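(* Let $2<p<\infty$. Then (a) $X_p\hookrightarrow \ell^2\oplus\ell^p$; (b) $\ell^2\oplus\ell^p\overset{c}{\hookrightarrow}X_p$; (c) $X_p\equiv \ell^2\oplus\ell^p$; (d) $X_p\not\overset{c}{\hookrightarrow}\ell^2\oplus\ell^p$; (e) $\left(\sum^{\oplus}\ell^2\right)_{\ell^p}\not\hookrightarrow X_p$; (f) $X_p\not\overset{c}{\hookrightarrow}\left(\sum^{\oplus}\ell^2\right)_{\ell^p}$; (g) $L^p\not\hookrightarrow X_p$; (h) statements (b), (d) and (f) also hold for $1<p<2$.
   Context: For Banach spaces $X,Y$: $X\hookrightarrow Y$ means $X$ is (linearly, boundedly) isomorphic to a closed subspace of $Y$; $X\overset{c}{\hookrightarrow}Y$ means $X$ is isomorphic to a complemented subspace of $Y$ (the range of a bounded linear projection on $Y$); $X\equiv Y$ means $X\hookrightarrow Y$ and $Y\hookrightarrow X$. A slashed symbol denotes negation. $L^p=L^p(0,1)$. $\left(\sum^{\oplus}X\right)_{\ell^p}$ is the $\ell^p$-sum of countably infinitely many copies of $X$. The space $X_p$: for $2<p<\infty$ and a sequence $w=\{w_n\}$ of positive scalars, $X_{p,w}$ is the Banach space of all scalar sequences $x=\{x_n\}$ with $\sum|x_n|^p<\infty$ and $\sum|w_nx_n|^2<\infty$, with norm $\max\{(\sum|x_n|^p)^{1/p},(\sum|w_nx_n|^2)^{1/2}\}$. The sequence $w$ satisfies condition $( * )$ if for each $\epsilon>0$, $\sum_{w_n<\epsilon}w_n^{2p/(p-2)}=\infty$.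 For fixed $p$, all $X_{p,w}$ with $w$ satisfying $( * )$ are mutually isomorphic; $X_p$ denotes (the isomorphism type of) any such $X_{p,w}$. For $1<q<2$ with conjugate index $p$ ($1/p+1/q=1$), $X_q$ is the dual of $X_p$. *)

(* Defs.v *)
From HB Require Import structures.
From mathcomp Require Import all_boot all_order all_algebra.
From mathcomp Require Import all_classical all_reals all_analysis.
From mathcomp Require Import measurable_realfun.

Set Implicit Arguments.
Unset Strict Implicit.
Unset Printing Implicit Defensive.

Import Order.TTheory GRing.Theory Num.Theory.
Import numFieldNormedType.Exports.

Local Open Scope classical_set_scope.
Local Open Scope ring_scope.

(** All Banach spaces are over the real scalar field [R : realType]. *)

Section embeddings.
Context {R : realType}.
Implicit Types X Y : normedModType R.

(** [T] is a bounded linear bijection of [X] onto the subspace [V] of [Y] whose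
    inverse [V -> X] is bounded. *)
Definition iso_onto X Y (T : {linear X -> Y}) (V : set Y) : Prop :=
  [/\ set_bij [set: X] V T, continuous T &
      exists C : R, forall x : X, `|x| <= C * `|T x|].

Definition embeds X Y : Prop :=
  exists (T : {linear X -> Y}) (V : set Y), closed V /\ iso_onto T V.

Definition bounded_projection Y (P : {linear Y -> Y}) : Prop :=
  continuous P /\ (forall y, P (P y) = P y).

Definition complementably_embeds X Y : Prop :=
  exists (P : {linear Y -> Y}) (T : {linear X -> Y}),
    bounded_projection P /\ iso_onto T (range P).

Definition mutually_embed X Y : Prop := embeds X Y /\ embeds Y X.

End embeddings.

(** The elements of finite norm, for an extended-real-valued norm on a real
    vector space, form a normed space; the [l^p]-sums, [X_{p,w}] and [L^p] are
    obtained in this way. *)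
Record enorm (R : realType) (E : lmodType R) := Enorm {
  enorm_fun :> E -> \bar R ;
  enorm_ge0 : forall x, (0 <= enorm_fun x)%E ;
  enormD : forall x y, (enorm_fun (x + y) <= enorm_fun x + enorm_fun y)%E ;
  enormZ : forall (a : R) x, (enorm_fun (a *: x) = `|a|%:E * enorm_fun x)%E ;
  enorm_eq0 : forall x, enorm_fun x = 0%E -> x = 0
}.

Definition enorm_fin (R : realType) (E : lmodType R) (N : enorm E) : {pred E} :=
  fun x => (N x < +oo)%E.

Record finite_part (R : realType) (E : lmodType R) (N : enorm E) := FinitePart {
  finite_part_val : E ;
  finite_partP : finite_part_val \in enorm_fin N
}.

Section finite_part.
Context {R : realType} {E : lmodType R} (N : enorm E).

Lemma enorm_fin_submod : submod_closed (enorm_fin N).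
Proof.
split=> [|a x y].
  by rewrite unfold_in /enorm_fin -(scale0r 0) enormZ normr0 mul0e ltry.
rewrite !unfold_in /enorm_fin => Nx Ny.
apply: (le_lt_trans (enormD _ _ _)); rewrite enormZ lte_add_pinfty//.
by rewrite lte_mul_pinfty.
Qed.

HB.instance Definition _ :=
  GRing.isSubmodClosed.Build R E (enorm_fin N) enorm_fin_submod.

HB.instance Definition _ := [isSub for @finite_part_val R E N].
HB.instance Definition _ := [Choice of finite_part N by <:].
HB.instance Definition _ := [SubChoice_isSubLmodule of finite_part N by <:].

Definition finite_part_norm (x : finite_part N) : R := fine (N (val x)).

Lemma finite_part_normE (x : finite_part N) :
  (finite_part_norm x)%:E = N (val x).
Proof.
by rewrite /finite_part_norm fineK// ge0_fin_numE ?enorm_ge0//; exact: (valP x).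
Qed.

Lemma finite_part_normD x y :
  finite_part_norm (x + y) <= finite_part_norm x + finite_part_norm y.
Proof. by rewrite -lee_fin EFinD !finite_part_normE; exact: enormD. Qed.

Lemma finite_part_normZ (a : R) x :
  finite_part_norm (a *: x) = `|a| * finite_part_norm x.
Proof. by apply: EFin_inj; rewrite EFinM !finite_part_normE; exact: enormZ. Qed.

Lemma finite_part_norm_eq0 x : finite_part_norm x = 0 -> x = 0.
Proof.
move=> x0; apply: val_inj; apply: (@enorm_eq0 _ _ N).
by rewrite -finite_part_normE x0.
Qed.

HB.instance Definition _ := Lmodule_isNormed.Build R (finite_part N)
  finite_part_normD finite_part_normZ finite_part_norm_eq0.

End finite_part.

Section sequence_spaces.
Context {R : realType}.
Implicit Types (p : R) (X : normedModType R) (w : nat -> R).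

(** [(\sum_n |x_n|^p)^(1/p)], see [ell_normE]. *)
Definition ell_norm p X (x : nat -> X) : \bar R :=
  'N[counting]_(p%:E)[(fun n => `|x n|%:E)]%E.

Lemma ell_normE p (p1 : 1 <= p) X (x : nat -> X) :
  ell_norm p x = ((\sum_(n <oo) (`|x n| `^ p)%:E) `^ p^-1)%E.
Proof.
rewrite /ell_norm Lnorm_counting ?(lt_le_trans _ p1)//.
by congr (_ `^ _)%E; apply: eq_eseriesr => n _; rewrite gee0_abs.
Qed.

Lemma ell_norm_ge0 p X (x : nat -> X) : (0 <= ell_norm p x)%E.
Proof. exact: Lnorm_ge0. Qed.

Lemma ell_norm_homo p (p1 : 1 <= p) X (Y : normedModType R) (x : nat -> X)
  (y : nat -> Y) : (forall n, `|x n| <= `|y n|) -> (ell_norm p x <= ell_norm p y)%E.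
Proof.
move=> xy; have p0 : 0 <= p by exact: le_trans p1.
rewrite !ell_normE//; apply: gt0_ler_poweR; rewrite ?invr_ge0 ?in_itv/= ?leey ?nneseries_ge0//.
by apply: lee_nneseries => // n _; rewrite lee_fin ge0_ler_powR// nnegrE.
Qed.

Lemma ell_normD p (p1 : 1 <= p) X (x y : nat -> X) :
  (ell_norm p (x + y)%R <= ell_norm p x + ell_norm p y)%E.
Proof.
apply: (@le_trans _ _ (ell_norm p ((Num.norm \o x) \+ (Num.norm \o y)))).
  by apply: ell_norm_homo => // n; rewrite /= ger0_norm// ler_normD.
rewrite /ell_norm.
rewrite (_ : (fun n => _) =
    EFin \o ((Num.norm \o x) \+ (Num.norm \o y)))%R; last first.
  by apply/funext => n; rewrite /= ger0_norm ?addr_ge0.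
exact: (@minkowski_EFin _ _ _ counting (Num.norm \o x) (Num.norm \o y) p).
Qed.

Lemma ell_normZ p (p1 : 1 <= p) X (a : R) (x : nat -> X) :
  (ell_norm p (a *: x)%R = `|a|%:E * ell_norm p x)%E.
Proof.
have p0 : 0 < p by exact: lt_le_trans p1.
rewrite !ell_normE//.
under eq_eseriesr do rewrite normrZ powRM// EFinM.
rewrite nneseriesZl// poweRM ?lee_fin ?powR_ge0 ?nneseries_ge0//.
by rewrite poweR_EFin -powRrM mulfV ?gt_eqF// powRr1.
Qed.

Lemma ell_norm_eq0 p (p1 : 1 <= p) X (x : nat -> X) :
  ell_norm p x = 0%E -> x = 0.
Proof.
have x0 n : (0%E <= (`|x n| `^ p)%:E)%E by rewrite lee_fin powR_ge0.
rewrite ell_normE// => /(poweR_eq0_eq0 (nneseries_ge0 (fun n _ _ => x0 n))) xs0.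
apply/funext => n; apply/eqP; rewrite -normr_eq0; apply/eqP.
apply: (@powR_eq0_eq0 _ _ p) => //; apply: EFin_inj; apply/eqP.
rewrite eq_le x0 andbT -[leRHS]xs0 (@nneseriesD1 _ _ n)// leeDl//.
exact: nneseries_ge0.
Qed.

Definition ell_enorm p (p1 : 1 <= p) X : enorm (nat -> X) :=
  Enorm (@ell_norm_ge0 p X) (ell_normD p1 (X := X)) (ell_normZ p1 (X := X))
    (ell_norm_eq0 p1 (X := X)).

(** The [l^p]-sum of countably many copies of [X]; [l^p] is the case [X = R]. *)
Definition ell_sum p (p1 : 1 <= p) X : normedModType R :=
  finite_part (ell_enorm p1 X).

Definition ell p (p1 : 1 <= p) : normedModType R := ell_sum p1 R.

Definition Xpw_norm p w (x : nat -> R) : \bar R :=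
  maxe (ell_norm p x) (ell_norm 2 (w \* x)).

Lemma Xpw_norm_ge0 p w x : (0 <= Xpw_norm p w x)%E.
Proof. by rewrite le_max ell_norm_ge0. Qed.

Lemma Xpw_normD p (p1 : 1 <= p) w (x y : nat -> R) :
  (Xpw_norm p w (x + y)%R <= Xpw_norm p w x + Xpw_norm p w y)%E.
Proof.
rewrite ge_max; apply/andP; split.
  by apply: (le_trans (ell_normD p1 _ _)); rewrite leeD// le_max lexx.
rewrite (_ : w \* (x + y) = (w \* x) + (w \* y)); last first.
  by apply/funext => n /=; rewrite mulrDr.
apply: (le_trans (ell_normD _ _ _)); first by rewrite ler1n.
by rewrite leeD// le_max lexx orbT.
Qed.

Lemma Xpw_normZ p (p1 : 1 <= p) w (a : R) (x : nat -> R) :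
  (Xpw_norm p w (a *: x)%R = `|a|%:E * Xpw_norm p w x)%E.
Proof.
rewrite /Xpw_norm maxe_pMr ?lee_fin// ell_normZ//; congr maxe.
rewrite -ell_normZ ?ler1n//; congr ell_norm.
by apply/funext => n /=; rewrite mulrCA.
Qed.

Lemma Xpw_norm_eq0 p (p1 : 1 <= p) w x : Xpw_norm p w x = 0%E -> x = 0.
Proof.
move=> x0; apply: (ell_norm_eq0 p1); apply/eqP.
by rewrite eq_le ell_norm_ge0 -x0 le_max lexx.
Qed.

Definition Xpw_enorm p (p1 : 1 <= p) w : enorm (nat -> R) :=
  Enorm (@Xpw_norm_ge0 p w) (Xpw_normD p1 w) (Xpw_normZ p1 w)
    (@Xpw_norm_eq0 p p1 w).

Definition Xpw p (p1 : 1 <= p) w : normedModType R :=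
  finite_part (Xpw_enorm p1 w).

Definition star_condition p w : Prop := forall e : R, 0 < e ->
  (\sum_(n <oo | (w n < e)%R) (w n `^ (2 * p / (p - 2)))%:E = +oo)%E.

End sequence_spaces.

Section dual.
Context {R : realType} (X : normedModType R).

Definition bounded_functional : {pred X -> R} :=
  fun f => `[< linear f /\ continuous f >].

Record dual := Dual {
  dual_val :> X -> R ;
  dualP : dual_val \in bounded_functional
}.

Lemma bounded_functional_submod : submod_closed bounded_functional.
Proof.
split=> [|a f g].
  apply/asboolP; split=> [b x y|x]; first by rewrite scaler0 addr0.
  exact: cst_continuous.
rewrite !unfold_in => /asboolP[lf cf] /asboolP[lg cg]; apply/asboolP; split.
  by move=> b x y; rewrite !fctE/= lf lg !scalerDr !scalerA [b * a]mulrC addrACA.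
move=> x; apply: cvgD; last exact: cg.
by apply: cvgZr; exact: cf.
Qed.

HB.instance Definition _ := GRing.isSubmodClosed.Build R (X -> R)
  bounded_functional bounded_functional_submod.

HB.instance Definition _ := [isSub for dual_val].
HB.instance Definition _ := [Choice of dual by <:].
HB.instance Definition _ := [SubChoice_isSubLmodule of dual by <:].

Definition dual_norm (f : dual) : R :=
  sup [set `|f x| | x in [set x : X | `|x| <= 1]].

Lemma dual_linear (f : dual) : linear f.
Proof. by have /asboolP[] := valP f. Qed.

Lemma dual_continuous (f : dual) : continuous f.
Proof. by have /asboolP[] := valP f. Qed.

HB.instance Definition _ (f : dual) :=
  GRing.isLinear.Build R X R *:%R (dual_val f) (dual_linear f).

Lemma dual_has_sup (f : dual) :
  has_sup [set `|f x| | x in [set x : X | `|x| <= 1]].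
Proof.
split; first by exists `|f 0|, 0 => //=; rewrite normr0.
have /linear_bounded_continuous/bounded_funP/(_ 1)[M fM] :
  continuous (f : {linear X -> R}) by exact: dual_continuous.
by exists M => _ [x /= x1 <-]; exact: fM.
Qed.

Lemma le_dual_norm (f : dual) x : `|x| <= 1 -> `|f x| <= dual_norm f.
Proof.
by move=> x1; apply: ub_le_sup; [exact: (dual_has_sup f).2|exists x].
Qed.

Lemma dual_norm_le (f : dual) (M : R) :
  (forall x, `|x| <= 1 -> `|f x| <= M) -> dual_norm f <= M.
Proof.
move=> fM; apply: ge_sup; first exact: (dual_has_sup f).1.
by move=> _ [x /= x1 <-]; exact: fM.
Qed.

Lemma dual_normD (f g : dual) : dual_norm (f + g) <= dual_norm f + dual_norm g.
Proof.
apply: dual_norm_le => x x1; apply: (le_trans (ler_normD (f x) (g x))).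
by rewrite lerD// le_dual_norm.
Qed.

Lemma dual_normZ (a : R) (f : dual) : dual_norm (a *: f) = `|a| * dual_norm f.
Proof.
have le_normZ (b : R) (g : dual) : dual_norm (b *: g) <= `|b| * dual_norm g.
  apply: dual_norm_le => x x1.
  by rewrite [(b *: g) x]/(b * g x) normrM ler_wpM2l// le_dual_norm.
apply/eqP; rewrite eq_le le_normZ/=.
have [->|a0] := eqVneq a 0.
  rewrite normr0 mul0r (le_trans (normr_ge0 ((0 *: f) 0)))// le_dual_norm//.
  by rewrite normr0.
by rewrite -ler_pdivlMl ?normr_gt0// -normfV -{1}(scale1r f) -(mulVf a0) -scalerA.
Qed.

Lemma dual_norm_eq0 (f : dual) : dual_norm f = 0 -> f = 0.
Proof.
move=> f0; suff fx0 x : f x = 0 by exact/val_inj/funext/fx0.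
apply/eqP; rewrite -normr_eq0.
have [->|x0] := eqVneq x 0; first by rewrite [X in `|X|](linear0 f) normr0.
have : `|f (`|x|^-1 *: x)| <= 0.
  by rewrite -f0 le_dual_norm// normrZ normfV normr_id mulVf ?normr_eq0.
rewrite linearZ/= normrM pmulr_rle0 ?normr_gt0 ?invr_eq0 ?normr_eq0//.
by rewrite normr_le0 -normr_eq0.
Qed.

HB.instance Definition _ := Lmodule_isNormed.Build R dual
  dual_normD dual_normZ dual_norm_eq0.

End dual.

Section Lspace.
Context d {T : measurableType d} {R : realType}.
Variable mu : {measure set T -> \bar R}.
Local Open Scope quotient_scope.

(** Classes of measurable functions [T -> R] modulo equality [mu]-a.e. The
    library's [LspaceType] consists of the same classes (up to the display of
    the sigma-algebra of [R]) but carries no vector space structure. *)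
Local Notation aefun := {mfun_ mu, T >-> R}.

Definition ae_class (f : {mfun T >-> R}) : aefun := \pi_aefun f.
Definition ae_repr (f : aefun) : {mfun T >-> R} := repr f.

Lemma ae_reprK : cancel ae_repr ae_class.
Proof. exact: reprK. Qed.

Lemma ae_classP (f g : {mfun T >-> R}) :
  ae_class f = ae_class g <-> f = g %[ae mu].
Proof.
split=> [/eqP|fg]; first by rewrite eqmodE => /asboolP.
by apply/eqP; rewrite eqmodE; apply/asboolP.
Qed.

Lemma ae_classK (f : {mfun T >-> R}) : ae_repr (ae_class f) = f %[ae mu].
Proof. by apply/ae_classP; rewrite ae_reprK. Qed.

Definition ae_zero : aefun := ae_class 0.
Definition ae_opp (f : aefun) : aefun := ae_class (- ae_repr f).
Definition ae_add (f g : aefun) : aefun := ae_class (ae_repr f + ae_repr g).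
Definition ae_scale (a : R) (f : aefun) : aefun := ae_class (a *: ae_repr f).

Lemma ae_addE (f g : {mfun T >-> R}) :
  ae_add (ae_class f) (ae_class g) = ae_class (f + g).
Proof.
apply/ae_classP; apply: filterS2 (ae_classK f) (ae_classK g) => x fx gx _.
by congr (_ + _); [exact: fx|exact: gx].
Qed.

Lemma ae_oppE (f : {mfun T >-> R}) : ae_opp (ae_class f) = ae_class (- f).
Proof.
apply/ae_classP; apply: filterS (ae_classK f) => x fx _.
by congr (- _); exact: fx.
Qed.

Lemma ae_scaleE (a : R) (f : {mfun T >-> R}) :
  ae_scale a (ae_class f) = ae_class (a *: f).
Proof.
apply/ae_classP; apply: filterS (ae_classK f) => x fx _.
by congr (_ * _); exact: fx.
Qed.

Lemma ae_addA : associative ae_add.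
Proof.
move=> f g h; rewrite -(ae_reprK f) -(ae_reprK g) -(ae_reprK h) !ae_addE.
by rewrite addrA.
Qed.

Lemma ae_addC : commutative ae_add.
Proof. by move=> f g; rewrite /ae_add addrC. Qed.

Lemma ae_add0 : left_id ae_zero ae_add.
Proof. by move=> f; rewrite -(ae_reprK f) ae_addE add0r. Qed.

Lemma ae_addN : left_inverse ae_zero ae_opp ae_add.
Proof. by move=> f; rewrite -(ae_reprK f) ae_oppE ae_addE addNr. Qed.

HB.instance Definition _ :=
  GRing.isZmodule.Build {mfun_ mu, T >-> R} ae_addA ae_addC ae_add0 ae_addN.

Lemma ae_scaleA a b f : ae_scale a (ae_scale b f) = ae_scale (a * b) f.
Proof. by rewrite -(ae_reprK f) !ae_scaleE scalerA. Qed.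

Lemma ae_scale1 : left_id 1 ae_scale.
Proof. by move=> f; rewrite -(ae_reprK f) ae_scaleE scale1r. Qed.

Lemma ae_scaleDr : right_distributive ae_scale +%R.
Proof.
move=> a f g; rewrite -(ae_reprK f) -(ae_reprK g).
by rewrite [_ + _]ae_addE !ae_scaleE scalerDr [RHS]ae_addE.
Qed.

Lemma ae_scaleDl f : {morph ae_scale^~ f : a b / a + b}.
Proof.
by move=> a b; rewrite -(ae_reprK f) !ae_scaleE scalerDl [RHS]ae_addE.
Qed.

HB.instance Definition _ := GRing.Zmodule_isLmodule.Build R {mfun_ mu, T >-> R}
  ae_scaleA ae_scale1 ae_scaleDr ae_scaleDl.

Variables (p : R) (p1 : 1 <= p).

Definition Lspace_norm (f : aefun) : \bar R := 'N[mu]_(p%:E)[EFin \o f]%E.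

Lemma Lspace_norm_class (f : {mfun T >-> R}) :
  Lspace_norm (ae_class f) = 'N[mu]_(p%:E)[EFin \o f]%E.
Proof.
rewrite /Lspace_norm unlock; congr (_ `^ _)%E; apply: ae_eq_integral => //.
- apply: (measurableT_comp (measurable_poweR p)) => //.
  exact/measurableT_comp/measurable_EFinP.
- apply: (measurableT_comp (measurable_poweR p)) => //.
  exact/measurableT_comp/measurable_EFinP.
- apply: filterS (ae_classK f) => x fx _ /=.
  by congr (`|_%:E| `^ _)%E; exact: fx.
Qed.

Lemma Lspace_norm_ge0 (f : aefun) : (0 <= Lspace_norm f)%E.
Proof. exact: Lnorm_ge0. Qed.

Lemma Lspace_normD (f g : aefun) :
  (Lspace_norm (f + g)%R <= Lspace_norm f + Lspace_norm g)%E.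
Proof.
rewrite -(ae_reprK f) -(ae_reprK g) [X in Lspace_norm X]ae_addE !Lspace_norm_class.
exact: minkowski_EFin.
Qed.

Lemma Lspace_normZ (a : R) (f : aefun) :
  (Lspace_norm (a *: f)%R = `|a|%:E * Lspace_norm f)%E.
Proof.
rewrite -(ae_reprK f) [X in Lspace_norm X]ae_scaleE !Lspace_norm_class.
have p0 : 0 < p by exact: lt_le_trans p1.
rewrite unlock.
under eq_integral do rewrite /= normrM powRM// EFinM.
rewrite ge0_integralZl//.
- rewrite poweRM ?lee_fin ?powR_ge0 ?integral_ge0//.
  by rewrite poweR_EFin -powRrM mulfV ?gt_eqF// powRr1.
- apply/measurable_EFinP; apply: (measurableT_comp (measurable_powR p)) => //.
  exact: measurableT_comp.
Qed.

Lemma Lspace_norm_eq0 (f : aefun) : Lspace_norm f = 0%E -> f = 0.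
Proof.
rewrite -(ae_reprK f) Lspace_norm_class => /Lnorm_eq0_eq0 f0; apply/ae_classP.
have := f0 _ _; rewrite lte_fin (lt_le_trans _ p1)// => /(_ _ isT) {}f0.
have /f0 : measurable_fun setT (EFin \o ae_repr f) by exact/measurable_EFinP.
by apply: filterS => x /= fx /fx[].
Qed.

Definition Lspace_enorm : enorm {mfun_ mu, T >-> R} :=
  Enorm Lspace_norm_ge0 Lspace_normD Lspace_normZ Lspace_norm_eq0.

Definition Lspace : normedModType R := finite_part Lspace_enorm.

End Lspace.

(** [L^p(0, 1)], as functions on [R] modulo equality a.e. on [(0, 1)]. *)
Definition Lp01 (R : realType) (p : R) (p1 : 1 <= p) : normedModType R :=
  Lspace (mrestr (@lebesgue_measure R) (measurable_itv `]0, 1[)) p1.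

Section exponents.
Context {R : realType}.
Implicit Types p q : R.

Lemma ge1_2 : (1 : R) <= 2.
Proof. by rewrite ler1n. Qed.

Lemma gt2_ge1 p : 2 < p -> 1 <= p.
Proof. by move=> p2; rewrite (le_trans ge1_2)// ltW. Qed.

Lemma conjugate_ge1 p q : 1 < p -> p^-1 + q^-1 = 1 -> 1 <= q.
Proof.
move=> p1 pq; have p0 : 0 < p by exact: lt_trans p1.
have qE : q^-1 = 1 - p^-1 by rewrite -pq addrAC subrr add0r.
have pV : 0 < 1 - p^-1 by rewrite subr_gt0 invf_lt1.
rewrite -[q]invrK qE invf_ge1// gerBl invr_ge0 ltW//.
Qed.

End exponents.

Definition ell2 (R : realType) : normedModType R := ell (@ge1_2 R).

(* Main.v *)
Require Import Defs.
From HB Require Import structures.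
From mathcomp Require Import all_boot all_order all_algebra.
From mathcomp Require Import all_classical all_reals all_analysis.
From mathcomp Require Import measurable_realfun lra ring.

Set Implicit Arguments.
Unset Strict Implicit.
Unset Printing Implicit Defensive.

Import Order.TTheory GRing.Theory Num.Theory.
Import numFieldNormedType.Exports.

Local Open Scope classical_set_scope.
Local Open Scope ring_scope.

(** Write gamma = 1/2 - 1/p > 0 and Y_p = (sum l^2)_p.

    (a), (c) The norm of X_{p,w} is the maximum of the norms of w x in l^2 and
    of x in l^p, so x |-> (w x, x) is an isometry into l^2 + l^p, with closed
    range ([Xpw_embeds]).

    (b) A block of unit vectors on which the sum S of w^(2p/(p-2)) is finite and
    positive carries a vector of norm 1 in l^p and S^gamma in the weighted l^2
    norm, and there is a biorthogonal functional that is just as well behaved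
    for both norms. Hence X_{p,w'} is a contractive retract of X_{p,w} for the
    weights w' j = S_j^gamma ([block_retract]). The condition on w allows
    the S_j to be prescribed up to a factor 2 ([star_weights]): weights of order
    1 produce l^2, rapidly decreasing weights produce l^p.

    (f) Suppose that X_{p,w} is complemented in Y_p with constant C. So is
    X_{p,w'}, with the same C, for w' of constant order eps small against C. In
    X_{p,w'}, a sum of n unit vectors has norm about eps n^(1/2) for large n,
    and a sum of n coordinate functionals has norm at most a multiple
    (depending on eps) of n^(1/2). The second estimate, transported to Y_p,
    forbids a gliding hump, because n disjoint blocks in Y_p only have norm
    n^(1/p): the functionals live uniformly on finitely many copies of l^2
    ([uniform_tails]). The vectors on which they take the value 1 therefore have
    a component of norm at least 1/(2C) there; but infinitely many bounded
    vectors of this kind on finitely many copies of l^2 have signed sums of norm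
    at least n^(1/2) / C', where C' does not depend on eps
    ([no_almost_biorthogonal]). (d) follows since l^2 + l^p is complemented
    in Y_p.

    (e), (g) Both (sum l^2)_p and L^p contain disjoint subspaces D_k, each of
    them containing an infinite separated sequence for a Hilbert norm weaker
    than the given one. Signed sums of differences of these show that the l^p
    component of an operator from D_k to l^2 + l^p is arbitrarily small on
    some unit vector z_k ([small_vector]). If the operator is an embedding, the
    l^2 components of the z_k are bounded below, so that a signed sum of n of
    them has norm at least of order n^(1/2) and not n^(1/p)
    ([no_embedding_sum]). No Khintchine inequality is involved: the lower
    estimates hold for well chosen signs by the parallelogram law alone
    ([exists_signs]).

    (h) Retractions dualize, (l^2 + l^q)' = l^2 + l^p, and Y_p' = Y_q. The
    argument for (f) only uses operators X -> Y and Y -> X'' whose composite is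
    the canonical embedding, and these also arise as adjoints when the dual of
    X is complemented in the dual of Y ([no_weak_retract]). *)

(** * Bounded maps, retracts and dual spaces *)

Section bounded_maps.
Context {R : realType}.
Implicit Types X Y Z : normedModType R.

Lemma linear_of (X Y : lmodType R) (f : X -> Y) :
  linear f -> exists g : {linear X -> Y}, g =1 f.
Proof.
move=> lf.
pose g : {linear X -> Y} := HB.pack f (GRing.isLinear.Build R X Y *:%R f lf).
by exists g.
Qed.

Lemma continuous_linearP X Y (T : {linear X -> Y}) :
  continuous T <-> exists2 C, 0 < C & forall x, `|T x| <= C * `|x|.
Proof.
split=> [/linear_bounded_continuous/linear_boundedP[M [Mr MT]]|[C C0 CT]].
  exists (`|M| + 1); first by rewrite ltr_wpDl.
  by apply: MT; rewrite (le_lt_trans (ler_norm M))// ltrDl.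
apply/linear_bounded_continuous/linear_boundedP; exists C; split.
  exact: gtr0_real.
by move=> D CD x; rewrite (le_trans (CT x))// ler_wpM2r// ltW.
Qed.

Lemma dual_le X (f : dual X) x : `|f x| <= `|f| * `|x|.
Proof.
have [->|x0] := eqVneq x 0.
  by rewrite [X in `|X|](linear0 f) !normr0 mulr0.
have nx : 0 < `|x| by rewrite normr_gt0.
rewrite -ler_pdivrMr// -(normr_id x) -normfV mulrC -normrM.
have -> : `|x|^-1 * f x = f (`|x|^-1 *: x) by rewrite linearZ.
rewrite le_dual_norm//; by rewrite normrZ normfV normr_id mulVf ?gt_eqF.
Qed.

Lemma dual_norm_leP X (f : dual X) C : 0 <= C ->
  (forall x, `|f x| <= C * `|x|) -> `|f| <= C.
Proof.
move=> C0 fC; apply: dual_norm_le => x x1; apply: (le_trans (fC x)).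
by rewrite ler_piMr.
Qed.

Lemma dual_of X (f : X -> R) C : linear f -> (forall x, `|f x| <= C * `|x|) ->
  exists g : dual X, g =1 f.
Proof.
move=> lf fC; have [g gf] := linear_of lf.
suff fP : f \in @bounded_functional _ X by exists (Dual fP).
apply/asboolP; split=> //; rewrite (_ : f = g); last exact/funext.
apply/(continuous_linearP g); exists (`|C| + 1); first by rewrite ltr_wpDl.
move=> x; rewrite gf (le_trans (fC x))// ler_wpM2r// (le_trans (ler_norm C))//.
by rewrite lerDl.
Qed.

Lemma dual_map_of X Y (F : X -> Y -> R) C : 0 <= C -> linear F ->
  (forall x, linear (F x)) -> (forall x y, `|F x y| <= C * `|x| * `|y|) ->
  exists T : {linear X -> dual Y},
    (forall x y, T x y = F x y) /\ (forall x, `|T x| <= C * `|x|).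
Proof.
move=> C0 lF lFx FC.
have /choice[T TF] x : exists g : dual Y, g =1 F x by exact: dual_of (FC x).
have lT : linear T.
  move=> a x y; apply: val_inj; apply/funext => z.
  by rewrite [LHS]TF lF [RHS]/(a * T x z + T y z) !TF.
have [S ST] := linear_of lT; exists S; split=> [x y|x]; first by rewrite ST TF.
apply: dual_norm_leP; first by rewrite mulr_ge0.
by move=> y; rewrite ST TF.
Qed.

Lemma bidual_of X : exists T : {linear X -> dual (dual X)},
  (forall x f, T x f = f x) /\ (forall x, `|T x| <= `|x|).
Proof.
have [|a x y|x a f g|x f|T [TE TC]] := @dual_map_of X (dual X) (fun x f => f x) 1.
- exact: ler01.
- by apply/funext => f; rewrite linearP.
- by [].
- by rewrite mul1r mulrC dual_le.
by exists T; split=> // x; rewrite -[leRHS]mul1r.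
Qed.

Lemma finite_part_map_of X (E : lmodType R) (N : enorm E) (F : X -> E) C :
  linear F -> (forall x, (N (F x) <= (C * `|x|)%:E)%E) ->
  exists T : {linear X -> finite_part N},
    (forall x, val (T x) = F x) /\ (forall x, `|T x| <= C * `|x|).
Proof.
move=> lF FC.
have Ffin x : F x \in enorm_fin N.
  by rewrite unfold_in /enorm_fin (le_lt_trans (FC x))// ltry.
pose T x := FinitePart (Ffin x).
have lT : linear T by move=> a x y; apply: val_inj; rewrite !linearP/= lF.
have [S ST] := linear_of lT; exists S; split=> x; rewrite ST//.
by rewrite -lee_fin [leLHS]finite_part_normE FC.
Qed.

(** The identity of [X] factors through [Y] with constant [C]. Unlike
    [complementably_embeds] it keeps track of the constant, which has to be the
    same for all the spaces [X_{p,w'}] obtained from one [X_{p,w}]. *)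
Definition retract (C : R) X Y : Prop :=
  exists (J : {linear X -> Y}) (Q : {linear Y -> X}),
    [/\ forall x, `|J x| <= C * `|x|, forall y, `|Q y| <= C * `|y| &
        forall x, Q (J x) = x].

Lemma retract_trans C D X Y Z : 0 <= C -> 0 <= D ->
  retract C X Y -> retract D Y Z -> retract (D * C) X Z.
Proof.
move=> C0 D0 [J [Q [JC QC QJ]]] [J' [Q' [J'C Q'C QJ']]].
exists (J' \o J : {linear _ -> _}), (Q \o Q' : {linear _ -> _}).
split=> [x|x|x] /=; last by rewrite QJ' QJ.
  by rewrite -mulrA (le_trans (J'C _))// ler_wpM2l.
by rewrite mulrAC mulrC (le_trans (QC _))// ler_wpM2l// mulrC.
Qed.

(** The adjoints of [Q] and [J] compose in the opposite order, so that
    they are again an injection and its left inverse. *)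
Lemma retract_dual C X Y : 0 <= C -> retract C X Y -> retract C (dual X) (dual Y).
Proof.
move=> C0 [J [Q [JC QC QJ]]].
have [|f a x y|f y|J' [J'E J'C]] :=
    @dual_map_of (dual X) Y (fun f y => f (Q y)) _ C0.
- by [].
- by rewrite !linearP.
- rewrite mulrAC mulrC (le_trans (dual_le _ _))// ler_wpM2l//.
have [|f a x y|f y|Q' [Q'E Q'C]] :=
    @dual_map_of (dual Y) X (fun f x => f (J x)) _ C0.
- by [].
- by rewrite !linearP.
- rewrite mulrAC mulrC (le_trans (dual_le _ _))// ler_wpM2l//.
exists J', Q'; split=> // f; apply: val_inj; apply/funext => x.
by rewrite [LHS]Q'E J'E QJ.
Qed.

(** From a projection [P] and an isomorphism [T] onto its range one gets
    [J = T] and [Q = T^-1 P]; conversely [J Q] is a projection. *)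
Lemma complementably_embedsP X Y :
  complementably_embeds X Y <-> exists2 C, 0 < C & retract C X Y.
Proof.
split.
  move=> [P [T [[/continuous_linearP[p p0 Pp] PP] [[Tfun Tinj Tsurj]
    /continuous_linearP[t t0 Tt] [c cT]]]]].
  have /choice[Q QE] y : exists x, T x = P y.
    by have [x _ <-] := Tsurj (P y) (ex_intro2 _ _ y I erefl); exists x.
  have TI x x' : T x = T x' -> x = x' by apply: Tinj; rewrite inE.
  have lQ : linear Q by move=> a x y; apply: TI; rewrite linearP !QE linearP.
  have [S SQ] := linear_of lQ.
  exists (Num.max t (`|c| * p)); first by rewrite lt_max t0.
  exists T, S; split=> [x|y|x].
  - by rewrite (le_trans (Tt x))// ler_wpM2r// le_max lexx.
  - rewrite SQ (le_trans (cT _))// QE.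
    rewrite (@le_trans _ _ (`|c| * `|P y|)) ?ler_wpM2r ?ler_norm//.
    rewrite (@le_trans _ _ (`|c| * (p * `|y|))) ?ler_wpM2l//.
    by rewrite mulrA ler_wpM2r// le_max lexx orbT.
  - apply: TI; rewrite SQ QE.
    by have [y _ <-] := Tfun x I; rewrite PP.
move=> [C C0 [J [Q [JC QC QJ]]]].
pose P : {linear Y -> Y} := (J \o Q : {linear _ -> _}).
have rP : range P = range J.
  apply/seteqP; split=> [_ [y _ <-]|_ [x _ <-]]; first by exists (Q y).
  by exists (J x) => //=; rewrite QJ.
exists P, J; split.
  split; last by move=> y /=; rewrite QJ.
  apply/continuous_linearP; exists (C * C); first by rewrite mulr_gt0.
  by move=> y /=; rewrite -mulrA (le_trans (JC _))// ler_wpM2l// ltW.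
rewrite rP; split.
- split.
  + by move=> x _; exists x.
  + by move=> x y _ _ /(congr1 Q); rewrite !QJ.
  + by move=> _ [x _ <-]; exists x.
- by apply/continuous_linearP; exists C.
- by exists C => x; rewrite -{1}(QJ x).
Qed.

Lemma closed_kernel X Y (T : {linear X -> Y}) :
  continuous T -> closed [set x | T x = 0].
Proof.
move=> cT; apply: (@preimage_closed _ _ T [set 0]) => //.
exact/accessible_closed_set1/hausdorff_accessible/norm_hausdorff.
Qed.

(** The range of a projection [P] is the kernel of [P - id], hence closed. *)
Lemma complementably_embeds_embeds X Y : complementably_embeds X Y -> embeds X Y.
Proof.
move=> [P [T [[cP PP] TP]]]; exists T, (range P); split=> //.
have [S SE] : exists S : {linear Y -> Y}, S =1 (fun y => P y - y).
  apply: linear_of => a x y; rewrite linearP scalerBr opprD addrACA; congr (_ + _).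
rewrite (_ : range P = [set y | S y = 0]).
  apply: closed_kernel.
  have [C C0 CP] := (continuous_linearP P).1 cP.
  apply/continuous_linearP; exists (C + 1); first by rewrite ltr_wpDl// ltW.
  by move=> y; rewrite SE (le_trans (ler_normB _ _))// mulrDl mul1r lerD.
apply/seteqP; split=> [_ [y _ <-]|y /= Sy]; first by rewrite /= SE PP subrr.
by exists y => //; apply/eqP; rewrite -subr_eq0 -SE Sy.
Qed.

Lemma pair_map_of X Y Z (S : {linear X -> Y}) (T : {linear X -> Z}) :
  exists U : {linear X -> (Y * Z)%type}, forall x, U x = (S x, T x).
Proof. by apply: linear_of => a x y; rewrite !linearP. Qed.

Lemma pair_normE X Y (x : X * Y) : `|x| = Num.max `|x.1| `|x.2|.
Proof. by []. Qed.

End bounded_maps.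

(** * Coordinates in an l^p-sum *)

Section powers.
Context {R : realType}.
Implicit Types (a b e p : R).

Lemma powRK p a : p != 0 -> 0 <= a -> (a `^ p) `^ p^-1 = a.
Proof. by move=> p0 a0; rewrite -powRrM mulfV// powRr1. Qed.

Lemma powRVK p a : p != 0 -> 0 <= a -> (a `^ p^-1) `^ p = a.
Proof. by move=> p0 a0; rewrite -powRrM mulVf// powRr1. Qed.

Lemma ler_powR2 p a b : 0 < p -> 0 <= a -> 0 <= b -> (a `^ p <= b `^ p) = (a <= b).
Proof.
move=> p0 a0 b0; apply/idP/idP => [|ab]; last first.
  by apply: ge0_ler_powR => //; rewrite ltW.
by apply: contraTT; rewrite -!ltNge => ba; apply: gt0_ltr_powR.
Qed.

Lemma powR_unbounded p (L : R) : 0 < p -> exists n : nat, L < n.+1%:R `^ p.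
Proof.
move=> p0; pose M := `|L| + 1.
have M0 : 0 <= M by rewrite addr_ge0.
exists (Num.trunc (M `^ p^-1)); apply: (@lt_le_trans _ _ M).
  by rewrite (le_lt_trans (ler_norm L))// ltrDl.
rewrite -[leLHS](@powRVK p) ?gt_eqF// ler_powR2 ?powR_ge0//.
by apply/ltW; rewrite truncnS_gt.
Qed.

Lemma powR2 a : 0 <= a -> a `^ 2 = a ^+ 2.
Proof. exact: powR_mulrn. Qed.

(** Continuity of the power, in the form in which it absorbs small errors. *)
Lemma powRD_le p a : 0 < p -> 0 <= a ->
  exists2 e, 0 < e & (a + e) `^ p <= a `^ p + 1.
Proof.
move=> p0 a0; exists ((a `^ p + 1) `^ p^-1 - a); last first.
  by rewrite addrC subrK powRVK ?gt_eqF// addr_ge0 ?powR_ge0.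
rewrite subr_gt0 -[ltLHS](@powRK p) ?gt_eqF//.
by apply: gt0_ltr_powR; rewrite ?invr_gt0 ?nnegrE ?addr_ge0 ?powR_ge0// ltrDl.
Qed.

End powers.

Section ell_sum.
Context {R : realType} (p : R) (p1 : 1 <= p) (X : normedModType R).
Local Notation E := (ell_sum p1 X).
Implicit Types (x y : E) (u : nat -> X).

Let p0 : 0 < p. Proof. exact: lt_le_trans p1. Qed.
Let pn0 : p != 0. Proof. exact: lt0r_neq0. Qed.

(** Together with [ell_partial] this reduces the infinite norms to real finite
    sums. *)
Lemma ell_norm_le u (M : R) : 0 <= M ->
  (forall n, \sum_(0 <= i < n) `|u i| `^ p <= M `^ p) -> (ell_norm p u <= M%:E)%E.
Proof.
move=> M0 uM; rewrite ell_normE//.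
rewrite (@le_trans _ _ ((M `^ p)%:E `^ p^-1)%E)//; last first.
  by rewrite poweR_EFin powRK.
apply: gt0_ler_poweR; rewrite ?invr_ge0 ?in_itv/= ?leey ?andbT ?(ltW p0)//.
- by apply: nneseries_ge0 => n _ _; rewrite lee_fin powR_ge0.
- by rewrite lee_fin powR_ge0.
apply: lime_le; first by apply: is_cvg_nneseries => n _ _; rewrite lee_fin powR_ge0.
by apply: nearW => n; rewrite sumEFin lee_fin.
Qed.

Lemma ell_sum_normE x : ((`|x| `^ p)%:E = \sum_(n <oo) (`|finite_part_val x n| `^ p)%:E)%E.
Proof.
have xE : (`|x|%:E = ell_norm p (finite_part_val x))%E by exact: finite_part_normE.
rewrite -poweR_EFin xE ell_normE// -poweRrM ?mulVf ?poweRe1//.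
by apply: nneseries_ge0 => n _ _; rewrite lee_fin powR_ge0.
Qed.

Lemma ell_sum_cvg x :
  (fun n => \sum_(0 <= i < n) `|finite_part_val x i| `^ p) @ \oo --> `|x| `^ p.
Proof.
suff : (EFin \o (fun n => \sum_(0 <= i < n) `|finite_part_val x i| `^ p)) @ \oo -->
    (`|x| `^ p)%:E by move=> /fine_cvgP[].
have /cvg_ex[l xl] : cvgn (fun n => \sum_(0 <= i < n) (`|finite_part_val x i| `^ p)%:E)%E.
  by apply: is_cvg_nneseries => n _ _; rewrite lee_fin powR_ge0.
rewrite (_ : EFin \o _ = fun n => (\sum_(0 <= i < n) (`|finite_part_val x i| `^ p)%:E)%E).
  by rewrite ell_sum_normE; move/cvg_lim : (xl) => ->.
by apply/funext => n; rewrite sumEFin.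
Qed.

Lemma ell_partial x n : \sum_(0 <= i < n) `|finite_part_val x i| `^ p <= `|x| `^ p.
Proof.
rewrite -lee_fin ell_sum_normE -sumEFin.
by apply: nneseries_lim_ge => i _; rewrite lee_fin powR_ge0.
Qed.

Lemma ell_coord x i : `|finite_part_val x i| <= `|x|.
Proof.
rewrite -(@ler_powR2 _ p)//; apply: le_trans (ell_partial x i.+1).
by rewrite big_nat_recr//= lerDr sumr_ge0// => j _; rewrite powR_ge0.
Qed.

Lemma ell_le x (M : R) : 0 <= M ->
  (forall n, \sum_(0 <= i < n) `|finite_part_val x i| `^ p <= M `^ p) -> `|x| <= M.
Proof.
by move=> M0 xM; rewrite -lee_fin [leLHS]finite_part_normE; exact: ell_norm_le.
Qed.

Lemma ell_lep x (B : R) :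
  (forall n, \sum_(0 <= i < n) `|finite_part_val x i| `^ p <= B) -> `|x| `^ p <= B.
Proof.
move=> xB.
have B0 : 0 <= B by have := xB 0; rewrite big_geq.
rewrite -[leRHS](@powRVK _ p)// ler_powR2 ?powR_ge0//; apply: ell_le => [|n].
  exact: powR_ge0.
by rewrite powRVK.
Qed.

Lemma ell_fin u (B : R) : (forall n, \sum_(0 <= i < n) `|u i| `^ p <= B) ->
  u \in enorm_fin (ell_enorm p1 X).
Proof.
move=> uB; have B0 : 0 <= B by have := uB 0; rewrite big_geq.
rewrite unfold_in /enorm_fin; apply: le_lt_trans (ltry (B `^ p^-1)).
by apply: ell_norm_le => [|n]; rewrite ?powR_ge0// powRVK.
Qed.

Lemma ell_ext x y : (forall i, finite_part_val x i = finite_part_val y i) -> x = y.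
Proof. by move=> xy; apply: val_inj; apply/funext. Qed.

Lemma ell_addE x y i : finite_part_val (x + y) i = finite_part_val x i + finite_part_val y i.
Proof. by []. Qed.
Lemma ell_subE x y i : finite_part_val (x - y) i = finite_part_val x i - finite_part_val y i.
Proof. by []. Qed.
Lemma ell_scaleE (a : R) x i : finite_part_val (a *: x) i = a *: finite_part_val x i.
Proof. by []. Qed.
Lemma ell_sumE (I : Type) (s : seq I) (P : pred I) (f : I -> E) i :
  finite_part_val (\sum_(j <- s | P j) f j) i = \sum_(j <- s | P j) finite_part_val (f j) i.
Proof. by elim/big_rec2: _ => // j a b _ <-; rewrite ell_addE. Qed.

Lemma ell_mask_fin (A : pred nat) x :
  (fun i => if A i then finite_part_val x i else 0) \in enorm_fin (ell_enorm p1 X).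
Proof.
apply: (@ell_fin _ (`|x| `^ p)) => n; apply: le_trans (ell_partial x n).
apply: ler_sum => i _; case: ifP => // _.
by rewrite normr0 powR0// powR_ge0.
Qed.
Definition ell_mask (A : pred nat) x : E := FinitePart (ell_mask_fin A x).

Lemma ell_maskE A x i : finite_part_val (ell_mask A x) i = if A i then finite_part_val x i else 0.
Proof. by []. Qed.

Lemma ell_mask_le A x : `|ell_mask A x| <= `|x|.
Proof.
apply: ell_le => // n; apply: le_trans (ell_partial x n).
apply: ler_sum => i _; rewrite ?ell_maskE; case: ifP => // _.
by rewrite normr0 powR0// powR_ge0.
Qed.

Lemma ell_headtail N x :
  ell_mask (fun i => (i < N)%N) x + ell_mask (fun i => (N <= i)%N) x = x.
Proof.
apply: ell_ext => i; rewrite ell_addE ?ell_maskE.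
by case: leqP; rewrite ?addr0 ?add0r.
Qed.

Lemma ell_disjointD x y : (forall i, finite_part_val x i = 0 \/ finite_part_val y i = 0) ->
  `|x + y| `^ p <= `|x| `^ p + `|y| `^ p.
Proof.
move=> xy; apply: ell_lep => n.
apply: le_trans (lerD (ell_partial x n) (ell_partial y n)).
rewrite -big_split; apply: ler_sum => i _.
by rewrite ell_addE; case: (xy i) => ->; rewrite normr0 (powR0 pn0) ?add0r ?addr0/= ?add0r ?addr0.
Qed.

Lemma ell_tail_small x (e : R) : 0 < e -> exists N, forall M, (N <= M)%N ->
  `|ell_mask (fun i => (M <= i)%N) x| <= e.
Proof.
move=> e0; have /cvgrPdist_le/(_ (e `^ p)) := @ell_sum_cvg x.
rewrite powR_gt0// => /(_ isT)[N _ NP]; exists N => M NM.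
apply: ell_le => [|n]; first exact: ltW.
have := NP M NM; rewrite /= ler_distl => /andP[_ xM].
have [nM|Mn] := leqP n M.
  rewrite big_nat big1 ?powR_ge0// => i /andP[_ iN].
  by rewrite ?ell_maskE leqNgt (leq_trans iN nM)/= normr0 powR0.
have -> : \sum_(0 <= i < n) `|finite_part_val (ell_mask (leq M) x) i| `^ p =
          \sum_(M <= i < n) `|finite_part_val x i| `^ p.
  rewrite (big_cat_nat (leq0n M) (ltnW Mn)) /= big_nat big1 ?add0r => [|i /andP[_ iM]].
    by rewrite !big_nat; apply: eq_bigr => i /andP[Mi _]; rewrite ?ell_maskE Mi.
  by rewrite ?ell_maskE leqNgt iM/= normr0 powR0.
have := ell_partial x n; rewrite (big_cat_nat (leq0n M) (ltnW Mn)) /=.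
by lra.
Qed.

Lemma ell_single_fin (i : nat) (a : X) :
  (fun j => if j == i then a else 0) \in enorm_fin (ell_enorm p1 X).
Proof.
apply: (@ell_fin _ (`|a| `^ p)) => n.
have [ni|ni] := leqP n i.
  rewrite big_nat big1 ?powR_ge0// => j /andP[_ jn].
  by rewrite ltn_eqF ?(leq_trans jn)// normr0 powR0.
rewrite (bigD1_seq i) ?mem_index_iota ?iota_uniq//= eqxx.
by rewrite big1 ?addr0// => j /negPf->; rewrite normr0 powR0.
Qed.
Definition ell_single i a : E := FinitePart (ell_single_fin i a).

Lemma ell_singleE i a j : finite_part_val (ell_single i a) j = if j == i then a else 0.
Proof. by []. Qed.

Lemma ell_single_norm i a : `|ell_single i a| = `|a|.
Proof.
apply/eqP; rewrite eq_le; apply/andP; split; last first.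
  by have := ell_coord (ell_single i a) i; rewrite ?ell_singleE eqxx.
apply: ell_le => // n.
have [ni|ni] := leqP n i.
  rewrite big_nat big1 ?powR_ge0// => j /andP[_ jn].
  by rewrite ?ell_singleE ltn_eqF ?(leq_trans jn)// normr0 powR0.
rewrite (bigD1_seq i) ?mem_index_iota ?iota_uniq//= eqxx.
by rewrite big1 ?addr0// => j /negPf jE; rewrite jE normr0 powR0.
Qed.

Lemma ell_single_linear i : linear (ell_single i).
Proof.
move=> c a b; apply: ell_ext => j.
by rewrite ell_addE ell_scaleE ?ell_singleE; case: (j == i); rewrite ?scaler0 ?addr0.
Qed.

HB.instance Definition _ i := GRing.isLinear.Build R X E *:%R (ell_single i)
  (ell_single_linear i).

Lemma ell_mask_sum n x :
  ell_mask (fun i => (i < n)%N) x = \sum_(0 <= i < n) ell_single i (finite_part_val x i).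
Proof.
elim: n => [|n IH].
  by rewrite big_geq//; apply: ell_ext => i; rewrite ?ell_maskE.
rewrite big_nat_recr//= -IH; apply: ell_ext => i.
rewrite ell_addE ?ell_maskE ?ell_singleE ltnS leq_eqVlt.
by have [->|] := eqVneq i n; rewrite ?ltnn/= ?add0r ?addr0.
Qed.

End ell_sum.

Arguments ell_sum_cvg {R p p1 X} x.

Notation ell_head N := (ell_mask (fun i => (i < N)%N)).
Notation ell_tail N := (ell_mask (fun i => (N <= i)%N)).

Section parallelogram.
Context {R : realType}.

Definition parallelogram (X : normedModType R) :=
  forall x y : X, `|x + y| ^+ 2 + `|x - y| ^+ 2 = `|x| ^+ 2 *+ 2 + `|y| ^+ 2 *+ 2.

Lemma parallelogram_real : parallelogram R.
Proof. by move=> x y; rewrite !real_normK ?num_real//; ring. Qed.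

(** The law holds for each coordinate, hence for the partial sums of the squared
    norms, and passes to the limit. *)
Lemma parallelogram_ell2 (X : normedModType R) (le12 : (1 : R) <= 2) :
  parallelogram X -> parallelogram (ell_sum le12 X).
Proof.
move=> PX x y; rewrite -!powR2// !(mulr2n (_ `^ _)).
pose s (z : ell_sum le12 X) n := \sum_(0 <= i < n) `|finite_part_val z i| `^ 2.
have sE n : s x n + s x n + (s y n + s y n) = s (x + y) n + s (x - y) n.
  rewrite /s -!big_split; apply: eq_bigr => i _ /=; rewrite !powR2//.
  exact/esym/PX.
have /funext sE' : (fun n => s x n + s x n + (s y n + s y n)) =1
  (fun n => s (x + y) n + s (x - y) n) by exact: sE.
have sl z : s z @ \oo --> `|z| `^ 2 by exact: ell_sum_cvg.
have := cvgD (cvgD (sl x) (sl x)) (cvgD (sl y) (sl y)).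
rewrite [X in X @ _](_ : _ = (fun n => s (x + y) n + s (x - y) n))//.
move=> fg; have <- := cvg_lim (@norm_hausdorff _ _) (fg _ _ _).
by have <- := cvg_lim (@norm_hausdorff _ _) (cvgD (sl (x + y)) (sl (x - y))).
Qed.

End parallelogram.

(** * Signs, pigeonhole and almost disjoint vectors *)

Section combinatorics.
Context {R : realType}.

(** The mean of [q] over all the signed sums is [\sum q (v j)]. Signs that do at
    least as well are found one vector at a time, because the larger of
    [q (x + v)] and [q (x - v)] is at least [q x + q v]. *)
Lemma exists_signs (V : lmodType R) (q : V -> R) :
  (forall x y, q (x + y) + q (x - y) = q x *+ 2 + q y *+ 2) ->
  forall (v : nat -> V) (s : seq nat), uniq s -> exists e : nat -> bool,
    \sum_(j <- s) q (v j) <= q (\sum_(j <- s) (-1) ^+ e j *: v j).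
Proof.
move=> Pq v; have q0 : q 0 = 0 by have := Pq 0 0; rewrite addr0 subr0; lra.
elim=> [_|j s IH /= /andP[js /IH[e es]]].
  by exists xpredT; rewrite !big_nil q0.
set x := \sum_(j <- s) _ *: v j in es.
have : exists c : bool, q x + q (v j) <= q ((-1) ^+ c *: v j + x).
  have := Pq x (v j); have [le _|lt eq] := lerP (q x + q (v j)) (q (x + v j)).
    by exists false; rewrite expr0 scale1r (addrC (v j)).
  by exists true; rewrite expr1 scaleN1r (addrC (- v j)); lra.
move=> [c qc]; exists (fun i => if i == j then c else e i).
rewrite !big_cons eqxx.
have -> : \sum_(i <- s) (-1) ^+ (if i == j then c else e i) *: v i = x.
  rewrite /x !big_seq; apply: eq_bigr => i si.
  by case: eqP si js => // ->  ->.
by rewrite addrC (le_trans _ qc)// lerD2r.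
Qed.

(** Cut the interval from [-M] to [M] into finitely many cells of length [e]:
    one of them receives infinitely many terms. *)
Lemma infinite_subset_close (A : set nat) (f : nat -> R) (M e : R) :
  infinite_set A -> (forall k, `|f k| <= M) -> 0 < e ->
  exists B, [/\ infinite_set B, B `<=` A &
    forall k l, B k -> B l -> `|f k - f l| <= e].
Proof.
move=> Ainf fM e0.
pose g k := (f k + M) / e.
have g0 k : 0 <= g k.
  by rewrite divr_ge0 ?(ltW e0)//; have := fM k; rewrite ler_norml; lra.
pose col k := Num.trunc (g k).
have colK k : (col k < (Num.trunc ((M + M) / e)).+1)%N.
  rewrite ltnS; apply: le_truncn; rewrite ler_pM2r ?invr_gt0//.
  by rewrite lerD2r (le_trans (ler_norm _) (fM k)).
have [c cinf] : exists c, infinite_set (A `&` [set k | col k = c]).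
  apply: contrapT => /forallNP H; apply: Ainf.
  apply: (@sub_finite_set _ _ (\bigcup_(c in `I_(Num.trunc ((M + M) / e)).+1)
      (A `&` [set k | col k = c]))).
    by move=> k Ak; exists (col k) => //=; exact: colK.
  by apply: bigcup_finite => [|c _]; [exact: finite_II|exact: (contrapT (H c))].
exists (A `&` [set k | col k = c]); split => // k l [_ /= kc] [_ /= lc].
have : `|g k - g l| <= 1.
  have := truncn_itv (g0 k); have := truncn_itv (g0 l).
  rewrite -/(col k) -/(col l) kc lc -natr1 => /andP[? ?] /andP[? ?].
  by rewrite ler_norml; apply/andP; split; lra.
have -> : g k - g l = (f k - f l) / e.
  by rewrite /g -mulrBl; congr (_ / _); lra.
by rewrite normrM normfV (gtr0_norm e0) ler_pdivrMr// mul1r.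
Qed.

(** A substitute for compactness of bounded sets of [R^N]: pass to an infinite
    set of indices for one coordinate after the other. *)
Lemma pigeonhole_close (b : nat -> nat -> R) (M e : R) N :
  (forall j i, `|b j i| <= M) -> 0 < e ->
  exists phi : nat -> nat, injective phi /\
    forall k l i, (i < N)%N -> `|b (phi k) i - b (phi l) i| <= e.
Proof.
move=> bM e0.
have [B [Binf Bb]] : exists B : set nat, infinite_set B /\
    forall k l i, B k -> B l -> (i < N)%N -> `|b k i - b l i| <= e.
  elim: N => [|N [B [Binf Bb]]].
    by exists setT; split => //; exact: infinite_nat.
  have [C [Cinf CB Cb]] :=
    @infinite_subset_close B (fun j => b j N) M e Binf (fun k => bM k N) e0.
  exists C; split=> // k l i Ck Cl; rewrite ltnS leq_eqVlt => /predU1P[->|iN].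
    exact: Cb.
  by apply: Bb => //; exact: CB.
have /infiniteP/pcard_leP[f] := Binf.
exists f; split=> [k l|k l i iN]; first by apply: inj; rewrite inE.
by apply: Bb => //; exact: funS.
Qed.

End combinatorics.

Section gliding.
Context {R : realType} (p : R) (p1 : 1 <= p) (X : normedModType R).
Local Notation E := (ell_sum p1 X).
Local Notation co := finite_part_val.

Let p0 : 0 < p. Proof. exact: lt_le_trans p1. Qed.

(** For disjoint supports this is [ell_disjointD]. In general the tail of [x]
    and the head of [y] are perturbations of norm at most [d / 2], and the last
    term [1] pays for them. *)
Lemma ell_almost_disjointD (x : E) (M : R) : 0 <= M ->
  exists (N : nat) (e : R), 0 < e /\ forall y : E, `|y| <= M ->
    (forall i, (i < N)%N -> `|co y i| <= e) ->
    `|x + y| `^ p <= `|x| `^ p + M `^ p + 1.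
Proof.
move=> M0.
pose a := (`|x| `^ p + M `^ p) `^ p^-1.
have aE : a `^ p = `|x| `^ p + M `^ p.
  by rewrite powRVK ?gt_eqF// addr_ge0 ?powR_ge0.
have [d d0 ad] := @powRD_le _ p a p0 (powR_ge0 _ _).
have [|N NP] := @ell_tail_small _ _ p1 X x (d / 2); first by rewrite divr_gt0.
exists N, (d / 2 / N.+1%:R); split; first by rewrite !divr_gt0.
move=> y yM yN.
have hy : `|ell_head N y| <= d / 2.
  rewrite ell_mask_sum (le_trans (ler_norm_sum _ _ _))// big_mkord.
  apply: (@le_trans _ _ (\sum_(i < N) (d / 2 / N.+1%:R))).
    by apply: ler_sum => i _; rewrite ell_single_norm yN.
  rewrite sumr_const card_ord -[_ *+ N]mulr_natr -mulrA ler_piMr ?divr_ge0 ?(ltW d0)//.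
  by rewrite mulrC ler_pdivrMr// mul1r ler_nat.
have tx := NP N (leqnn _).
have -> : x + y = ell_tail N x + ell_head N y + (ell_head N x + ell_tail N y).
  rewrite -{1}(ell_headtail N x) -{1}(ell_headtail N y).
  by rewrite -!addrA [LHS]addrCA; congr (_ + _); rewrite addrCA.
rewrite -aE; apply: le_trans ad; rewrite ler_powR2//; last first.
  by rewrite addr_ge0 ?powR_ge0// ltW.
rewrite (le_trans (ler_normD _ _))// addrC lerD//; last first.
  by rewrite (le_trans (ler_normD _ _))// (splitr d) lerD.
rewrite -(@ler_powR2 _ p)// ?powR_ge0// aE.
apply: (le_trans (ell_disjointD _)).
  by move=> i; rewrite ?ell_maskE; case: (leqP N i); [left|right].
by rewrite lerD// ler_powR2// ?ell_mask_le// (le_trans (ell_mask_le _ _)).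
Qed.

End gliding.

(** * Weakly null sequences in an l^p-sum of Hilbert spaces *)

Section core.
Context {R : realType} (p : R) (p2 : 2 < p) (p1 : 1 <= p) (X : normedModType R).
Local Notation E := (ell_sum p1 X).
Local Notation co := finite_part_val.
Local Notation root n := (n%:R `^ (2^-1)).

Let p0 : 0 < p. Proof. exact: lt_le_trans p1. Qed.

Lemma sum_powR_n (n : nat) (x : R) : 0 <= x -> x `^ p <= n%:R -> x <= n%:R `^ p^-1.
Proof.
by move=> x0 xn; rewrite -(@ler_powR2 _ p)// ?powR_ge0// powRVK// gt_eqF.
Qed.

(** Gliding hump. Otherwise there are, beyond any coordinate, functionals [G j]
    of a new index [j] and vectors of norm at most 1 on which [G j] exceeds [d];
    these can be cut off to be successive blocks. With signs chosen so that the
    cross terms are nonnegative, the sum [x] of [n] blocks and the signed sum of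
    the corresponding functionals satisfy
    [n d <= K n^(1/2) |x| <= K n^(1/2 + 1/p)], impossible for large [n]. *)
Lemma uniform_tails (G : nat -> {linear E -> R}) (K d : R) : 0 <= K -> 0 < d ->
  (forall s e z, uniq s ->
    `|\sum_(j <- s) (-1) ^+ (e j : bool) * G j z| <= K * root (size s) * `|z|) ->
  exists N, forall j z, (N <= j)%N -> (forall i, (i < N)%N -> co z i = 0) ->
    `|G j z| <= d * `|z|.
Proof.
move=> K0 d0 GK; apply: contrapT => /forallNP nG.
have GK1 j z : `|G j z| <= K * `|z|.
  have := GK [:: j] (fun=> false) z; rewrite big_seq1 expr0 mul1r powR1 mulr1.
  exact.
have next N : exists (j : nat) (u : E) (M : nat),
    [/\ (N <= j)%N, (j < M)%N, `|u| <= 1, d <= G j u &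
        forall i, (i < N)%N || (M <= i)%N -> co u i = 0].
  have := nG N; move=> /existsNP[j /existsNP[z /not_implyP[Nj /not_implyP[zN]]]].
  move=> /negP; rewrite -ltNge => dz.
  have z0 : 0 < `|z|.
    rewrite normr_gt0; apply: contraTneq dz => ->.
    by rewrite linear0 !normr0 mulr0 ltxx.
  pose c : bool := G j z < 0.
  pose v := (`|z|^-1 * (-1) ^+ c) *: z.
  have v1 : `|v| = 1.
    by rewrite normrZ normrM normr_sign mulr1 normfV normr_id mulVf ?gt_eqF.
  have Gv : d < G j v.
    have -> : G j v = `|z|^-1 * `|G j z| by rewrite linearZ/= normrEsign mulrA.
    by rewrite mulrC ltr_pdivlMr.
  have [|M MP] := @ell_tail_small _ _ p1 X v ((G j v - d) / (K + 1)).
    by rewrite divr_gt0 ?subr_gt0 ?ltr_wpDl.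
  pose M' := maxn M (maxn N j.+1).
  exists j, (ell_head M' v), M'; split=> //.
  - by rewrite !leq_max ltnSn !orbT.
  - by rewrite -v1 ell_mask_le.
  - have := ell_headtail M' v => /(congr1 (G j)); rewrite linearD => Ghead.
    have := GK1 j (ell_tail M' v); have := MP M' (leq_maxl _ _).
    rewrite ler_pdivlMr ?ltr_wpDl// => tail Gtail.
    have : `|G j (ell_tail M' v)| <= G j v - d.
      rewrite (le_trans Gtail)// (le_trans _ tail)// mulrC ler_wpM2l//.
      by rewrite lerDl.
    by rewrite ler_norml -Ghead; lra.
  - move=> i /orP[iN|Mi]; rewrite ?ell_maskE.
      by case: ifP => // _; rewrite /v ell_scaleE zN// scaler0.
    by rewrite ltnNge Mi.
have glide n : exists (N : nat) (s : seq nat) (e : nat -> bool) (x : E),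
    [/\ uniq s, size s = n & all (fun j => j < N)%N s] /\
    [/\ forall i, (N <= i)%N -> co x i = 0, `|x| `^ p <= n%:R &
        n%:R * d <= \sum_(j <- s) (-1) ^+ e j * G j x].
  elim: n => [|n [N [s [e [x [[us sn sN] [xN xn Gx]]]]]]].
    exists 0, [::], (fun=> false), 0; split; first by [].
    by split; rewrite ?big_nil ?mul0r ?normr0 ?powR0 ?gt_eqF.
  have [j [u [M [Nj jM u1 Gu uM]]]] := next N.
  have js : j \notin s.
    by apply/negP => /(allP sN); rewrite ltnNge Nj.
  (* the cross terms created by adding the block u and the functional G j *)
  pose t := G j x + \sum_(i <- s) (-1) ^+ e i * G i u.
  pose c : bool := t < 0.
  exists M, (j :: s), (fun i => if i == j then c else e i), (x + (-1) ^+ c *: u).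
  split; split.
  - by rewrite /= js.
  - by rewrite /= sn.
  - rewrite /= jM; apply: sub_all sN => i iN; rewrite (ltn_trans iN)//.
    exact: leq_ltn_trans jM.
  - move=> i Mi; rewrite ell_addE ell_scaleE xN ?uM ?Mi ?orbT ?scaler0 ?addr0//.
    by rewrite (leq_trans _ Mi)// ltnW// (leq_ltn_trans Nj).
  - apply: (le_trans (ell_disjointD _)).
      move=> i; have [Ni|iN] := leqP N i; first by left; exact: xN.
      by right; rewrite ell_scaleE uM ?iN// scaler0.
    rewrite -natr1 lerD// normrZ normr_sign mul1r.
    have p11 : 1 `^ p = 1 by rewrite powR1.
    by rewrite -[leRHS]p11 ler_powR2.
  - rewrite big_cons eqxx.
    have -> : \sum_(i <- s) (-1) ^+ (if i == j then c else e i) *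
          G i (x + (-1) ^+ c *: u) =
        \sum_(i <- s) (-1) ^+ e i * G i x +
        (-1) ^+ c * \sum_(i <- s) (-1) ^+ e i * G i u.
      rewrite mulr_sumr -big_split/= !big_seq; apply: eq_bigr => i si.
      case: eqP si js => [-> -> //|_ _ _].
      by rewrite linearD linearZ/= mulrDr mulrCA.
    rewrite linearD linearZ/= mulrDr mulrA -expr2 sqrr_sign mul1r.
    have : 0 <= (-1) ^+ c * t by rewrite -normrEsign.
    by rewrite /t mulrDr -natr1 mulrDl mul1r; lra.
have [|n nK] := @powR_unbounded _ (2^-1 - p^-1) (K / d).
  by rewrite subr_gt0 ltf_pV2 ?posrE.
have [N [s [e [x [[us sn _] [_ xn Gx]]]]]] := glide n.+1.
have : n.+1%:R * d <= K * root n.+1 * (n.+1%:R `^ p^-1).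
  rewrite (le_trans Gx)// (le_trans (ler_norm _))// (le_trans (GK _ _ _ us))//.
  by rewrite sn ler_wpM2l// ?mulr_ge0 ?powR_ge0// sum_powR_n.
apply/negP; rewrite -ltNge.
move: nK; rewrite ltr_pdivrMr// => nK.
have nE : n.+1%:R = n.+1%:R `^ (2^-1 - p^-1) * (root n.+1 * n.+1%:R `^ p^-1) :> R.
  rewrite -!powRD ?pnatr_eq0 ?implybT//.
  have -> : 2^-1 - p^-1 + (2^-1 + p^-1) = 1 :> R by lra.
  by rewrite powRr1.
rewrite [X in _ < X * d]nE -[ltLHS]mulrA [ltRHS]mulrAC.
by rewrite ltr_pM2r// mulr_gt0// powR_gt0.
Qed.

(** Young's inequality for the conjugate exponents [p / (p - 2)] and [p / 2]. *)
Lemma young_sq (a t : R) : 0 <= a -> 0 <= t ->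
  a `^ (p - 2) * t ^+ 2 <= (1 - 2 / p) * a `^ p + 2 / p * t `^ p.
Proof.
move=> a0 t0; have pm : 0 < p - 2 by rewrite subr_gt0.
have pn0 : p != 0 by exact: lt0r_neq0.
have pmn : p - 2 != 0 by exact: lt0r_neq0.
apply: (le_trans (@conjugate_powR _ _ _ (p / (p - 2)) (p / 2) _ _ _ _ _)).
- exact: powR_ge0.
- exact: sqr_ge0.
- by rewrite divr_gt0.
- by rewrite divr_gt0.
- by field; rewrite pn0 pmn.
rewrite -powR2// -!powRrM (_ : (p - 2) * (p / (p - 2)) = p); last by field.
rewrite (_ : 2 * (p / 2) = p); last by field.
by rewrite le_eqVlt; apply/orP; left; apply/eqP; field; rewrite pn0 pmn.
Qed.

(** By [uniform_tails] the [G j] are concentrated on [N] coordinates, so that the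
    head of [y j] has norm at least [1 / (2 C)]. Along a subsequence the norms
    of the first [N] coordinates of [y j] are almost constant, equal to [a i].
    The quadratic form with weights [a i ^ (p - 2)] on the head then yields
    signed sums of [n] of the [y j] of norm at least [n^(1/2) / (3 C)], where
    the constant depends neither on [N] nor on [eps]; for small [eps] this is
    incompatible with the bound [C eps n^(1/2)]. *)
Lemma no_almost_biorthogonal (y : nat -> E) (G : nat -> {linear E -> R})
    (C K eps : R) : parallelogram X ->
  0 < C -> 0 <= K -> 0 < eps -> 4 * C ^+ 2 * eps < 1 ->
  (forall j, `|y j| <= C) -> (forall j z, `|G j z| <= C * `|z|) ->
  (forall j, G j (y j) = 1) ->
  (forall s e, uniq s -> `|\sum_(j <- s) (-1) ^+ (e j : bool) *: y j| <=
    C * Num.max ((size s)%:R `^ p^-1) (eps * root (size s))) ->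
  (forall s e z, uniq s ->
    `|\sum_(j <- s) (-1) ^+ (e j : bool) * G j z| <= K * root (size s) * `|z|) ->
  False.
Proof.
move=> PX C0 K0 e0 Ce yC GC Gy yS GS.
have C2 : 0 < 2 * C by rewrite mulr_gt0.
have [|N NP] := @uniform_tails G K (2 * C)^-1 K0 _ GS.
  by rewrite invr_gt0.
have head_ge j : (N <= j)%N -> (2 * C)^-1 <= `|ell_head N (y j)|.
  move=> Nj; have := Gy j; rewrite -{1}(ell_headtail N (y j)) linearD.
  have h1 := GC j (ell_head N (y j)).
  have h2 : `|G j (ell_tail N (y j))| <= 2^-1.
    rewrite (le_trans (NP _ _ Nj _))// => [i iN|].
      by rewrite ?ell_maskE leqNgt iN.
    rewrite invfM -mulrA ler_piMr// mulrC ler_pdivrMr// mul1r.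
    by rewrite (le_trans (ell_mask_le _ _)).
  move=> h; rewrite invfM ler_pdivrMr//.
  move: h1 h2; rewrite !ler_norml => /andP[_ h1] /andP[_ h2].
  by rewrite [leRHS]mulrC; lra.
pose kappa := (2 * C)^-1 `^ p.
have kappa0 : 0 < kappa by rewrite powR_gt0// invr_gt0.
have Cp : 0 < C `^ (p - 1) by rewrite powR_gt0.
(* small enough for the loss 2 eta sum_i (a i)^(p-1) below to be at most A / p *)
pose eta := kappa / p / (2 * N.+1%:R * C `^ (p - 1)).
have eta0 : 0 < eta by rewrite !divr_gt0// !mulr_gt0.
have [phi [phiI phiP]] :=
  @pigeonhole_close _ (fun j i => `|co (y (N + j)%N) i|) C eta N
    (fun j i => le_trans (eq_ind_r (fun t => t <= _) (ell_coord _ _) (normr_id _))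
       (yC _)) eta0.
pose idx k := (N + phi k)%N.
have idxI : injective idx by move=> k l /addnI /phiI.
pose a i := `|co (y (idx 0)) i|.
have aC i : a i <= C by rewrite (le_trans (ell_coord _ _)).
pose A := \sum_(0 <= i < N) a i `^ p.
have kA : kappa <= A.
  rewrite (@le_trans _ _ (`|ell_head N (y (idx 0))| `^ p))//.
    by rewrite ler_powR2// ?invr_ge0 ?(ltW C2)// head_ge// leq_addr.
  apply: ell_lep => n; rewrite /A.
  have [nN|Nn] := leqP n N.
    rewrite (big_cat_nat (leq0n n) nN)/= ler_wpDr//.
      by rewrite sumr_ge0// => i _; rewrite powR_ge0.
    rewrite !big_nat; apply: ler_sum => i /andP[_ iN].
    by rewrite ?ell_maskE (leq_trans iN nN).
  rewrite (big_cat_nat (leq0n N) (ltnW Nn))/=.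
  rewrite [X in _ + X <= _]big_nat [X in _ + X <= _]big1 ?addr0.
    rewrite !big_nat; apply: ler_sum => i /andP[_ iN].
    by rewrite ?ell_maskE iN.
  move=> i /andP[Ni _].
  by rewrite ?ell_maskE ltnNge Ni/= normr0 powR0// gt_eqF.
have A0 : 0 < A by exact: lt_le_trans kA.
(* with these weights Young's inequality is sharp where |x i| = a i *)
pose q (x : E) := \sum_(0 <= i < N) a i `^ (p - 2) * `|co x i| ^+ 2.
have qP x z : q (x + z) + q (x - z) = q x *+ 2 + q z *+ 2.
  rewrite /q -!sumrMnl -!big_split; apply: eq_bigr => i _ /=.
  by rewrite -mulrDr PX mulrDr !mulrnAr.
have qy k : (1 - p^-1) * A <= q (y (idx k)).
  apply: (@le_trans _ _ (\sum_(0 <= i < N) (a i `^ p - 2 * eta * C `^ (p - 1)))).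
    rewrite big_split/= -/A sumr_const_nat subn0 mulrBl mul1r lerD2l.
    rewrite mulNrn lerN2 -[_ *+ N]mulr_natr /eta.
    rewrite (@le_trans _ _ (p^-1 * kappa))//; last first.
      by rewrite ler_wpM2l// invr_ge0 ltW.
    have etaE (k' c n m : R) : c != 0 -> n != 0 ->
        2 * (k' / p / (2 * n * c)) * c * m = p^-1 * k' * (m / n).
      by move=> c0 n0; field; rewrite c0 n0 gt_eqF.
    rewrite etaE ?pnatr_eq0 ?gt_eqF//.
    rewrite ler_piMr ?mulr_ge0 ?invr_ge0 ?(ltW p0) ?(ltW kappa0)//.
    by rewrite ler_pdivrMr// mul1r ler_nat.
  rewrite /q !big_nat; apply: ler_sum => i /andP[_ iN].
  have := phiP 0 k i iN; rewrite -/(idx k) -/(idx 0) -/(a i).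
  set b := `|co (y (idx k)) i| => ab.
  have b0 : 0 <= b by exact: normr_ge0.
  have ai0 : 0 <= a i by exact: normr_ge0.
  have bb : a i ^+ 2 - 2 * a i * eta <= b ^+ 2.
    move: ab; rewrite ler_norml => /andP[_ ab].
    have [aeta|etaa] := lerP (a i) eta.
      rewrite (@le_trans _ _ 0) ?sqr_ge0//; nra.
    have : a i - eta <= b by lra.
    nra.
  have aE : a i `^ p = a i `^ (p - 2) * a i ^+ 2.
    by rewrite -powR2// -powRD ?subrK// gt_eqF.
  have aE1 : a i `^ (p - 1) = a i `^ (p - 2) * a i.
    have -> : p - 1 = p - 2 + 1 by ring.
    rewrite powRD ?powRr1//; apply/implyP; rewrite -addrA.
    by rewrite addr_eq0 opprD opprK => /eqP pE; move: p2; rewrite pE; lra.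
  have : a i `^ (p - 1) <= C `^ (p - 1).
    apply: ge0_ler_powR; rewrite ?nnegrE ?(ltW C0)// subr_ge0.
    exact: p1.
  have := ler_wpM2l (powR_ge0 (a i) (p - 2)) bb.
  rewrite aE1 aE => h1 h2.
  have := ler_wpM2l (ltW eta0) h2.
  lra.
(* a number of terms for which eps * n^(1/2) exceeds n^(1/p) *)
have [|n nP] := @powR_unbounded _ (2^-1 - p^-1) eps^-1.
  by rewrite subr_gt0 ltf_pV2 ?posrE.
pose s := [seq idx k | k <- iota 0 n.+1].
have us : uniq s by rewrite map_inj_uniq ?iota_uniq.
have sz : size s = n.+1 by rewrite size_map size_iota.
have [e eP] := @exists_signs _ _ q qP y s us.
have := yS s e us; rewrite sz max_r; last first.
  have -> : p^-1 = 2^-1 - (2^-1 - p^-1) :> R by lra.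
  rewrite powRB ?pnatr_eq0 ?implybT// mulrC ler_wpM2r ?powR_ge0//.
  rewrite -[leRHS]invrK lef_pV2 ?posrE ?powR_gt0 ?invr_gt0//.
  exact: ltW.
move: eP; set x := \sum_(j <- s) _ *: _ => qx xC.
have r0 : 0 < root n.+1 :> R by rewrite powR_gt0.
have : n.+1%:R * ((1 - p^-1) * A) <= q x.
  apply: le_trans qx; rewrite big_map -[X in X%:R](size_iota 0) -sum1_size.
  rewrite natr_sum mulr_suml; apply: ler_sum => k _.
  by rewrite mul1r.
have : q x / n.+1%:R <= (1 - 2 / p) * A + 2 / p * (C * eps) `^ p.
  apply: (@le_trans _ _ (\sum_(0 <= i < N) ((1 - 2 / p) * a i `^ p +
      2 / p * (`|co x i| / root n.+1) `^ p))).
    rewrite /q mulr_suml; apply: ler_sum => i _.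
    apply: le_trans (young_sq _ _); rewrite ?divr_ge0 ?powR_ge0//.
    rewrite -mulrA ler_wpM2l ?powR_ge0// expr_div_n -(powR2 (powR_ge0 _ _)).
    by rewrite powRVK.
    exact: normr_ge0.
  rewrite big_split/= -!mulr_sumr lerD2l ler_wpM2l ?divr_ge0 ?(ltW p0)//.
  under eq_bigr do rewrite powRM ?invr_ge0 ?powR_ge0//.
  rewrite -mulr_suml.
  apply: (@le_trans _ _ (`|x| `^ p * (root n.+1)^-1 `^ p)).
    by rewrite ler_wpM2r ?powR_ge0// ell_partial.
  rewrite -powRM ?invr_ge0 ?powR_ge0// ler_powR2//.
  - by rewrite ler_pdivrMr// -mulrA.
  - by rewrite mulr_ge0// ltW.
move=> h1; rewrite mulrC -ler_pdivlMr// => /le_trans/(_ h1) {h1} h.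
have : A <= 2 * (C * eps) `^ p.
  rewrite -(@ler_pM2l _ p^-1) ?invr_gt0//.
  by move: h; rewrite !mulrBl; lra.
apply/negP; rewrite -ltNge; apply: lt_le_trans kA.
have -> : kappa = 2 * (2 `^ p^-1 * (2 * C))^-1 `^ p.
  rewrite invfM powRM ?invr_ge0 ?powR_ge0 ?(ltW C2)//.
  by rewrite -powRN -powRrM mulNr mulVf ?gt_eqF// powR_inv1// mulrA mulfV ?mul1r.
rewrite ltr_pM2l// gt0_ltr_powR// ?nnegrE ?invr_ge0 ?mulr_ge0 ?powR_ge0 ?(ltW C0) ?(ltW e0)//.
have t2 : 2 `^ p^-1 <= 2 :> R.
  by rewrite ler1_powR// ?ler1n// invf_le1.
rewrite -[ltRHS]div1r ltr_pdivlMr ?mulr_gt0 ?powR_gt0//.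
apply: le_lt_trans Ce.
have -> : C * eps * (2 `^ p^-1 * (2 * C)) = 2 * C ^+ 2 * eps * 2 `^ p^-1 by ring.
have -> : 4 * C ^+ 2 * eps = 2 * C ^+ 2 * eps * 2 by ring.
by rewrite ler_wpM2l// !mulr_ge0// ?sqr_ge0// ltW.
Qed.

End core.

(** * Subspaces of l^2 + l^p *)

Section no_embedding.
Context {R : realType} (p : R) (p2 : 2 < p) (p1 : 1 <= p).
Local Notation co := finite_part_val.
Local Notation root n := (n%:R `^ (2^-1)).

Let p0 : 0 < p. Proof. exact: lt_le_trans p1. Qed.

(** By pigeonhole, some difference [h j - h l] is mapped by [S] to a vector that
    is as small as needed on any given head, hence almost disjoint from what has
    already been built. Adding or subtracting [m] such differences gives [z]
    with [Q z] of order at least [m], so [|z|] of order at least [m^(1/2)],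
    while [|S z|] is of order at most [m^(1/p)]. *)
Lemma small_vector (Z : normedModType R) (S : {linear Z -> ell p1})
    (D : Z -> Prop) (Q : Z -> R) (B M c : R) (h : nat -> Z) :
  D 0 -> (forall x y, D x -> D y -> D (x + y)) ->
  (forall a x, D x -> D (a *: x)) ->
  (forall x y, D x -> D y -> Q (x + y) + Q (x - y) = Q x *+ 2 + Q y *+ 2) ->
  0 < M -> (forall x, D x -> Q x <= M * `|x| ^+ 2) ->
  (forall j, D (h j)) -> (forall j, `|h j| <= M) ->
  0 < c -> (forall j l, j != l -> c <= Q (h j - h l)) ->
  0 < B -> (forall x, `|S x| <= B * `|x|) ->
  forall d, 0 < d -> exists z, [/\ D z, `|z| = 1 & `|S z| <= d].
Proof.
move=> D0 DD DZ QP M0 QM Dh hM c0 hc B0 SB d d0.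
have DN x : D x -> D (- x) by move=> Dx; rewrite -scaleN1r; exact: DZ.
have Q0 : Q 0 = 0 by have := QP 0 0 D0 D0; rewrite addr0 subr0; lra.
have QN x : D x -> Q (- x) = Q x.
  by move=> Dx; have := QP 0 x D0 Dx; rewrite !add0r Q0; lra.
pose b := (B * (M *+ 2)) `^ p + 1.
have b0 : 0 < b by rewrite ltr_wpDl ?powR_ge0.
have grow m : exists z, [/\ D z, m%:R * c <= Q z & `|S z| `^ p <= m%:R * b].
  elim: m => [|m [z [Dz Qz Sz]]].
    exists 0; split=> //; first by rewrite mul0r Q0.
    by rewrite linear0 normr0 powR0 ?mul0r// gt_eqF.
  have [|N [e [e0 Ne]]] := @ell_almost_disjointD _ p p1 R (S z) (B * (M *+ 2)).
    by rewrite mulr_ge0 ?mulrn_wge0// ltW.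
  have [|phi [phiI phie]] :=
      @pigeonhole_close _ (fun j i => co (S (h j)) i) (B * M) e N _ e0.
    move=> j i; rewrite (le_trans (ell_coord _ _))// (le_trans (SB _))//.
    by rewrite ler_wpM2l// ltW.
  pose w := h (phi 0%N) - h (phi 1%N).
  have Dw : D w by apply: DD => //; exact: DN.
  have cw : c <= Q w by apply: hc; apply/negP => /eqP /phiI.
  have wM : `|w| <= M *+ 2.
    by rewrite (le_trans (ler_normB _ _))// mulr2n lerD.
  have we i : (i < N)%N -> `|co (S w) i| <= e.
    by move=> iN; rewrite linearB ell_subE phie.
  have [x [Dx Qx xM xe]] : exists x, [/\ D x, Q z + Q w <= Q (z + x),
      `|S x| <= B * (M *+ 2) & forall i, (i < N)%N -> `|co (S x) i| <= e].
    have Sw : `|S w| <= B * (M *+ 2).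
      by rewrite (le_trans (SB _))// ler_wpM2l// ltW.
    have := QP z w Dz Dw; have [le _|lt eq] := lerP (Q z + Q w) (Q (z + w)).
      by exists w; split.
    exists (- w); split; [exact: DN|lra|by rewrite linearN normrN|].
    by move=> i iN; rewrite linearN [co _ i]/(- co (S w) i) normrN we.
  exists (z + x); split; first exact: DD.
    by rewrite -natr1 mulrDl mul1r (le_trans _ Qx)// lerD.
  rewrite linearD (le_trans (Ne _ xM xe))// -natr1 mulrDl mul1r.
  by rewrite -addrA lerD2r.
have [|m mP] := @powR_unbounded _ (2^-1 - p^-1)
    (b `^ p^-1 / (d * (c / M) `^ 2^-1)).
  by rewrite subr_gt0 ltf_pV2 ?posrE.
have [z [Dz Qz Sz]] := grow m.+1.
have cM0 : 0 < (c / M) `^ 2^-1 by rewrite powR_gt0// divr_gt0.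
have zge : root m.+1 * (c / M) `^ 2^-1 <= `|z|.
  rewrite -powRM ?divr_ge0 ?(ltW c0) ?(ltW M0)//.
  rewrite -(@ler_powR2 _ 2)// ?powR_ge0// powRVK//; last first.
    by rewrite mulr_ge0// divr_ge0 ?(ltW c0) ?(ltW M0).
  rewrite powR2// mulrA ler_pdivrMr// mulrC [leRHS]mulrC.
  by rewrite (le_trans _ (QM _ Dz))// mulrC.
have r0 : 0 < root m.+1 :> R by rewrite powR_gt0.
have z0 : 0 < `|z| by rewrite (lt_le_trans _ zge)// mulr_gt0.
have Szd : `|S z| <= d * `|z|.
  apply: (@le_trans _ _ (m.+1%:R `^ p^-1 * b `^ p^-1)).
    rewrite -(@ler_powR2 _ p)// ?mulr_ge0 ?powR_ge0//.
    by rewrite -powRM ?(ltW b0)// powRVK ?gt_eqF// mulr_ge0// ltW.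
  apply: (@le_trans _ _ (d * (root m.+1 * (c / M) `^ 2^-1))); last first.
    by rewrite ler_wpM2l// ltW.
  have -> : root m.+1 = m.+1%:R `^ (2^-1 - p^-1) * m.+1%:R `^ p^-1 :> R.
    by rewrite -powRD ?pnatr_eq0 ?implybT// subrK.
  have bm : b `^ p^-1 <= m.+1%:R `^ (2^-1 - p^-1) * (d * (c / M) `^ 2^-1).
    by rewrite -ler_pdivrMr ?mulr_gt0// ltW.
  apply: (le_trans (ler_wpM2l (powR_ge0 _ _) bm)).
  by rewrite [leRHS](_ : _ = m.+1%:R `^ p^-1 *
    (m.+1%:R `^ (2^-1 - p^-1) * (d * (c / M) `^ 2^-1)))//; ring.
exists (`|z|^-1 *: z); split.
- exact: DZ.
- by rewrite normrZ normfV normr_id mulVf ?gt_eqF.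
- by rewrite linearZ/= normrZ normfV normr_id mulrC ler_pdivrMr.
Qed.

(** [small_vector] provides unit vectors [z k] of [D k] whose second components
    are negligible, so that the first ones are bounded below in the Hilbert
    space [H]. Suitable signs make the first component of the sum of [n] of them
    of order at least [n^(1/2)], whereas the sum itself has norm at most
    [n^(1/p)]. *)
Lemma no_embedding_sum (H Z : normedModType R)
    (U : {linear Z -> H}) (S : {linear Z -> ell p1}) (B : R)
    (D : nat -> Z -> Prop) (Q : nat -> Z -> R) (M c : nat -> R)
    (h : nat -> nat -> Z) : parallelogram H ->
  (forall k, D k 0) -> (forall k x y, D k x -> D k y -> D k (x + y)) ->
  (forall k a x, D k x -> D k (a *: x)) ->
  (forall k x y, D k x -> D k y ->
    Q k (x + y) + Q k (x - y) = Q k x *+ 2 + Q k y *+ 2) ->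
  (forall k, 0 < M k) -> (forall k x, D k x -> Q k x <= M k * `|x| ^+ 2) ->
  (forall k j, D k (h k j)) -> (forall k j, `|h k j| <= M k) ->
  (forall k, 0 < c k) -> (forall k j l, j != l -> c k <= Q k (h k j - h k l)) ->
  (forall n (z : nat -> Z), (forall k, D k (z k)) ->
    `|\sum_(0 <= k < n) z k| `^ p <= \sum_(0 <= k < n) `|z k| `^ p) ->
  0 < B -> (forall x, `|U x| <= B * `|x|) -> (forall x, `|S x| <= B * `|x|) ->
  (forall x, `|x| <= B * Num.max `|U x| `|S x|) -> False.
Proof.
move=> PH D0 DD DZ QP M0 QM Dh hM c0 hc Dp B0 UB SB below.
have d0 : 0 < (2 * B)^-1 by rewrite invr_gt0 mulr_gt0.
have /choice[z zP] k : exists z, [/\ D k z, `|z| = 1 & `|S z| <= (2 * B)^-1].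
  exact: (small_vector (D0 k) (DD k) (DZ k) (QP k) (M0 k) (QM k) (Dh k) (hM k)
    (c0 k) (hc k) B0 SB d0).
have Uz k : B^-1 <= `|U (z k)|.
  have [_ z1 Sz] := zP k; have := below (z k); rewrite z1.
  rewrite maxr_pMr ?(ltW B0)// le_max => /orP[|h1].
    by rewrite mulrC -ler_pdivrMr// div1r.
  have : B * `|S (z k)| <= 2^-1.
    by rewrite (le_trans (ler_wpM2l (ltW B0) Sz))// invfM mulrCA mulfV ?mulr1// gt_eqF.
  by move=> h2; have := le_trans h1 h2; lra.
have [|n nP] := @powR_unbounded _ (1 - 2 / p) (B ^+ 4).
  by rewrite subr_gt0 ltr_pdivrMr// mul1r.
pose q (x : Z) := `|U x| ^+ 2.
have [e eP] := @exists_signs _ _ q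
  (fun x y => eq_ind_r (fun t => `|t| ^+ 2 + _ = _)
     (eq_ind_r (fun t => _ + `|t| ^+ 2 = _) (PH (U x) (U y)) (linearB U x y))
     (linearD U x y)) z (index_iota 0 n.+1) (iota_uniq _ _).
move: eP; set x := \sum_(0 <= k < n.+1) _ *: _ => qx.
have xn : `|x| `^ p <= n.+1%:R.
  rewrite (le_trans (Dp _ _ _))// => [k|]; first by apply: DZ; have [] := zP k.
  rewrite (eq_bigr (fun=> 1)).
    by rewrite sumr_const_nat subn0.
  by move=> k _; have [_ zk _] := zP k; rewrite normrZ normr_sign mul1r zk powR1.
have : n.+1%:R * B ^- 2 <= B ^+ 2 * n.+1%:R `^ (2 / p).
  apply: (@le_trans _ _ (q x)).
    apply: le_trans qx; rewrite -[X in X%:R * _]subn0 mulr_natl -sumr_const_nat.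
    by apply: ler_sum => k _; rewrite /q -exprVn lerXn2r ?nnegrE ?invr_ge0 ?(ltW B0).
  rewrite /q (@le_trans _ _ ((B * `|x|) ^+ 2))//.
    by rewrite lerXn2r ?nnegrE ?mulr_ge0 ?(ltW B0).
  rewrite exprMn ler_wpM2l ?sqr_ge0// -powR2// mulrC powRrM ler_powR2 ?powR_ge0//.
  by rewrite -(@ler_powR2 _ p) ?powR_ge0// powRVK// gt_eqF.
apply/negP; rewrite -ltNge.
have nE : n.+1%:R = n.+1%:R `^ (1 - 2 / p) * n.+1%:R `^ (2 / p) :> R.
  rewrite -powRD ?pnatr_eq0 ?implybT//.
  by rewrite subrK powRr1.
rewrite ltr_pdivlMr ?exprn_gt0// mulrAC -exprD [ltRHS]nE.
by rewrite ltr_pM2r// powR_gt0.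
Qed.

End no_embedding.

(** * The space X_{p,w} *)

Section Xpw.
Context {R : realType} (p : R) (p1 : 1 <= p) (w : nat -> R).
Local Notation co := finite_part_val.
Local Notation X := (Xpw p1 w).

Let p0 : 0 < p. Proof. exact: lt_le_trans p1. Qed.

Lemma Xpw_norm_le (u : nat -> R) (M : R) : 0 <= M ->
  (forall n, \sum_(0 <= i < n) `|u i| `^ p <= M `^ p) ->
  (forall n, \sum_(0 <= i < n) (w i * u i) ^+ 2 <= M ^+ 2) ->
  (Xpw_norm p w u <= M%:E)%E.
Proof.
move=> M0 up u2; rewrite ge_max; apply/andP; split; first exact: ell_norm_le.
apply: ell_norm_le => // [|n]; first exact: ge1_2.
rewrite powR2// (le_trans _ (u2 n))//; apply: ler_sum => i _.
by rewrite powR2// real_normK ?num_real.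
Qed.

(** The operators [x |-> w x] and [x |-> x], whose norms have the norm of
    [X_{p,w}] as their maximum. *)
Lemma Xpw_maps : exists (U : {linear X -> ell2 R}) (S : {linear X -> ell p1}),
  [/\ forall x i, co (U x) i = w i * co x i, forall x i, co (S x) i = co x i,
      forall x, `|U x| <= `|x|, forall x, `|S x| <= `|x| &
      forall x, `|x| <= Num.max `|U x| `|S x|].
Proof.
have [|x|U [UE UC]] := @finite_part_map_of R X _ (ell_enorm (@ge1_2 R) R)
    (fun x i => w i * co x i) 1.
- move=> a x y; apply/funext => i.
  have coE : co (a *: x + y) i = a * co x i + co y i by [].
  suff : w i * co (a *: x + y) i = a * (w i * co x i) + w i * co y i by [].
  by rewrite coE mulrDr mulrCA.
- rewrite mul1r [leRHS]finite_part_normE.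
  suff : (ell_norm 2 (w \* co x)%R <= Xpw_norm p w (co x))%E by [].
  by rewrite le_max lexx orbT.
have [//|x|S [SE SC]] := @finite_part_map_of R X _ (ell_enorm p1 R) (fun x => co x) 1.
- rewrite mul1r [leRHS]finite_part_normE.
  suff : (ell_norm p (co x) <= Xpw_norm p w (co x))%E by [].
  by rewrite le_max lexx.
exists U, S; split=> [x i|x i|x|x|x].
- exact: (congr1 (fun u => u i) (UE x)).
- exact: (congr1 (fun u => u i) (SE x)).
- by rewrite -[leRHS]mul1r.
- by rewrite -[leRHS]mul1r.
rewrite -lee_fin [leLHS]finite_part_normE EFin_max.
rewrite [X in maxe X _]finite_part_normE [X in maxe _ X]finite_part_normE.
by rewrite UE SE maxC.
Qed.

Lemma Xpw_partial (x : X) n : \sum_(0 <= i < n) `|co x i| `^ p <= `|x| `^ p.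
Proof.
have [_ [S [_ SE _ SC _]]] := Xpw_maps.
apply: (@le_trans _ _ (`|S x| `^ p)); last by rewrite ler_powR2.
by rewrite -(eq_bigr _ (fun i _ => congr1 (fun t => `|t| `^ p) (SE x i))) ell_partial.
Qed.

Lemma Xpw_coord (x : X) i : `|co x i| <= `|x|.
Proof.
have [_ [S [_ SE _ SC _]]] := Xpw_maps.
by rewrite -SE (le_trans (ell_coord _ _)).
Qed.

Lemma Xpw_partial2 (x : X) n : \sum_(0 <= i < n) (w i * co x i) ^+ 2 <= `|x| ^+ 2.
Proof.
have [U [_ [UE _ UC _ _]]] := Xpw_maps.
apply: (@le_trans _ _ (`|U x| ^+ 2)); last by rewrite lerXn2r ?nnegrE.
rewrite -powR2//; apply: le_trans (ell_partial _ n); apply: ler_sum => i _.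
by rewrite powR2// real_normK ?num_real// UE.
Qed.

(** The isometry [x |-> (w x, x)] has closed range because the latter is defined
    by the equations [z_1 i = w i * z_2 i]. *)
Lemma Xpw_embeds : embeds X (ell2 R * ell p1)%type.
Proof.
have [U [S [UE SE UC SC USC]]] := Xpw_maps.
have [T TE] := pair_map_of U S.
exists T, (range T); split.
  rewrite (_ : range T = \bigcap_i [set z | co z.1 i - w i * co z.2 i = 0]).
    apply: closed_bigI => i _.
    have [F FE] : exists F : {linear (ell2 R * ell p1)%type -> R},
        F =1 (fun z => co z.1 i - w i * co z.2 i).
      apply: linear_of => a x y.
      have -> : (a *: x + y).1 = a *: x.1 + y.1 by [].
      have -> : (a *: x + y).2 = a *: x.2 + y.2 by [].
      rewrite !ell_addE !ell_scaleE.
      have scE (b c : R) : b *: (c : R^o) = b * c by [].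
      by rewrite !scE; ring.
    rewrite (_ : [set z | _] = [set z | F z = 0]).
      apply: closed_kernel; apply/continuous_linearP.
      exists (1 + `|w i|); first by rewrite ltr_wpDr.
      move=> z; rewrite FE (le_trans (ler_normB _ _))// mulrDl mul1r lerD//.
        by rewrite (le_trans (ell_coord _ _))// pair_normE le_max lexx.
      by rewrite normrM ler_wpM2l// (le_trans (ell_coord _ _))// pair_normE le_max lexx orbT.
    by apply/seteqP; split=> z /=; rewrite FE.
  apply/seteqP; split=> [_ [x _ <-] i _|z zV] /=.
    by rewrite TE /= UE SE subrr.
  have zE i : co z.1 i = w i * co z.2 i by apply/eqP; rewrite -subr_eq0 zV.
  have zX : co z.2 \in enorm_fin (Xpw_enorm p1 w).
    rewrite unfold_in /enorm_fin; apply: le_lt_trans (ltry `|z|).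
    apply: Xpw_norm_le => // n.
      apply: le_trans (ell_partial _ _) _; rewrite ler_powR2// pair_normE.
      by rewrite le_max lexx orbT.
    apply: (@le_trans _ _ (`|z.1| ^+ 2)); last first.
      by rewrite lerXn2r ?nnegrE// pair_normE le_max lexx.
    rewrite -powR2//; apply: le_trans (ell_partial _ n); apply: ler_sum => i _.
    by rewrite powR2// real_normK ?num_real// zE.
  exists (FinitePart zX) => //; rewrite TE [RHS]surjective_pairing.
  by congr pair; apply: ell_ext => i; rewrite ?UE ?SE /= ?zE.
split.
- split=> [x _|x y _ _|_ [x _ <-]]; [by exists x| |by exists x].
  rewrite !TE => -[_ xy]; apply: val_inj; apply/funext => i.
  by rewrite -[LHS]/(co x i) -[RHS]/(co y i) -!SE xy.
- apply/continuous_linearP; exists 1 => // x.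
  by rewrite mul1r TE pair_normE ge_max UC SC.
- by exists 1 => x; rewrite mul1r TE pair_normE.
Qed.

Lemma embeds_Xpw (Z : normedModType R) : embeds Z X ->
  exists (U : {linear Z -> ell2 R}) (S : {linear Z -> ell p1}) (B : R),
    [/\ 0 < B, forall x, `|U x| <= B * `|x|, forall x, `|S x| <= B * `|x| &
        forall x, `|x| <= B * Num.max `|U x| `|S x|].
Proof.
move=> [T [V [_ [_ /continuous_linearP[B B0 TB] [C TC]]]]].
have [U [S [UE SE UC SC USC]]] := Xpw_maps.
exists (U \o T : {linear _ -> _}), (S \o T : {linear _ -> _}), (Num.max B C).
have h x : B * `|x| <= Num.max B C * `|x| by rewrite ler_wpM2r// le_max lexx.
split=> [|x|x|x] /=.
- by rewrite lt_max B0.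
- by rewrite (le_trans (UC _))// (le_trans (TB _)).
- by rewrite (le_trans (SC _))// (le_trans (TB _)).
- rewrite (le_trans (TC _))// (@le_trans _ _ (Num.max B C * `|T x|))//.
    by rewrite ler_wpM2r// le_max lexx orbT.
  by rewrite ler_wpM2l// le_max (ltW B0).
Qed.

End Xpw.

Section not_embeds_sum.
Context {R : realType} (p : R) (p2 : 2 < p) (p1 : 1 <= p) (w : nat -> R).
Local Notation co := finite_part_val.

Let p0 : 0 < p. Proof. exact: lt_le_trans p1. Qed.

(** The disjoint subspaces are the copies of [l^2], and the unit vectors of each
    copy have mutual distance [2^(1/2)]. *)
Lemma not_embeds_ell_sum : ~ embeds (ell_sum p1 (ell2 R)) (Xpw p1 w).
Proof.
move=> /embeds_Xpw[U [S [B [B0 UB SB USB]]]].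
have PH := @parallelogram_ell2 R R ge1_2 (@parallelogram_real R).
pose D k (x : ell_sum p1 (ell2 R)) := forall i, i != k -> co x i = 0.
apply: (@no_embedding_sum R p p2 p1 (ell2 R) _ U S B D
  (fun k x => `|co x k| ^+ 2) (fun=> 1) (fun=> 1)
  (fun k j => ell_single p1 k (ell_single ge1_2 j (1 : R)))) => //.
- by move=> k x y Dx Dy i ik; rewrite ell_addE Dx// Dy// addr0.
- by move=> k a x Dx i ik; rewrite ell_scaleE Dx// scaler0.
- by move=> k x y _ _; rewrite ell_addE ell_subE; exact: PH.
- by move=> k x Dx; rewrite mul1r lerXn2r ?nnegrE// ell_coord.
- by move=> k j i ik; rewrite ?ell_singleE (negPf ik).
- by move=> k j; rewrite !ell_single_norm normr1.
- move=> k j l jl; rewrite ell_subE ?ell_singleE eqxx.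
  have := @ell_coord _ _ (@ge1_2 R) R
     (ell_single ge1_2 j (1 : R) - ell_single ge1_2 l (1 : R)) j.
  rewrite ell_subE ?ell_singleE eqxx (negPf jl) subr0 normr1 => h.
  by rewrite -{1}(expr1n _ 2) lerXn2r ?nnegrE.
- move=> n z Dz; set sz := \sum_(0 <= k < n) z k; apply: ell_lep => m.
  rewrite (@le_trans _ _ (\sum_(0 <= i < n) `|co (z i) i| `^ p))//; last first.
    apply: ler_sum => i _; rewrite ler_powR2// ell_coord//.
  have zE i : co sz i = if (i < n)%N then co (z i) i else 0.
    rewrite /sz ell_sumE; case: ltnP => ni.
      rewrite (bigD1_seq i) ?mem_index_iota ?iota_uniq//=.
      by rewrite big1 ?addr0// => k ki; rewrite Dz// eq_sym.
    rewrite big_nat big1// => k /andP[_ kn]; rewrite Dz//.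
    by rewrite gtn_eqF// (leq_trans kn).
  apply: (@le_trans _ _ (\sum_(0 <= i < maxn m n) `|co sz i| `^ p)).
    rewrite [leRHS](big_cat_nat (leq0n m) (leq_maxl m n))/= lerDl sumr_ge0//.
  rewrite (big_cat_nat (leq0n n) (leq_maxr m n))/=.
  rewrite [X in _ + X]big_nat [X in _ + X]big1 ?addr0.
    by rewrite !big_nat; apply: ler_sum => i /andP[_ ni]; rewrite zE ni.
  by move=> i /andP[ni _]; rewrite zE ltnNge ni/= normr0 powR0// gt_eqF.
Qed.

End not_embeds_sum.

(** * Blocks of the unit vectors of X_{p,w} *)

Section finite_hoelder.
Context {R : realType}.

(** Young's inequality after normalization; [A + d] and [B + d] replace [A] and
    [B], which may vanish. *)
Lemma hoelder_sum (I : Type) (s : seq I) (p q : R) (a b : I -> R) (A B : R) :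
  0 < p -> 0 < q -> p^-1 + q^-1 = 1 ->
  (forall i, 0 <= a i) -> (forall i, 0 <= b i) -> 0 <= A -> 0 <= B ->
  \sum_(i <- s) a i `^ p <= A `^ p -> \sum_(i <- s) b i `^ q <= B `^ q ->
  \sum_(i <- s) a i * b i <= A * B.
Proof.
move=> p0 q0 pq a0 b0 A0 B0 sa sb.
have pos (d : R) : 0 < d -> \sum_(i <- s) a i * b i <= (A + d) * (B + d).
  move=> d0; have Ad : 0 < A + d by rewrite ltr_wpDl.
  have Bd : 0 < B + d by rewrite ltr_wpDl.
  rewrite -[leRHS]mul1r -ler_pdivrMr ?mulr_gt0// -[leRHS]pq mulr_suml.
  have unit (r : R) (f : I -> R) (F G : R) : 0 < r -> (forall i, 0 <= f i) ->
      0 <= F -> F <= G -> 0 < G -> \sum_(i <- s) f i `^ r <= F `^ r ->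
      \sum_(i <- s) (f i / G) `^ r / r <= r^-1.
    move=> r0 f0 F0 FG G0 sf; rewrite -mulr_suml ler_piMl ?invr_ge0 ?(ltW r0)//.
    under eq_bigr do rewrite powRM ?invr_ge0 ?(ltW G0)//.
    rewrite -mulr_suml -powR_inv1 ?(ltW G0)// powRAC powR_inv1 ?powR_ge0//.
    rewrite ler_pdivrMr ?powR_gt0// mul1r (le_trans sf)//.
    by rewrite ler_powR2// ltW.
  have ua := unit p a A (A + d) p0 a0 A0 _ Ad sa.
  have ub := unit q b B (B + d) q0 b0 B0 _ Bd sb.
  apply: (le_trans _ (lerD (ua _) (ub _))); rewrite ?lerDl ?(ltW d0)//.
  rewrite -big_split/=. apply: ler_sum => i _.
  by rewrite invfM mulrACA; apply: conjugate_powR => //; rewrite divr_ge0// ltW.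
rewrite leNgt; apply/negP => lt.
have [d d0 dlt] : exists2 d : R, 0 < d & (A + d) * (B + d) < \sum_(i <- s) a i * b i.
  pose t := \sum_(i <- s) a i * b i - A * B.
  have t0 : 0 < t by rewrite subr_gt0.
  have AB0 : 0 <= A + B by rewrite addr_ge0.
  pose d := Num.min 1 (t / (2 * (A + B + 1))).
  have d0 : 0 < d by rewrite lt_min ltr01 divr_gt0// mulr_gt0// ltr_wpDl.
  have d1 : d <= 1 by rewrite ge_min lexx.
  have dt : d * (2 * (A + B + 1)) <= t.
    by rewrite -ler_pdivlMr ?mulr_gt0 ?ltr_wpDl// ge_min lexx orbT.
  exists d => //.
  have -> : \sum_(i <- s) a i * b i = A * B + t by rewrite /t addrC subrK.
  have : d * d <= d * 1 by rewrite ler_wpM2l// ltW.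
  have : 0 <= d * (A + B) by rewrite mulr_ge0// ltW.
  lra.
by have := pos d d0; rewrite leNgt dlt.
Qed.

End finite_hoelder.

Section blocks.
Context {R : realType}.

Lemma block_index (t : nat -> nat) : t 0 = 0 -> (forall j, (t j < t j.+1)%N) ->
  exists blk : nat -> nat, forall i j, (t j <= i < t j.+1)%N -> blk i = j.
Proof.
move=> t0 tS.
have tmono : {homo t : m n / (m <= n)%N}.
  by apply: homo_leq => //; [exact: leq_trans|move=> j; exact/ltnW/tS].
exists (fun i => \max_(j < i.+1 | (t j <= i)%N) j)%N => i j /andP[ji ij].
have jt k : (k <= t k)%N by elim: k => // k IH; exact: leq_ltn_trans IH (tS k).
apply/eqP; rewrite eqn_leq; apply/andP; split.
  apply/bigmax_leqP => k tk; rewrite leqNgt; apply/negP => jk.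
  by have := leq_trans (tmono _ _ jk) tk; rewrite leqNgt ij.
have ji1 : (j < i.+1)%N by rewrite ltnS (leq_trans (jt j)).
exact: (@leq_bigmax_cond _ (fun k : 'I_i.+1 => t k <= i)%N (fun k => k : nat)
  (Ordinal ji1)).
Qed.

Lemma sum_blocks (t : nat -> nat) (f : nat -> R) n :
  t 0 = 0 -> (forall j, (t j < t j.+1)%N) ->
  \sum_(0 <= j < n) \sum_(t j <= i < t j.+1) f i = \sum_(0 <= i < t n) f i.
Proof.
move=> t0 tS; elim: n => [|n IH]; first by rewrite big_geq// t0 big_geq.
by rewrite big_nat_recr//= IH -big_cat_nat// ltnW.
Qed.

Lemma sum_le_blocks (t : nat -> nat) (f : nat -> R) n :
  t 0 = 0 -> (forall j, (t j < t j.+1)%N) -> (forall i, 0 <= f i) ->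
  \sum_(0 <= i < n) f i <= \sum_(0 <= j < n) \sum_(t j <= i < t j.+1) f i.
Proof.
move=> t0 tS f0; rewrite sum_blocks//.
have nt : (n <= t n)%N by elim: n => // k IH; exact: leq_ltn_trans IH (tS k).
by rewrite (big_cat_nat (leq0n n) nt)/= lerDl sumr_ge0.
Qed.

Variables (p : R) (p2 : 2 < p) (p1 : 1 <= p) (w : nat -> R).
Hypothesis w0 : forall i, 0 < w i.
Local Notation co := finite_part_val.

Let p0 : 0 < p. Proof. exact: lt_le_trans p1. Qed.

(** Let [S] be the sum of [u i ^ p] over a block. The block vector
    [S^(-1/p) \sum u i e_i] has norm 1 in [l^p], and [w' j] in the weighted
    [l^2] since [(w u)^2 = u^p]. The functional with coefficients
    [alpha i = S^(1/p - 1) u i ^ (p - 1)] takes the value 1 on it, has norm 1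
    on [l^p] and norm [1 / w' j] for the weighted [l^2] norm. Hence both the
    embedding and the projection are contractive for each of the two norms. *)
Lemma block_retract (t : nat -> nat) (u : nat -> R) (w' : nat -> R) :
  t 0 = 0 -> (forall j, (t j < t j.+1)%N) -> (forall i, 0 <= u i) ->
  (forall i, (w i * u i) ^+ 2 = u i `^ p) ->
  (forall j, 0 < \sum_(t j <= i < t j.+1) u i `^ p) ->
  (forall j, w' j = (\sum_(t j <= i < t j.+1) u i `^ p) `^ (2^-1 - p^-1)) ->
  retract 1 (Xpw p1 w') (Xpw p1 w).
Proof.
move=> t0 tS u0 wu S0 w'E; have [blk blkE] := block_index t0 tS.
pose S j := \sum_(t j <= i < t j.+1) u i `^ p.
have S0' j : 0 < S j by exact: S0.
(* coordinates of the block vectors and of the biorthogonal functionals *)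
pose beta i := S (blk i) `^ (- p^-1) * u i.
pose alpha i := S (blk i) `^ (p^-1 - 1) * u i `^ (p - 1).
have beta0 i : 0 <= beta i by rewrite mulr_ge0 ?powR_ge0.
have alpha0 i : 0 <= alpha i by rewrite mulr_ge0 ?powR_ge0.
have blk_sum (f : nat -> nat -> R) j :
    \sum_(t j <= i < t j.+1) f (blk i) i = \sum_(t j <= i < t j.+1) f j i.
  by rewrite !big_nat; apply: eq_bigr => i /blkE ->.
have u1 i : u i * u i `^ (p - 1) = u i `^ p by rewrite mulr_powRB1.
have Spow j (a b : R) : S j `^ a * S j `^ b = S j `^ (a + b).
  by rewrite powRD// (gt_eqF (S0' _)) implybT.
have S1 j (a : R) : a + 1 = 0 -> S j `^ a * S j = 1.
  by move=> a1; rewrite -{2}[S j]powRr1 ?(ltW (S0' _))// Spow a1 powRr0.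
have beta_p j : \sum_(t j <= i < t j.+1) beta i `^ p = 1.
  rewrite (blk_sum (fun j i => (S j `^ (- p^-1) * u i) `^ p)).
  under eq_bigr do rewrite powRM ?powR_ge0// -powRrM mulNr mulVf ?gt_eqF//.
  by rewrite -mulr_sumr S1// addNr.
have alphabeta j : \sum_(t j <= i < t j.+1) alpha i * beta i = 1.
  rewrite (blk_sum (fun j i => (S j `^ (p^-1 - 1) * u i `^ (p - 1)) *
    (S j `^ (- p^-1) * u i))).
  under eq_bigr do rewrite mulrACA Spow [_ `^ _ * u _]mulrC u1.
  by rewrite -mulr_sumr S1//; ring.
have beta_2 j : \sum_(t j <= i < t j.+1) (w i * beta i) ^+ 2 = w' j ^+ 2.
  rewrite (blk_sum (fun j i => (w i * (S j `^ (- p^-1) * u i)) ^+ 2)).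
  under eq_bigr do rewrite mulrCA exprMn wu.
  rewrite -mulr_sumr w'E -/(S j) -!powR2 ?powR_ge0// -!powRrM.
  rewrite -{2}[S j]powRr1 ?(ltW (S0' _))// Spow; congr (_ `^ _).
  by field; rewrite gt_eqF.
pose q := p / (p - 1).
have pm1 : 0 < p - 1 by have := p2; lra.
have q0 : 0 < q by rewrite divr_gt0.
have pq : p^-1 + q^-1 = 1 by rewrite /q; field; rewrite !gt_eqF.
have alpha_q j : \sum_(t j <= i < t j.+1) alpha i `^ q <= 1 `^ q.
  rewrite (blk_sum (fun j i => (S j `^ (p^-1 - 1) * u i `^ (p - 1)) `^ q)).
  have e1 : (p - 1) * q = p by rewrite /q; field; rewrite gt_eqF.
  have e2 : (p^-1 - 1) * q = -1 by rewrite /q; field; rewrite !gt_eqF.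
  under eq_bigr do rewrite powRM ?powR_ge0// -!powRrM e1 e2.
  by rewrite -mulr_sumr S1 ?addNr// powR1.
have alpha_2 j : \sum_(t j <= i < t j.+1) (w' j * (alpha i / w i)) `^ 2 <= 1 `^ 2.
  rewrite (blk_sum (fun k i => (w' j * ((S k `^ (p^-1 - 1) * u i `^ (p - 1)) / w i)) `^ 2)).
  rewrite (eq_bigr (fun i => S j `^ (-1) * u i `^ p)).
    by rewrite -mulr_sumr S1 ?addNr// powR1.
  move=> i _; have wi := w0 i.
  rewrite powR2; last by rewrite w'E !mulr_ge0 ?powR_ge0// invr_ge0 ltW.
  have uw : (u i `^ (p - 1) / w i) ^+ 2 = u i `^ p.
    rewrite expr_div_n; apply: (@mulIf _ (w i ^+ 2)).
      by rewrite expf_neq0// gt_eqF.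
    rewrite divfK ?expf_neq0 ?gt_eqF//.
    have [->|un0] := eqVneq (u i) 0.
      by rewrite !powR0 ?gt_eqF// expr0n/= mul0r.
    apply: (@mulIf _ (u i ^+ 2)); first by rewrite expf_neq0.
    by rewrite -[LHS]exprMn [_ * u i]mulrC u1 -[RHS]mulrA -exprMn wu expr2.
  rewrite -mulrA mulrA exprMn uw w'E -/(S j) Spow -powR2 ?powR_ge0// -powRrM.
  by congr (_ `^ _ * _); field; rewrite gt_eqF.
have [||J [JE JC]] := @finite_part_map_of R (Xpw p1 w') _ (Xpw_enorm p1 w)
    (fun d i => co d (blk i) * beta i) 1.
- move=> a d d'; apply/funext => i.
  have coE : co (a *: d + d') (blk i) = a * co d (blk i) + co d' (blk i) by [].
  have lin (s s' b : R) : (a * s + s') * b = a * (s * b) + s' * b by ring.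
  exact: etrans (congr1 (fun s : R => s * beta i) coE) (lin _ _ _).
- move=> d; rewrite mul1r; apply: Xpw_norm_le => // n.
    apply: le_trans (Xpw_partial d n).
    apply: (le_trans (sum_le_blocks n t0 tS _)) => [i|]; first exact: powR_ge0.
    apply: ler_sum => j _.
    rewrite (blk_sum (fun j i => `|co d j * beta i| `^ p)).
    under eq_bigr do rewrite normrM powRM// (ger0_norm (beta0 _)).
    by rewrite -mulr_sumr beta_p mulr1.
  apply: le_trans (Xpw_partial2 d n).
  apply: (le_trans (sum_le_blocks n t0 tS _)) => [i|]; first exact: sqr_ge0.
  apply: ler_sum => j _.
  rewrite (blk_sum (fun j i => (w i * (co d j * beta i)) ^+ 2)).
  under eq_bigr do rewrite mulrCA exprMn.
  by rewrite -mulr_sumr beta_2 -exprMn mulrC.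
have [||Q [QE QC]] := @finite_part_map_of R (Xpw p1 w) _ (Xpw_enorm p1 w')
    (fun x j => \sum_(t j <= i < t j.+1) alpha i * co x i) 1.
- move=> a x y; apply/funext => j.
  transitivity (a * (\sum_(t j <= i < t j.+1) alpha i * co x i) +
    \sum_(t j <= i < t j.+1) alpha i * co y i); last by [].
  rewrite mulr_sumr -big_split/=.
  apply: eq_bigr => i _.
  have coE : co (a *: x + y) i = a * co x i + co y i by [].
  have lin (s s' b : R) : b * (a * s + s') = a * (b * s) + b * s' by ring.
  exact: etrans (congr1 (fun s : R => alpha i * s) coE) (lin _ _ _).
- move=> x; rewrite mul1r; apply: Xpw_norm_le => // n.
    apply: le_trans (Xpw_partial x (t n)); rewrite -(sum_blocks _ n t0 tS).
    apply: ler_sum => j _.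
    set s := \sum_(_ <= i < _) `|co x i| `^ p.
    have s0 : 0 <= s by apply: sumr_ge0 => i _; exact: powR_ge0.
    rewrite -[leRHS](@powRVK _ p) ?gt_eqF// ler_powR2 ?powR_ge0//.
    apply: (le_trans (ler_norm_sum _ _ _)).
    under eq_bigr do rewrite normrM (ger0_norm (alpha0 _)) mulrC.
    rewrite -[leRHS]mulr1; apply: (hoelder_sum p0 q0 pq) => //.
    - exact: powR_ge0.
    - by rewrite powRVK// gt_eqF.
  apply: le_trans (Xpw_partial2 x (t n)); rewrite -(sum_blocks _ n t0 tS).
  apply: ler_sum => j _.
  set s := \sum_(_ <= i < _) (w i * co x i) ^+ 2.
  have s0 : 0 <= s by apply: sumr_ge0 => i _; exact: sqr_ge0.
  have w'0 : 0 <= w' j by rewrite w'E powR_ge0.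
  rewrite -real_normK ?num_real// -!powR2//.
  rewrite -[leRHS](@powRVK _ 2)// ler_powR2 ?powR_ge0//.
  rewrite normrM (ger0_norm w'0).
  apply: (@le_trans _ _ (\sum_(t j <= i < t j.+1) `|w i * co x i| *
      (w' j * (alpha i / w i)))).
    rewrite (le_trans (ler_wpM2l w'0 (ler_norm_sum _ _ _)))// mulr_sumr.
    apply: ler_sum => i _; rewrite [in leLHS]normrM (ger0_norm (alpha0 _)) normrM.
    rewrite (ger0_norm (ltW (w0 i))) le_eqVlt; apply/orP; left; apply/eqP.
    by field; rewrite gt_eqF.
  rewrite -[leRHS]mulr1; apply: (@hoelder_sum _ _ _ 2 2) => //.
  - by field.
  - by move=> i; rewrite mulr_ge0// divr_ge0// ltW.
  - exact: powR_ge0.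
  - rewrite powRVK//; apply: ler_sum => i _.
    by rewrite powR2// real_normK ?num_real.
exists J, Q; split=> // d; apply: val_inj; apply/funext => j; rewrite QE.
have -> : co (J d) = fun i => co d (blk i) * beta i by rewrite -JE.
rewrite (blk_sum (fun k i => alpha i * (co d k * beta i))).
under eq_bigr do rewrite mulrCA.
by rewrite -mulr_sumr alphabeta mulr1.
Qed.

End blocks.

(** * Weights, and bases of X_{p,w} *)

Section weights.
Context {R : realType} (p : R) (p2 : 2 < p) (p1 : 1 <= p) (w : nat -> R).
Hypotheses (w0 : forall i, 0 < w i) (w_star : star_condition p w).
Local Notation co := finite_part_val.
Local Notation r := (2 * p / (p - 2)).

Let p0 : 0 < p. Proof. exact: lt_le_trans p1. Qed.
Let pm0 : 0 < p - 2. Proof. by rewrite subr_gt0. Qed.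
Let r0 : 0 < r. Proof. by rewrite divr_gt0// mulr_gt0. Qed.

(** The sum over the indices with [w i ^ r < s] diverges and its terms are less
    than [s], so the first partial sum that reaches [s] stays below [2 s]. *)
Lemma star_block (s : R) n0 : 0 < s -> exists2 n1, (n0 < n1)%N &
  s <= \sum_(n0 <= i < n1 | w i < s `^ r^-1) w i `^ r <= 2 * s.
Proof.
move=> s0; set e := s `^ r^-1.
have e0 : 0 < e by rewrite powR_gt0.
pose f n := \sum_(n0 <= i < n | w i < e) w i `^ r.
have [n nP] : exists n, s <= f n.
  apply: contrapT => /forallNP H.
  have : (\sum_(n <oo | (w n < e)%R) (w n `^ r)%:E <=
      (\sum_(0 <= i < n0 | (w i < e)%R) w i `^ r + s)%:E)%E.
    apply: lime_le.
      by apply: is_cvg_nneseries => n _ _; rewrite lee_fin powR_ge0.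
    apply: nearW => n; rewrite sumEFin lee_fin.
    have [nn0|n0n] := leqP n n0.
      rewrite [in leRHS](big_cat_nat (leq0n n) nn0)/= -addrA lerDl.
      by rewrite addr_ge0 ?(ltW s0)// sumr_ge0// => i _; exact: powR_ge0.
    rewrite [leLHS](big_cat_nat (leq0n n0) (ltnW n0n))/= lerD2l.
    by have := H n; rewrite /f => /negP; rewrite -ltNge => /ltW.
  by rewrite (w_star e0) leye_eq.
have exn : exists n, s <= f n by exists n.
case: (ex_minnP exn) => m ms mmin.
have n0m : (n0 < m)%N.
  rewrite ltnNge; apply/negP => mn; move: ms; rewrite /f big_geq//.
  by rewrite leNgt s0.
exists m => //; rewrite -/(f m) ms/=.
case: m ms mmin n0m => // m ms mmin n0m.
rewrite /f big_mkcond big_nat_recr//= -big_mkcond/=.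
rewrite [leRHS](_ : 2 * s = s + s); last by ring.
apply: lerD.
  by rewrite leNgt -/(f m); apply/negP => /ltW /mmin; rewrite ltnn.
case: ifP => [we|_]; last exact: ltW.
by rewrite -(@powRVK _ r s) ?gt_eqF ?(ltW s0)// -/e ler_powR2 ?ltW//.
Qed.

(** The equation [(w u)^2 = u^p] of [block_retract] forces
    [u i = w i ^ (2 / (p - 2))], and then [u i ^ p = w i ^ r] is the quantity
    whose sum the condition on [w] allows to prescribe. *)
Lemma star_weights (a : nat -> R) : (forall j, 0 < a j) ->
  exists w' : nat -> R, (forall j, a j <= w' j <= 2 * a j) /\
    retract 1 (Xpw p1 w') (Xpw p1 w).
Proof.
move=> a0; pose g := 2^-1 - p^-1 : R.
have g0 : 0 < g by rewrite subr_gt0 ltf_pV2 ?posrE.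
pose s j := a j `^ g^-1.
have s0 j : 0 < s j by rewrite powR_gt0.
have /choice[next nextP] (jn : nat * nat) : exists n1, (jn.2 < n1)%N /\
    s jn.1 <= \sum_(jn.2 <= i < n1 | w i < s jn.1 `^ r^-1) w i `^ r <= 2 * s jn.1.
  by have [n1] := @star_block (s jn.1) jn.2 (s0 _); exists n1.
pose t n := iteri n (fun j m => next (j, m)) 0%N.
have tS j : (t j < t j.+1)%N by have [] := nextP (j, t j).
have [blk blkE] := @block_index t erefl tS.
pose b := 2 / (p - 2).
have b0 : 0 < b by rewrite divr_gt0.
pose u i := if w i < s (blk i) `^ r^-1 then w i `^ b else 0.
have bp : b * p = r by rewrite /b mulrAC.
have up i : u i `^ p = if w i < s (blk i) `^ r^-1 then w i `^ r else 0.
  by rewrite /u; case: ifP => _; rewrite ?powR0 ?gt_eqF// -powRrM bp.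
have SE j : \sum_(t j <= i < t j.+1) u i `^ p =
    \sum_(t j <= i < t j.+1 | w i < s j `^ r^-1) w i `^ r.
  rewrite [RHS]big_mkcond !big_nat; apply: eq_bigr => i ij.
  by rewrite up (blkE _ _ ij).
have SP j : s j <= \sum_(t j <= i < t j.+1) u i `^ p <= 2 * s j.
  by rewrite SE; have [_] := nextP (j, t j).
have Spos j : 0 < \sum_(t j <= i < t j.+1) u i `^ p.
  by have /andP[+ _] := SP j; exact: lt_le_trans.
exists (fun j => (\sum_(t j <= i < t j.+1) u i `^ p) `^ g); split=> [j|].
  have /andP[sS S2] := SP j.
  have aE : a j = s j `^ g by rewrite powRVK ?gt_eqF// ltW.
  apply/andP; split; first by rewrite aE ler_powR2// ltW.
  apply: (@le_trans _ _ ((2 * s j) `^ g)).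
    by rewrite ler_powR2// ?ltW// mulr_gt0.
  rewrite powRM ?(ltW (s0 _))// -aE ler_wpM2r ?(ltW (a0 _))//.
  rewrite ler1_powR ?ler1n// /g; have : 0 < p^-1 by rewrite invr_gt0.
  lra.
apply: (@block_retract _ p p2 p1 w w0 t u _ erefl tS) => // i.
  by rewrite /u; case: ifP => // _; rewrite powR_ge0.
rewrite up /u; case: ifP => _; last by rewrite mulr0 expr0n.
rewrite -powR2 ?mulr_ge0 ?powR_ge0 ?(ltW (w0 _))//.
rewrite -{1}[w i]powRr1 ?(ltW (w0 _))// -powRD ?(gt_eqF (w0 _)) ?implybT// -powRrM.
by congr (_ `^ _); rewrite /b; field; rewrite gt_eqF.
Qed.

End weights.

Section ell2_ellp.
Context {R : realType} (p : R) (p1 : 1 <= p).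
Local Notation co := finite_part_val.

Let p0 : 0 < p. Proof. exact: lt_le_trans p1. Qed.

(** The inclusion of [l^2] into [l^p]. *)
Lemma ell2_partial_pow (p2 : 2 <= p) (x : ell2 R) n :
  \sum_(0 <= i < n) `|co x i| `^ p <= `|x| `^ p.
Proof.
have pE (y : R) : 0 <= y -> y `^ p = y `^ 2 * y `^ (p - 2).
  move=> y0; rewrite -powRD; first by rewrite addrC subrK.
  by rewrite [2 + _]addrC subrK gt_eqF.
apply: (@le_trans _ _ (\sum_(0 <= i < n) `|co x i| `^ 2 * `|x| `^ (p - 2))).
  apply: ler_sum => i _; rewrite pE// ler_wpM2l ?powR_ge0//.
  by apply: ge0_ler_powR; rewrite ?subr_ge0 ?nnegrE// ell_coord.
by rewrite -mulr_suml [leRHS]pE// ler_wpM2r ?powR_ge0// ell_partial.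
Qed.

Lemma sum_double (f : nat -> R) n :
  \sum_(0 <= i < n.*2) f i = \sum_(0 <= j < n) (f j.*2 + f j.*2.+1).
Proof.
elim: n => [|n IH]; first by rewrite !big_geq.
by rewrite doubleS !big_nat_recr//= IH addrA.
Qed.

Lemma sum_geometric n : \sum_(0 <= j < n) 2^-1 ^+ j.+1 = 1 - 2^-1 ^+ n :> R.
Proof.
elim: n => [|n IH]; first by rewrite big_geq// expr0 subrr.
by rewrite big_nat_recr//= IH exprS; field.
Qed.

(** On the even indices the weighted [l^2] norm dominates and is equivalent to
    the [l^2] norm; on the odd ones the weights are square summable and the
    [l^p] norm dominates. *)
Lemma ell2_ellp_retract (p2 : 2 <= p) (w : nat -> R) :
  (forall j, 1 <= w j.*2 <= 2) ->
  (forall j, 0 <= w j.*2.+1 <= 2^-1 ^+ j.+1) ->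
  retract 3 (ell2 R * ell p1)%type (Xpw p1 w).
Proof.
move=> weven wodd.
pose F (z : (ell2 R * ell p1)%type) i := if odd i then co z.2 i./2 else co z.1 i./2.
have F0 z j : F z j.*2 = co z.1 j by rewrite /F odd_double doubleK.
have F1 z j : F z j.*2.+1 = co z.2 j by rewrite /F /= odd_double/= uphalf_double.
have le_double (f : nat -> R) n : (forall i, 0 <= f i) ->
    \sum_(0 <= i < n) f i <= \sum_(0 <= i < n.*2) f i.
  move=> f0; have nn : (n <= n.*2)%N by rewrite -addnn leq_addr.
  by rewrite [leRHS](big_cat_nat (leq0n n) nn)/= lerDl sumr_ge0.
have n1 (z : (ell2 R * ell p1)%type) : `|z.1| <= `|z| by rewrite pair_normE le_max lexx.
have n2 (z : (ell2 R * ell p1)%type) : `|z.2| <= `|z|.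
  by rewrite pair_normE le_max lexx orbT.
have [||J [JE JC]] := @finite_part_map_of R _ _ (Xpw_enorm p1 w) F 3.
- move=> a x y; apply/funext => i.
  suff : F (a *: x + y) i = a * F x i + F y i by [].
  rewrite /F; case: (odd i).
    have -> : (a *: x + y).2 = a *: x.2 + y.2 by [].
    by rewrite ell_addE ell_scaleE.
  have -> : (a *: x + y).1 = a *: x.1 + y.1 by [].
  by rewrite ell_addE ell_scaleE.
- move=> z; apply: Xpw_norm_le => //.
    move=> n; apply: (le_trans (le_double _ n _)) => [i|]; first exact: powR_ge0.
    rewrite sum_double big_split/=.
    under eq_bigr do rewrite F0.
    under [X in _ + X <= _]eq_bigr do rewrite F1.
    apply: (le_trans (lerD (ell2_partial_pow p2 _ _) (ell_partial _ _))).
    rewrite powRM// (@le_trans _ _ (`|z| `^ p + `|z| `^ p))//.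
      by rewrite lerD// ler_powR2// ?n1 ?n2.
    rewrite [leLHS](_ : _ = 2 * `|z| `^ p); last by ring.
    rewrite ler_wpM2r ?powR_ge0//.
    by rewrite (@le_trans _ _ 3)// ?ler_nat// le1r_powR// ler1n.
  move=> n; apply: (le_trans (le_double _ n _)) => [i|]; first exact: sqr_ge0.
  rewrite sum_double big_split/=.
  under eq_bigr do rewrite F0.
  under [X in _ + X <= _]eq_bigr do rewrite F1.
  apply: (@le_trans _ _ (4 * `|z| ^+ 2 + `|z| ^+ 2)); last first.
    by rewrite exprMn; have := sqr_ge0 `|z|; lra.
  apply: lerD.
    apply: (@le_trans _ _ (4 * `|z.1| ^+ 2)); last first.
      by rewrite ler_wpM2l// lerXn2r ?nnegrE.
    rewrite -powR2// (le_trans _ (ler_wpM2l _ (ell_partial z.1 n)))//.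
    rewrite mulr_sumr; apply: ler_sum => i _.
    rewrite powR2// real_normK ?num_real// exprMn ler_wpM2r ?sqr_ge0//.
    have /andP[w1 w2] := weven i.
    by have -> : 4 = 2 ^+ 2 :> R; [ring|rewrite lerXn2r ?nnegrE//; lra].
  apply: (@le_trans _ _ (\sum_(0 <= j < n) 2^-1 ^+ j.+1 * `|z| ^+ 2)).
    apply: ler_sum => j _; have /andP[w1 w2] := wodd j.
    rewrite exprMn ler_pM ?sqr_ge0//.
      rewrite (le_trans _ w2)// expr2 ler_piMr// (le_trans w2)//.
      by rewrite exprn_ile1// invf_le1// ler1n.
    rewrite -(real_normK (num_real (co z.2 j))) lerXn2r ?nnegrE//.
    by rewrite (le_trans (ell_coord _ _)).
  by rewrite -mulr_suml sum_geometric ler_piMl ?sqr_ge0//.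
have [||Q1 [Q1E Q1C]] := @finite_part_map_of R (Xpw p1 w) _ (ell_enorm (@ge1_2 R) R)
    (fun x j => co x j.*2) 1.
- by [].
- move=> x; rewrite mul1r; apply: (ell_norm_le (@ge1_2 R)) => // n; rewrite powR2//.
  apply: le_trans (Xpw_partial2 x n.*2); rewrite sum_double; apply: ler_sum => j _.
  have /andP[w1 _] := weven j.
  rewrite powR2// real_normK ?num_real// -[leLHS]addr0 lerD ?sqr_ge0//.
  by rewrite exprMn ler_peMl ?sqr_ge0// -(expr1n _ 2) lerXn2r ?nnegrE//; lra.
have [||Q2 [Q2E Q2C]] := @finite_part_map_of R (Xpw p1 w) _ (ell_enorm p1 R)
    (fun x j => co x j.*2.+1) 1.
- by [].
- move=> x; rewrite mul1r; apply: ell_norm_le => // n.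
  apply: le_trans (Xpw_partial x n.*2); rewrite sum_double; apply: ler_sum => j _.
  by rewrite lerDr powR_ge0.
have [Q QE] := pair_map_of Q1 Q2.
exists J, Q; split=> // [x|z].
  rewrite QE pair_normE ge_max; apply/andP; split.
    by rewrite (le_trans (Q1C _))// ler_wpM2r// ler1n.
  by rewrite (le_trans (Q2C _))// ler_wpM2r// ler1n.
rewrite QE [RHS]surjective_pairing; congr pair; apply: val_inj.
  rewrite Q1E; apply/funext => j.
  by rewrite (_ : co (J z) = F z) ?F0// -JE.
rewrite Q2E; apply/funext => j.
by rewrite (_ : co (J z) = F z) ?F1// -JE.
Qed.

(** [l^2] is the first copy, and [l^p] is spanned by the first unit vectors of
    the other copies. *)
Lemma ell2_ellp_retract_sum : retract 2 (ell2 R * ell p1)%type (ell_sum p1 (ell2 R)).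
Proof.
pose F (z : (ell2 R * ell p1)%type) i : ell2 R :=
  if i is j.+1 then ell_single ge1_2 0 (co z.2 j) else z.1.
have [||J [JE JC]] := @finite_part_map_of R _ _ (ell_enorm p1 (ell2 R)) F 2.
- move=> a x y; apply/funext => -[|i].
    have e1 : (a *: x + y).1 = a *: x.1 + y.1 by [].
    exact: e1.
  have lin := ell_single_linear ge1_2 0 a (co x.2 i) (co y.2 i).
  have co2 : co (a *: x + y).2 i = a *: co x.2 i + co y.2 i.
    have -> : (a *: x + y).2 = a *: x.2 + y.2 by [].
    by rewrite ell_addE ell_scaleE.
  exact: etrans (congr1 (ell_single (@ge1_2 R) 0) co2) lin.
- move=> z; apply: ell_norm_le => //.
  case=> [|n]; first by rewrite big_geq// powR_ge0.
  rewrite big_nat_recl//=.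
  under eq_bigr do rewrite ell_single_norm.
  apply: (le_trans (lerD (lexx _) (ell_partial _ _))).
  rewrite powRM// (@le_trans _ _ (`|z| `^ p + `|z| `^ p))//.
    by rewrite lerD// ler_powR2// pair_normE le_max lexx ?orbT.
  rewrite [leLHS](_ : _ = 2 * `|z| `^ p); last by ring.
  rewrite ler_wpM2r ?powR_ge0//.
  by rewrite le1r_powR// ler1n.
have [Q1 [Q1E Q1C]] : exists Q1 : {linear ell_sum p1 (ell2 R) -> ell2 R},
    (forall y, Q1 y = co y 0%N) /\ forall y, `|Q1 y| <= `|y|.
  have [Q1 Q1E] : exists Q1 : {linear ell_sum p1 (ell2 R) -> ell2 R},
    Q1 =1 fun y => co y 0%N by exact: linear_of.
  by exists Q1; split=> // y; rewrite Q1E ell_coord.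
have [||Q2 [Q2E Q2C]] := @finite_part_map_of R (ell_sum p1 (ell2 R)) _ (ell_enorm p1 R)
    (fun y j => co (co y j.+1) 0%N) 1.
- move=> a x y; apply/funext => j.
  have e1 : co (a *: x + y) j.+1 = a *: co x j.+1 + co y j.+1.
    by rewrite ell_addE ell_scaleE.
  exact: (congr1 (fun z : ell2 R => co z 0%N) e1).
- move=> y; rewrite mul1r; apply: ell_norm_le => // n.
  apply: le_trans (ell_partial y n.+1); rewrite big_nat_recl//= -[leLHS]add0r.
  rewrite lerD ?powR_ge0//; apply: ler_sum => i _.
  by rewrite ler_powR2// (ell_coord (co y i.+1)).
have [Q QE] := pair_map_of Q1 Q2.
exists J, Q; split=> // [y|z].
  rewrite QE pair_normE ge_max; apply/andP; split.
    by rewrite (le_trans (Q1C _))// ler_peMl// ler1n.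
  by rewrite (le_trans (Q2C _))// ler_wpM2r// ler1n.
have JE' : co (J z) = F z by rewrite -JE.
rewrite QE [RHS]surjective_pairing; congr pair; first by rewrite Q1E JE'.
apply: val_inj; rewrite Q2E; apply/funext => j.
by rewrite JE' /F; rewrite ?ell_singleE.
Qed.

End ell2_ellp.

Section basis.
Context {R : realType} (p : R) (p1 : 1 <= p) (w : nat -> R).
Local Notation co := finite_part_val.
Local Notation X := (Xpw p1 w).
Local Notation root n := (n%:R `^ (2^-1)).

Let p0 : 0 < p. Proof. exact: lt_le_trans p1. Qed.

Lemma sum_mem_le (s : seq nat) m : uniq s ->
  \sum_(0 <= i < m) (i \in s)%:R <= (size s)%:R :> R.
Proof.
move=> us; rewrite -natr_sum ler_nat -big_mkcond sum1_count -size_filter.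
apply: uniq_leq_size; first by rewrite filter_uniq// iota_uniq.
by move=> i; rewrite mem_filter => /andP[].
Qed.

Lemma Xpw_basis : exists b : nat -> X, forall j i, co (b j) i = (i == j)%:R.
Proof.
suff H j : (fun i => (i == j)%:R : R) \in enorm_fin (Xpw_enorm p1 w).
  by exists (fun j => FinitePart (H j)).
pose M := 1 + `|w j|.
have M1 : 1 <= M by rewrite lerDl.
have M0 : 0 <= M by rewrite (le_trans _ M1).
have sumj n (f : nat -> R) : (forall i, i != j -> f i = 0) -> 0 <= f j ->
    \sum_(0 <= i < n) f i <= f j.
  move=> fj0 fj; have [jn|nj] := ltnP j n.
    rewrite (bigD1_seq j) ?mem_index_iota ?iota_uniq//=.
    by rewrite big1 ?addr0// => i /fj0.
  by rewrite big_nat big1// => i /andP[_ ni]; rewrite fj0// ltn_eqF// (leq_trans ni).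
rewrite unfold_in /enorm_fin; apply: le_lt_trans (ltry M).
apply: Xpw_norm_le => // n.
  apply: (le_trans (sumj _ _ _ _)); rewrite ?powR_ge0//.
    by move=> i /negPf->; rewrite normr0 powR0// gt_eqF.
  by rewrite eqxx normr1 ler_powR2.
apply: (le_trans (sumj _ _ _ _)); rewrite ?sqr_ge0//.
  by move=> i /negPf->; rewrite mulr0 expr0n.
rewrite eqxx mulr1 -real_normK ?num_real// lerXn2r ?nnegrE//.
by rewrite lerDr.
Qed.

Lemma Xpw_basis_signs (b : nat -> X) (a : R) :
  (forall j i, co (b j) i = (i == j)%:R) -> (forall j, 0 <= w j <= a) ->
  forall s e, uniq s -> `|\sum_(j <- s) (-1) ^+ (e j : bool) *: b j| <=
    Num.max ((size s)%:R `^ p^-1) (a * root (size s)).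
Proof.
move=> bE wa s e us; set x := \sum_(j <- s) _.
have a0 : 0 <= a by have /andP[w0] := wa 0%N; exact: le_trans.
have xE i : co x i = if i \in s then (-1) ^+ e i else 0.
  have -> : co x i = \sum_(j <- s) (-1) ^+ e j * co (b j) i.
    by rewrite /x; elim/big_rec2: _ => // j c d _ <-.
  case: ifPn => si.
    rewrite (bigD1_seq i)//= bE eqxx mulr1 big1 ?addr0// => j ij.
    by rewrite bE eq_sym (negPf ij) mulr0.
  rewrite big_seq big1// => j js; rewrite bE.
  by case: eqP js si => [->->|]; rewrite ?mulr0.
have absx i : `|co x i| = (i \in s)%:R.
  by rewrite xE; case: ifP; rewrite ?normr_sign ?normr0.
rewrite -lee_fin [leLHS]finite_part_normE; apply: (Xpw_norm_le p1).
- by rewrite le_max powR_ge0.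
- move=> n; rewrite (@le_trans _ _ (((size s)%:R `^ p^-1) `^ p))//; last first.
    by rewrite ler_powR2 ?le_max ?powR_ge0 ?lexx.
  rewrite powRVK ?gt_eqF// (le_trans _ (sum_mem_le n us))//.
  apply: ler_sum => i _; rewrite absx; case: (i \in s).
    by rewrite powR1.
  by rewrite powR0 ?gt_eqF.
- move=> n; rewrite (@le_trans _ _ ((a * root (size s)) ^+ 2))//; last first.
    by rewrite lerXn2r ?nnegrE ?le_max ?powR_ge0 ?lexx ?orbT// mulr_ge0 ?powR_ge0.
  rewrite exprMn -(powR2 (powR_ge0 _ _)) powRVK//.
  rewrite (le_trans _ (ler_wpM2l (sqr_ge0 a) (sum_mem_le n us)))// mulr_sumr.
  apply: ler_sum => i _; have /andP[wi0 wia] := wa i.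
  rewrite exprMn -(real_normK (num_real (co x i))) absx ler_pM ?sqr_ge0//.
    by rewrite lerXn2r ?nnegrE.
  by case: (i \in s); rewrite ?expr1n ?expr0n.
Qed.

Lemma sum_uniq_le (f : nat -> R) (s : seq nat) : uniq s -> (forall i, 0 <= f i) ->
  exists m, \sum_(j <- s) f j <= \sum_(0 <= i < m) f i.
Proof.
move=> us f0; pose m := (\max_(j <- s) j).+1; exists m.
have sm j : j \in s -> (j < m)%N by move=> js; rewrite ltnS leq_bigmax_seq.
rewrite [leRHS](bigID (mem s))/= -[leLHS]addr0 lerD ?sumr_ge0//.
rewrite -[leRHS]big_filter le_eqVlt; apply/orP; left; apply/eqP.
apply: perm_big; apply: uniq_perm => //; first by rewrite filter_uniq// iota_uniq.
move=> j; rewrite mem_filter mem_index_iota leq0n/=.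
by case: (boolP (j \in s)) => // /sm ->.
Qed.

(** The Cauchy-Schwarz inequality for the weighted [l^2] norm. *)
Lemma Xpw_coord_signs (a : R) : 0 < a -> (forall j, a <= w j) ->
  forall s e (x : X), uniq s -> `|\sum_(j <- s) (-1) ^+ (e j : bool) * co x j| <=
    a^-1 * root (size s) * `|x|.
Proof.
move=> a0 wa s e x us; apply: (le_trans (ler_norm_sum _ _ _)).
rewrite (eq_bigr (fun j => 1 * `|co x j|)); last first.
  by move=> j _; rewrite normrM normr_sign.
have -> : a^-1 * root (size s) * `|x| = root (size s) * (a^-1 * `|x|) by ring.
apply: (@hoelder_sum _ _ _ 2 2) => //.
- by field.
- by rewrite mulr_ge0// invr_ge0 ltW.
- by rewrite powRVK// powR1 -(natr_sum _ _ _ (fun=> 1%N)) sum1_size.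
rewrite powR2; last by rewrite mulr_ge0// invr_ge0 ltW.
have [|m sm] := @sum_uniq_le (fun j => `|co x j| `^ 2) s us.
  by move=> i; exact: powR_ge0.
apply: (le_trans sm); rewrite exprMn.
apply: le_trans (ler_wpM2l _ (Xpw_partial2 x m)); last exact: sqr_ge0.
rewrite mulr_sumr; apply: ler_sum => i _.
rewrite powR2// real_normK ?num_real// exprMn mulrA ler_peMl ?sqr_ge0//.
rewrite -exprMn -(expr1n _ 2) lerXn2r ?nnegrE//.
  by rewrite mulr_ge0// ?invr_ge0 ltW// (lt_le_trans a0).
by rewrite mulrC ler_pdivlMr// mul1r.
Qed.

End basis.

(** * Duality of l^p-sums *)

Section duality.
Context {R : realType}.
Local Notation co := finite_part_val.

Definition isometric_dual (X' X : normedModType R) : Prop :=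
  exists (Psi : {linear X' -> dual X}) (Phi : {linear dual X -> X'}),
    [/\ forall y, `|Psi y| <= `|y|, forall f, `|Phi f| <= `|f|,
        cancel Psi Phi & cancel Phi Psi].

Lemma cvgn_real_unique (u : nat -> R) (l l' : R) :
  u @ \oo --> l -> u @ \oo --> l' -> l = l'.
Proof.
by move=> ul ul'; rewrite -(cvg_lim (@Rhausdorff R) ul) -(cvg_lim (@Rhausdorff R) ul').
Qed.

Lemma dual_eq (X : normedModType R) (f g : dual X) : (forall x, f x = g x) -> f = g.
Proof. by move=> fg; apply: val_inj; apply/funext. Qed.

Lemma isometric_dual_real : isometric_dual R R.
Proof.
have [||x y|Psi [PsiE PsiC]] := @dual_map_of R R R (fun a x => a * x) 1 ler01.
- move=> a x y; apply/funext => z.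
  have lin (s t : R) : (a * s + t) * z = a * (s * z) + t * z by ring.
  exact: lin.
- move=> x a y z.
  have lin (s t : R) : x * (a * s + t) = a * (x * s) + x * t by ring.
  exact: lin.
- by rewrite normrM mul1r.
have [Phi PhiE] : exists Phi : {linear dual R -> R}, Phi =1 fun f => f 1.
  exact: linear_of.
exists Psi, Phi; split=> [y|f|y|f].
- by rewrite -[leRHS]mul1r.
- by rewrite PhiE le_dual_norm// normr1.
- by rewrite PhiE PsiE mulr1.
- apply: dual_eq => x; rewrite PsiE PhiE mulrC.
  have fZ : f (x *: (1 : R)) = x * f 1 by rewrite linearZ.
  by have x1 : x *: (1 : R) = x := mulr1 x; rewrite -fZ x1.
Qed.

(** The dual norm is a supremum, not necessarily attained. *)
Lemma dual_norming (X : normedModType R) (f : dual X) (e : R) : 0 < e < 1 ->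
  exists2 u : X, `|u| <= 1 & (1 - e) * `|f| <= f u.
Proof.
move=> /andP[e0 e1]; have [f0|f0] := eqVneq `|f| 0.
  by exists 0; rewrite ?normr0// f0 mulr0 linear0.
have fpos : 0 < `|f| by rewrite lt_neqAle eq_sym f0/=.
have [_ [x x1 <-] fx] := sup_adherent (mulr_gt0 e0 fpos) (dual_has_sup f).
have {}fx : (1 - e) * `|f| <= `|f x| by rewrite mulrBl mul1r ltW.
exists ((-1) ^+ (f x < 0)%R *: x); first by rewrite normrZ normr_sign mul1r.
rewrite linearZ/=; apply: (le_trans fx); by rewrite normrEsign.
Qed.

Section ell_isometric_dual.
Variables (p q : R) (p1 : 1 <= p) (q1 : 1 <= q) (X' X : normedModType R).
Hypotheses (pq : p^-1 + q^-1 = 1).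
Local Notation E := (ell_sum p1 X).
Local Notation E' := (ell_sum q1 X').

Let p0 : 0 < p. Proof. exact: lt_le_trans p1. Qed.
Let q0 : 0 < q. Proof. exact: lt_le_trans q1. Qed.

(** The series that defines the pairing converges absolutely by Hoelder's
    inequality. *)
Lemma ell_pairing (Psi : {linear X' -> dual X}) : (forall y, `|Psi y| <= `|y|) ->
  exists T : {linear E' -> dual E}, (forall y, `|T y| <= `|y|) /\
    forall y x, (fun n => \sum_(0 <= i < n) Psi (co y i) (co x i)) @ \oo --> T y x.
Proof.
move=> PsiC.
pose s (y : E') (x : E) n := \sum_(0 <= i < n) Psi (co y i) (co x i).
have sabs (y : E') (x : E) n : \sum_(0 <= i < n) `|Psi (co y i) (co x i)| <= `|y| * `|x|.
  apply: (@le_trans _ _ (\sum_(0 <= i < n) `|co y i| * `|co x i|)).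
    apply: ler_sum => i _; rewrite (le_trans (dual_le _ _))//.
    by rewrite ler_wpM2r.
  have qp : q^-1 + p^-1 = 1 by rewrite addrC.
  apply: (hoelder_sum q0 p0 qp) => //; [exact: (ell_partial y n)|exact: (ell_partial x n)].
have scvg y x : cvgn (s y x).
  apply: (@normed_cvg R R (fun i => Psi (co y i) (co x i))).
  apply: nondecreasing_is_cvgn; first by apply: nondecreasing_series => *; exact: normr_ge0.
  by exists (`|y| * `|x|) => _ [n _ <-]; exact: sabs.
pose F y x := limn (s y x).
have sF y x : s y x @ \oo --> F y x by exact: scvg.
have FC y x : `|F y x| <= 1 * `|y| * `|x|.
  rewrite mul1r; apply: (ler_cvg_to (cvg_norm (sF y x)) (cvg_cst _)).
  apply: nearW => n; exact: le_trans (ler_norm_sum _ _ _) (sabs y x n).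
have Flin y : linear (F y).
  move=> a x z; apply: (@cvgn_real_unique (s y (a *: x + z)) _ _) => //.
  have -> : s y (a *: x + z) = fun n => a * s y x n + s y z n.
    apply/funext => n; rewrite /s mulr_sumr -big_split; apply: eq_bigr => i _ /=.
    by rewrite -[RHS](linearP (Psi (co y i)) a).
  by apply: cvgD => //; apply: cvgMr.
have lF : linear F.
  move=> a y z; apply/funext => x; apply: (@cvgn_real_unique (s (a *: y + z) x) _ _) => //.
  have -> : s (a *: y + z) x = fun n => a * s y x n + s z x n.
    apply/funext => n; rewrite /s mulr_sumr -big_split; apply: eq_bigr => i _ /=.
    have lin : Psi (a *: co y i + co z i) (co x i) =
      a * Psi (co y i) (co x i) + Psi (co z i) (co x i) by rewrite linearP.
    exact: lin.
  by apply: cvgD => //; apply: cvgMr.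
have [T [TE TC]] := dual_map_of ler01 lF Flin FC.
exists T; split=> [y|y x]; first by rewrite -[leRHS]mul1r.
by rewrite TE; exact: sF.
Qed.

(** The converse of Hoelder's inequality: [f] is tested on the finitely
    supported vectors with coordinates [|Phi (S i f)|^(q - 1) u i], where [u i]
    almost norms the [i]-th component [S i f] of [f]. *)
Lemma ell_functional_coords (Phi : {linear dual X -> X'}) :
  (forall f, `|Phi f| <= `|f|) ->
  exists T : {linear dual E -> E'}, (forall f, `|T f| <= `|f|) /\
    forall (f : dual E) i, exists2 g : dual X, (forall a, g a = f (ell_single p1 i a)) &
      co (T f) i = Phi g.
Proof.
move=> PhiC.
have /choice[S SP] i : exists S : {linear dual E -> dual X},
    (forall (f : dual E) a, S f a = f (ell_single p1 i a)) /\ forall f, `|S f| <= 1 * `|f|.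
  apply: dual_map_of => //.
  - by move=> f a x y; rewrite !linearP.
  - move=> f a; rewrite mul1r (le_trans (dual_le _ _))// ell_single_norm//.
have [||T [TE TC]] := @finite_part_map_of R (dual E) _ (ell_enorm q1 X')
    (fun f i => Phi (S i f)) 1.
- move=> a f g; apply/funext => i.
  rewrite linearP linearP; exact: erefl.
- move=> f; rewrite mul1r; apply: ell_norm_le => // n.
  set s := \sum_(_ <= _ < _) _.
  have s0 : 0 <= s by apply: sumr_ge0 => i _; exact: powR_ge0.
  have [->|sn0] := eqVneq s 0; first exact: powR_ge0.
  have spos : 0 < s by rewrite lt_neqAle eq_sym sn0.
  (* the loss e comes from norming vectors that are not exactly norming *)
  have eP (e : R) : 0 < e < 1 -> (1 - e) * s `^ q^-1 <= `|f|.
    move=> e01; have /andP[e0 e1] := e01.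
    have /choice[u uP] i : exists u : X, `|u| <= 1 /\ (1 - e) * `|S i f| <= S i f u.
      by have [u] := dual_norming (S i f) e01; exists u.
    pose t i := `|Phi (S i f)| `^ (q - 1).
    pose z := \sum_(0 <= i < n) t i *: ell_single p1 i (u i).
    have zE j : co z j = if (j < n)%N then t j *: u j else 0.
      have cE i : co (t i *: ell_single p1 i (u i)) j = if j == i then t i *: u i else 0.
        by rewrite ell_scaleE ?ell_singleE; case: eqP => _; rewrite ?scaler0.
      rewrite /z ell_sumE (eq_bigr _ (fun i _ => cE i)); case: ltnP => jn.
        rewrite (bigD1_seq j) ?mem_index_iota ?iota_uniq//= eqxx.
        by rewrite big1 ?addr0// => i; rewrite eq_sym => /negPf ->.
      rewrite big_nat big1// => i /andP[_ iN].
      by rewrite gtn_eqF// (leq_trans iN).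
    have qp : (q - 1) * p = q.
      have : q^-1 = 1 - p^-1 by rewrite -pq addrAC subrr add0r.
      move=> qE; rewrite -[q]invrK qE; field; rewrite gt_eqF//=.
      have : 0 < q^-1 by rewrite invr_gt0.
      rewrite qE subr_gt0 invf_lt1// => p_gt1.
      by rewrite gt_eqF// subr_gt0.
    have zs : `|z| `^ p <= s.
      apply: ell_lep => m; apply: (@le_trans _ _ (\sum_(0 <= i < maxn m n) `|co z i| `^ p)).
        rewrite [leRHS](big_cat_nat (leq0n m) (leq_maxl m n))/= lerDl sumr_ge0//.
      rewrite (big_cat_nat (leq0n n) (leq_maxr m n))/=.
      rewrite [X in _ + X]big_nat [X in _ + X]big1 ?addr0.
        rewrite /s !big_nat; apply: ler_sum => i /andP[_ iN].
        rewrite zE iN normrZ ger0_norm ?powR_ge0// powRM ?powR_ge0//.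
        rewrite -powRrM qp ler_piMr ?powR_ge0//.
        have -> : 1 = 1 `^ p :> R by rewrite powR1.
        by rewrite ler_powR2//; have [] := uP i.
      by move=> i /andP[ni _]; rewrite zE ltnNge ni/= normr0 powR0// gt_eqF.
    have fz : (1 - e) * s <= f z.
      rewrite /z linear_sum /s mulr_sumr; apply: ler_sum => i _.
      have [_ h] := uP i; have [SE _] := SP i.
      rewrite linearZ/= -SE.
      apply: (le_trans _ (ler_wpM2l (powR_ge0 _ _) h)).
      rewrite mulrCA ler_wpM2l ?subr_ge0 ?(ltW e1)//.
      rewrite -(@mulr_powRB1 _ `|Phi (S i f)|)// mulrC ler_wpM2l ?powR_ge0//.
    have sE : s = s `^ q^-1 * s `^ p^-1.
      rewrite -powRD ?sn0 ?implybT//.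
      by rewrite addrC pq powRr1.
    rewrite -(@ler_pM2r _ (s `^ p^-1)) ?powR_gt0// -mulrA -sE (le_trans fz)//.
    rewrite (le_trans (ler_norm _))// (le_trans (dual_le _ _))// ler_wpM2l//.
    by rewrite -(@ler_powR2 _ p)// ?powR_ge0// powRVK// gt_eqF.
  rewrite -[leLHS](@powRVK _ q) ?gt_eqF// ler_powR2 ?powR_ge0//.
  set c := s `^ q^-1; have c0 : 0 < c by rewrite powR_gt0.
  rewrite leNgt; apply/negP => fc.
  have := eP ((c - `|f|) / (2 * c)).
  have f0 := normr_ge0 f.
  rewrite divr_gt0 ?subr_gt0 ?mulr_gt0//= ltr_pdivrMr ?mulr_gt0// mul1r.
  have h : c - `|f| < 2 * c by lra.
  move=> /(_ h); rewrite -/c.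
  have -> : (1 - (c - `|f|) / (2 * c)) * c = (c + `|f|) / 2.
    by field; rewrite gt_eqF.
  lra.
exists T; split=> [f|f i]; first by rewrite -[leRHS]mul1r.
exists (S i f); first by have [SE _] := SP i; exact: SE.
by rewrite -[LHS]/(val (T f) i) TE.
Qed.

Lemma isometric_dual_ell : isometric_dual X' X -> isometric_dual E' E.
Proof.
move=> [Psi [Phi [PsiC PhiC PsiK PhiK]]].
have [T [TC Tlim]] := ell_pairing PsiC.
have [S [SC SP]] := ell_functional_coords PhiC.
exists T, S; split=> // [y|f].
  apply: ell_ext => i; have [g gE ->] := SP (T y) i.
  rewrite (_ : g = Psi (co y i)) ?PsiK//; apply: dual_eq => a; rewrite gE.
  apply: (cvgn_real_unique (Tlim y (ell_single p1 i a))).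
  apply: cvg_near_cst; exists i.+1 => // n /= ni; apply/eqP.
  rewrite (bigD1_seq i) ?mem_index_iota ?iota_uniq//= ?ell_singleE eqxx.
  rewrite big1 ?addr0// => j ji.
  by rewrite ?ell_singleE (negPf ji) linear0.
apply: dual_eq => x; apply: (cvgn_real_unique (Tlim (S f) x)).
have -> : (fun n => \sum_(0 <= i < n) Psi (co (S f) i) (co x i)) =
    fun n => f (ell_head n x).
  apply/funext => n; rewrite ell_mask_sum linear_sum; apply: eq_bigr => i _.
  by have [g gE ->] := SP f i; rewrite PhiK gE.
apply/cvgrPdist_le => e e0.
have [|N NP] := @ell_tail_small _ _ p1 X x (e / (`|f| + 1)).
  by rewrite divr_gt0// ltr_wpDl.
exists N => // n /= Nn.
have -> : f x - f (ell_head n x) = f (ell_tail n x).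
  by rewrite -{1}(ell_headtail n x) linearD addrAC subrr add0r.
rewrite (le_trans (dual_le _ _))//.
have := NP n Nn; rewrite ler_pdivlMr ?ltr_wpDl//; apply: le_trans.
by rewrite mulrC ler_wpM2l// lerDl.
Qed.

End ell_isometric_dual.

Lemma isometric_dual_prod (X' X Y' Y : normedModType R) : isometric_dual X' X -> isometric_dual Y' Y ->
  retract 2 (X' * Y')%type (dual (X * Y)%type).
Proof.
move=> [Psi [Phi [PsiC PhiC PsiK PhiK]]] [Psi2 [Phi2 [Psi2C Phi2C Psi2K Phi2K]]].
have n1 (A B : normedModType R) (z : A * B) : `|z.1| <= `|z|.
  by rewrite pair_normE le_max lexx.
have n2 (A B : normedModType R) (z : A * B) : `|z.2| <= `|z|.
  by rewrite pair_normE le_max lexx orbT.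
have [||z x|J [JE JC]] := @dual_map_of R (X' * Y')%type (X * Y)%type
    (fun z x => Psi z.1 x.1 + Psi2 z.2 x.2) 2 (ler0n _ _).
- move=> a z z'; apply/funext => x.
  have -> : (a *: z + z').1 = a *: z.1 + z'.1 by [].
  have -> : (a *: z + z').2 = a *: z.2 + z'.2 by [].
  have lin (s t s' t' : R) : (a * s + s') + (a * t + t') = a * (s + t) + (s' + t') by ring.
  by rewrite !linearP; exact: lin.
- move=> z a x x'.
  have -> : (a *: x + x').1 = a *: x.1 + x'.1 by [].
  have -> : (a *: x + x').2 = a *: x.2 + x'.2 by [].
  have lin (s t s' t' : R) : (a * s + s') + (a * t + t') = a * (s + t) + (s' + t') by ring.
  by rewrite !linearP; exact: lin.
- have -> : 2 * `|z| * `|x| = `|z| * `|x| + `|z| * `|x| by ring.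
  rewrite (le_trans (ler_normD _ _))// lerD// (le_trans (dual_le _ _))// ler_pM//.
    exact: le_trans (PsiC _) (n1 _ _ _).
  exact: le_trans (Psi2C _) (n2 _ _ _).
have [||f x|I1 [I1E I1C]] := @dual_map_of R (dual (X * Y)%type) X
    (fun f x => f (x, 0)) 1 ler01.
- by [].
- move=> f a x x'.
  have -> : (a *: x + x', 0) = a *: (x, 0) + (x', 0) :> (X * Y)%type.
    by congr pair; rewrite /= scaler0 addr0.
  by rewrite linearP.
- rewrite mul1r (le_trans (dual_le _ _))// ler_wpM2l// pair_normE/= normr0.
  by rewrite ge_max lexx normr_ge0.
have [||f x|I2 [I2E I2C]] := @dual_map_of R (dual (X * Y)%type) Y
    (fun f x => f (0, x)) 1 ler01.
- by [].
- move=> f a x x'.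
  have -> : (0, a *: x + x') = a *: (0, x) + (0, x') :> (X * Y)%type.
    by congr pair; rewrite /= scaler0 addr0.
  by rewrite linearP.
- rewrite mul1r (le_trans (dual_le _ _))// ler_wpM2l// pair_normE/= normr0.
  by rewrite ge_max lexx normr_ge0.
have [Q QE] := pair_map_of (Phi \o I1 : {linear _ -> _}) (Phi2 \o I2 : {linear _ -> _}).
exists J, Q; split=> // [f|z].
  rewrite QE pair_normE/= ge_max; apply/andP; split.
    rewrite (le_trans (PhiC _))// (le_trans (I1C _))// ler_wpM2r// ler1n//.
  rewrite (le_trans (Phi2C _))// (le_trans (I2C _))// ler_wpM2r// ler1n//.
rewrite QE [RHS]surjective_pairing /=; congr pair.
  rewrite -[RHS]PsiK; congr (Phi _); apply: dual_eq => x.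
  by rewrite I1E JE/= linear0 addr0.
rewrite -[RHS]Psi2K; congr (Phi2 _); apply: dual_eq => x.
by rewrite I2E JE/= linear0 add0r.
Qed.

End duality.

(** * Complemented subspaces *)

Section no_retract.
Context {R : realType}.
Local Notation co := finite_part_val.
Local Notation root n := (n%:R `^ (2^-1)).

(** The unit vectors and the coordinate functionals of [X_{p,w'}], for weights
    [w'] between [eps / 2] and [eps], are transported to the [l^p]-sum by [J] and
    [T], where they contradict [no_almost_biorthogonal]. The range of [T] is the
    bidual and not [X_{p,w'}] in order that [T] may be an adjoint. *)
Lemma no_weak_retract (p : R) (p2 : 2 < p) (p1 : 1 <= p) (w : nat -> R)
    (X : normedModType R) (C : R) :
  (forall i, 0 < w i) -> star_condition p w -> parallelogram X -> 0 < C ->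
  ~ (forall w', retract 1 (Xpw p1 w') (Xpw p1 w) ->
     exists (J : {linear Xpw p1 w' -> ell_sum p1 X})
            (T : {linear ell_sum p1 X -> dual (dual (Xpw p1 w'))}),
       [/\ forall x, `|J x| <= C * `|x|, forall y, `|T y| <= C * `|y| &
           forall x f, T (J x) f = f x]).
Proof.
move=> w0 wstar PX C0 H.
(* any eps <= 1 with 4 C^2 eps < 1 would do *)
pose eps := Num.min 1 (5 * C ^+ 2)^-1.
have C5 : 0 < 5 * C ^+ 2 by rewrite mulr_gt0// exprn_gt0.
have e0 : 0 < eps by rewrite lt_min ltr01 invr_gt0.
have e1 : eps <= 1 by rewrite ge_min lexx.
have e5 : 4 * C ^+ 2 * eps < 1.
  have : (5 * C ^+ 2) * eps <= 1.
    by rewrite -ler_pdivlMl// mulr1 ge_min lexx orbT.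
  have : 0 < C ^+ 2 * eps by rewrite mulr_gt0// exprn_gt0.
  lra.
have a0 : 0 < eps / 2 by rewrite divr_gt0.
have [w' [w'P /H[J [T [JC TC TJ]]]]] :=
  @star_weights _ p p2 p1 w w0 wstar (fun=> eps / 2) (fun=> a0).
have w'e j : 0 <= w' j <= eps.
  by have /andP[h1 h2] := w'P j; apply/andP; split; lra.
have w'a j : eps / 2 <= w' j by have /andP[] := w'P j.
have [b bE] := Xpw_basis p1 w'.
have bS := @Xpw_basis_signs _ p p1 w' b eps bE w'e.
have coS := @Xpw_coord_signs _ p p1 w' (eps / 2) a0 w'a.
have b1 j : `|b j| <= 1.
  have := bS [:: j] (fun=> false) isT.
  rewrite big_seq1 expr0 scale1r/= !powR1 mulr1 => /le_trans; apply.
  by rewrite ge_max lexx.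
have /choice[f fE] j : exists f : dual (Xpw p1 w'), f =1 (fun x => co x j).
  apply: (@dual_of _ _ _ 1) => [a x y|x]; first by [].
  by rewrite mul1r Xpw_coord.
have fS (s : seq nat) (e : nat -> bool) : uniq s ->
    `|\sum_(j <- s) (-1) ^+ e j *: f j| <= (eps / 2)^-1 * root (size s).
  move=> us; apply: dual_norm_leP => [|x].
    by rewrite mulr_ge0 ?powR_ge0// invr_ge0 ltW.
  have -> : (\sum_(j <- s) (-1) ^+ e j *: f j) x =
      \sum_(j <- s) (-1) ^+ e j * co x j.
    elim/big_rec2: _ => // j c g _ <-; rewrite -fE//.
  exact: coS.
have f1 j : `|f j| <= 1.
  by apply: dual_norm_leP => // x; rewrite fE mul1r Xpw_coord.
have /choice[G GE] j : exists G : {linear ell_sum p1 X -> R}, G =1 fun z => T z (f j).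
  by apply: linear_of => a x y; rewrite linearP.
have GsumE (s : seq nat) (e : nat -> bool) z :
    \sum_(j <- s) (-1) ^+ e j * G j z = T z (\sum_(j <- s) (-1) ^+ e j *: f j).
  by rewrite linear_sum; apply: eq_bigr => j _; rewrite GE linearZ.
apply: (@no_almost_biorthogonal _ p p2 p1 X (fun j => J (b j)) G C
  (C * (eps / 2)^-1) eps) => //.
- by apply: mulr_ge0; [exact: ltW|rewrite invr_ge0; exact: ltW].
- by move=> j; rewrite (le_trans (JC _))// ler_piMr// ltW.
- move=> j z; rewrite GE (le_trans (dual_le _ _))//.
  rewrite (le_trans (ler_pM _ _ (TC z) (f1 j)))// mulr1//.
- by move=> j; rewrite GE TJ fE bE eqxx.
- move=> s e us; rewrite -[X in `|X|](_ : J (\sum_(j <- s) (-1) ^+ e j *: b j) = _).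
    by rewrite (le_trans (JC _))// ler_wpM2l ?bS// ltW.
  by rewrite linear_sum; apply: eq_bigr => j _; rewrite linearZ.
- move=> s e z us; rewrite GsumE (le_trans (dual_le _ _))//.
  rewrite (le_trans (ler_pM _ _ (TC z) (fS s e us)))//.
  by rewrite le_eqVlt; apply/orP; left; apply/eqP; ring.
Qed.

Lemma parallelogram_ell2R : parallelogram (ell2 R).
Proof. exact/parallelogram_ell2/parallelogram_real. Qed.

Lemma Xpw_not_complemented (p : R) (p2 : 2 < p) (p1 : 1 <= p) (w : nat -> R) :
  (forall i, 0 < w i) -> star_condition p w ->
  ~ complementably_embeds (Xpw p1 w) (ell_sum p1 (ell2 R)).
Proof.
move=> w0 wstar /complementably_embedsP[C C0 XY].
apply: (no_weak_retract p2 w0 wstar parallelogram_ell2R C0) => w' w'w.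
have [J [Q [JC QC QJ]]] := retract_trans ler01 (ltW C0) w'w XY.
rewrite mulr1 in JC QC.
have [ev [evE evC]] := bidual_of (Xpw p1 w').
exists J, (ev \o Q : {linear _ -> _}); split=> // [y|x f] /=.
  exact: le_trans (evC _) (QC _).
by rewrite QJ evE.
Qed.

Lemma isometric_dual_ell_ell2 (p q : R) (p1 : 1 <= p) (q1 : 1 <= q) : p^-1 + q^-1 = 1 ->
  isometric_dual (ell_sum q1 (ell2 R)) (ell_sum p1 (ell2 R)).
Proof.
move=> pq; apply: isometric_dual_ell => //; apply: isometric_dual_ell; last exact: isometric_dual_real.
by field.
Qed.

(** If [Q J = id] for [J] from the dual of [X] to [(sum l^2)_p] and [Q] back, the
    adjoint of [Q], restricted to [X], maps [X] to the dual of [(sum l^2)_p],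
    which is [(sum l^2)_q], and the adjoint of [J] maps the latter to the bidual
    of [X]; their composite is the canonical embedding. *)
Lemma dual_Xpw_not_complemented (p q : R) (p1 : 1 <= p) (q2 : 2 < q) (q1 : 1 <= q)
    (w : nat -> R) : p^-1 + q^-1 = 1 ->
  (forall i, 0 < w i) -> star_condition q w ->
  ~ complementably_embeds (dual (Xpw q1 w)) (ell_sum p1 (ell2 R)).
Proof.
move=> pq w0 wstar /complementably_embedsP[C C0 XY].
apply: (no_weak_retract (p1 := q1) q2 w0 wstar parallelogram_ell2R C0) => w' w'w.
have [J [Q [JC QC QJ]]] := retract_trans ler01 (ltW C0) (retract_dual ler01 w'w) XY.
rewrite mulr1 in JC QC.
have [Psi [Phi [PsiC PhiC PsiK PhiK]]] := isometric_dual_ell_ell2 p1 q1 pq.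
have [||x y|D [DE DC]] := @dual_map_of R (Xpw q1 w') (ell_sum p1 (ell2 R))
    (fun x y => Q y x) C (ltW C0).
- by move=> a x y; apply/funext => z; rewrite linearP.
- by move=> x a y z; rewrite linearP.
- rewrite (le_trans (dual_le _ _))// mulrAC ler_wpM2r//.
have [||x y|T [TE TC]] := @dual_map_of R (ell_sum q1 (ell2 R)) (dual (Xpw q1 w'))
    (fun z f => Psi z (J f)) C (ltW C0).
- by move=> a x y; apply/funext => z; rewrite linearP.
- by move=> x a y z; rewrite !linearP.
- rewrite (le_trans (dual_le _ _))// [C * _]mulrC -mulrA ler_pM//.
exists (Phi \o D : {linear _ -> _}), T; split=> // [x|x f] /=.
  exact: le_trans (PhiC _) (DC _).
by rewrite TE PhiK DE QJ.
Qed.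

Lemma ell2_ellp_not_complemented (p : R) (p1 : 1 <= p) (X : normedModType R) :
  ~ complementably_embeds X (ell_sum p1 (ell2 R)) ->
  ~ complementably_embeds X (ell2 R * ell p1)%type.
Proof.
move=> nX /complementably_embedsP[C C0 XY]; apply: nX.
apply/complementably_embedsP; exists (2 * C); first by rewrite mulr_gt0.
exact: retract_trans (ltW C0) (ler0n _ _) XY (ell2_ellp_retract_sum p1).
Qed.

Lemma ell2_ellp_retract_Xpw (p : R) (p2 : 2 < p) (p1 : 1 <= p) (w : nat -> R) :
  (forall i, 0 < w i) -> star_condition p w ->
  retract 3 (ell2 R * ell p1)%type (Xpw p1 w).
Proof.
move=> w0 wstar.
(* the weights are only prescribed up to a factor 2, hence the division by 2 *)
pose a j : R := if odd j then 2^-1 ^+ j./2.+1 / 2 else 1.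
have a0 j : 0 < a j by rewrite /a; case: ifP => _ //; rewrite divr_gt0 ?exprn_gt0.
have [w' [w'P w'w]] := star_weights p2 p1 w0 wstar a0.
rewrite -[3]mul1r; apply: retract_trans w'w => //.
apply: ell2_ellp_retract => [|j|j]; first exact: ltW.
  by have := w'P j.*2; rewrite /a odd_double mulr1.
have := w'P j.*2.+1; rewrite /a /= odd_double /= uphalf_double mulrCA mulfV// mulr1.
by move=> /andP[h ->]; rewrite andbT (le_trans _ h)// divr_ge0// exprn_ge0.
Qed.

Lemma ell2_ellp_retract_dual_Xpw (p q : R) (p1 : 1 <= p) (q2 : 2 < q) (q1 : 1 <= q)
    (w : nat -> R) : p^-1 + q^-1 = 1 ->
  (forall i, 0 < w i) -> star_condition q w ->
  retract 6 (ell2 R * ell p1)%type (dual (Xpw q1 w)).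
Proof.
move=> pq w0 wstar.
have -> : 6 = 3 * 2 :> R by ring.
apply: retract_trans (retract_dual _ (ell2_ellp_retract_Xpw q2 q1 w0 wstar)) => //.
apply: isometric_dual_prod; apply: isometric_dual_ell; try exact: isometric_dual_real.
  by field.
by rewrite addrC.
Qed.

End no_retract.

(** * The space L^p *)

Section Lspace_facts.
Context d {T : measurableType d} {R : realType}.
Variable mu : {measure set T -> \bar R}.
Hypothesis mu1 : (mu setT <= 1)%E.
Variables (p : R) (p2 : 2 < p) (p1 : 1 <= p).
Local Notation Z := (Defs.Lspace mu p1).
Local Notation cls := (@ae_class _ _ _ mu).
Implicit Types (f g : {mfun T >-> R}) (z : Z).

Let p0 : 0 < p. Proof. exact: lt_le_trans p1. Qed.

Let measurable_pow f : measurable_fun setT (fun x => (`|f x| `^ p)%:E).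
Proof.
apply/measurable_EFinP; apply: (measurableT_comp (measurable_powR p)) => //.
exact: measurableT_comp.
Qed.

Let pow_ge0 f x : (0 <= (`|f x| `^ p)%:E)%E.
Proof. by rewrite lee_fin powR_ge0. Qed.

Lemma mfun_of (f : T -> R) : measurable_fun setT f ->
  exists g : {mfun T >-> R}, g =1 f.
Proof.
move=> mf.
pose g : {mfun T >-> R} := HB.pack f (isMeasurableFun.Build _ _ _ _ f mf).
by exists g.
Qed.

Lemma Lspace_powE z f : finite_part_val z = cls f ->
  ((`|z| `^ p)%:E = \int[mu]_x (`|f x| `^ p)%:E)%E.
Proof.
move=> zf; have : (`|z|%:E = 'N[mu]_(p%:E)[EFin \o f])%E.
  by rewrite [LHS]finite_part_normE /= -Lspace_norm_class -zf.
by rewrite -poweR_EFin => ->; rewrite powR_Lnorm// gt_eqF.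
Qed.

Lemma Lspace_rep z : exists f, finite_part_val z = cls f.
Proof. by exists (ae_repr (finite_part_val z)); rewrite ae_reprK. Qed.

Lemma Lspace_of f (B : R) : 0 <= B -> (forall x, `|f x| <= B) ->
  exists2 z : Z, finite_part_val z = cls f & `|z| <= B.
Proof.
move=> B0 fB.
have N : (Lspace_norm p (cls f) <= B%:E)%E.
  rewrite Lspace_norm_class unlock (@le_trans _ _ ((B `^ p)%:E `^ p^-1)%E)//; last first.
    by rewrite poweR_EFin powRK// gt_eqF.
  have m0 : (0 <= \int[mu]_x `|(EFin \o f) x| `^ p)%E.
    by apply: integral_ge0 => x _; exact: poweR_ge0.
  apply: gt0_ler_poweR; rewrite ?invr_ge0 ?in_itv/= ?leey ?andbT ?(ltW p0)//.
    by rewrite lee_fin powR_ge0.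
  apply: (@le_trans _ _ (\int[mu]_x (B `^ p)%:E)%E).
    apply: ge0_le_integral => //.
    - by move=> x _; rewrite lee_fin ler_powR2// (le_trans _ (fB x)).
  by rewrite integral_cst// -[leRHS]mule1 lee_wpmul2l// lee_fin powR_ge0//.
have zfin : cls f \in enorm_fin (Lspace_enorm mu p1).
  by rewrite unfold_in /enorm_fin; exact: le_lt_trans N (ltry _).
exists (FinitePart zfin) => //.
by rewrite -lee_fin [leLHS]finite_part_normE.
Qed.

Definition sq_int f : \bar R := (\int[mu]_x ((f x) ^+ 2)%:E)%E.
(** The square of the [L^2] norm, which is finite on [L^p] as [p > 2] and the
    measure is finite. *)
Definition sq_form z : R := fine (sq_int (ae_repr (finite_part_val z))).

Let measurable_sq f : measurable_fun setT (fun x => ((f x) ^+ 2)%:E).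
Proof. by apply/measurable_EFinP; exact: measurable_funX. Qed.

Lemma sq_int_ge0 f : (0 <= sq_int f)%E.
Proof. by apply: integral_ge0 => x _; rewrite lee_fin sqr_ge0. Qed.

Lemma sq_int_class f g : cls f = cls g -> sq_int f = sq_int g.
Proof.
move=> /ae_classP fg; apply: ae_eq_integral => //.
by apply: filterS fg => x fg _; rewrite fg.
Qed.

Lemma sq_formE z f : finite_part_val z = cls f -> sq_form z = fine (sq_int f).
Proof. by move=> zf; congr fine; apply: sq_int_class; rewrite ae_reprK. Qed.

(** With [s = |z|], integrate the inequality
    [t^2 <= s^2 + s^(2 - p) |t|^p], which is clear for [|t| <= s] as well as for
    [|t| >= s]. *)
Lemma sq_int_le z f : finite_part_val z = cls f ->
  (sq_int f <= (2 * `|z| ^+ 2)%:E)%E.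
Proof.
move=> zf; have [z0|z0] := eqVneq z 0.
  rewrite (@sq_int_class f 0); last by rewrite -zf z0.
  rewrite /sq_int (eq_integral (fun=> 0%E)) ?integral0 ?lee_fin ?mulr_ge0 ?sqr_ge0//.
  by move=> x _; rewrite expr0n.
have s0 : 0 < `|z| by rewrite normr_gt0.
set s := `|z| in s0 *.
have pt (t : R) : t ^+ 2 <= s ^+ 2 + s `^ (2 - p) * `|t| `^ p.
  have [ts|st] := lerP `|t| s.
    rewrite -[t ^+ 2]real_normK ?num_real// -[leLHS]addr0 lerD//.
      by rewrite lerXn2r ?nnegrE// ltW.
    by rewrite mulr_ge0 ?powR_ge0.
  have t0 : 0 < `|t| by exact: lt_trans st.
  rewrite -[leLHS]add0r lerD ?sqr_ge0//.
  have -> : `|t| `^ p = t ^+ 2 * `|t| `^ (p - 2).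
    rewrite -[t ^+ 2]real_normK ?num_real// -powR2// -powRD ?(gt_eqF t0) ?implybT//.
    by congr (_ `^ _); ring.
  rewrite mulrCA ler_peMr ?sqr_ge0//.
  have -> : 2 - p = - (p - 2) by ring.
  rewrite powRN mulrC ler_pdivlMr ?powR_gt0// mul1r.
  by apply: ge0_ler_powR; rewrite ?nnegrE ?(ltW s0) ?(ltW st)// subr_ge0 ltW.
apply: (@le_trans _ _ (\int[mu]_x ((s ^+ 2)%:E + (s `^ (2 - p))%:E * (`|f x| `^ p)%:E))%E).
  apply: ge0_le_integral => //.
  - by move=> x _; rewrite lee_fin sqr_ge0.
  - apply: emeasurable_funD => //; exact: measurable_funeM.
  - by move=> x _; rewrite -EFinM -EFinD lee_fin.
rewrite ge0_integralD//; last 3 first.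
- by move=> x _; rewrite lee_fin sqr_ge0.
- by move=> x _; rewrite -EFinM lee_fin mulr_ge0// powR_ge0.
- exact: measurable_funeM.
rewrite ge0_integralZl_EFin ?powR_ge0//.
rewrite -(Lspace_powE zf) integral_cst// -/s -EFinM -powRD; last first.
  by rewrite (gt_eqF s0) implybT.
rewrite subrK powR2 ?(ltW s0)//.
have -> : 2 * s ^+ 2 = s ^+ 2 + s ^+ 2 by ring.
rewrite EFinD leeD2r// -[leRHS]mule1 lee_wpmul2l// lee_fin sqr_ge0//.
Qed.

Lemma sq_form_le z : sq_form z <= 2 * `|z| ^+ 2.
Proof.
have [f zf] := Lspace_rep z; rewrite (sq_formE zf) -lee_fin fineK ?sq_int_le//.
by rewrite ge0_fin_numE ?sq_int_ge0// (le_lt_trans (sq_int_le zf))// ltry.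
Qed.

Lemma Lspace_add_rep z z' f g : finite_part_val z = cls f -> finite_part_val z' = cls g ->
  finite_part_val (z + z') = cls (f + g).
Proof.
by move=> zf zg; rewrite -ae_addE -zf -zg.
Qed.

Lemma Lspace_scale_rep (a : R) z f : finite_part_val z = cls f ->
  finite_part_val (a *: z) = cls (a *: f).
Proof. by move=> zf; rewrite -ae_scaleE -zf. Qed.

Lemma Lspace_sub_rep z z' f g : finite_part_val z = cls f -> finite_part_val z' = cls g ->
  finite_part_val (z - z') = cls (f - g).
Proof.
move=> zf zg; apply: Lspace_add_rep => //.
by rewrite -[RHS]ae_oppE -zg.
Qed.

Lemma sq_form_parallelogram z z' :
  sq_form (z + z') + sq_form (z - z') = sq_form z *+ 2 + sq_form z' *+ 2.
Proof.
have [f zf] := Lspace_rep z; have [g zg] := Lspace_rep z'.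
have zD := Lspace_add_rep zf zg; have zB := Lspace_sub_rep zf zg.
have sqK h (y : Z) : finite_part_val y = cls h -> ((sq_form y)%:E = sq_int h)%E.
  move=> yh; rewrite (sq_formE yh) fineK// ge0_fin_numE ?sq_int_ge0//.
  by rewrite (le_lt_trans (sq_int_le yh))// ltry.
apply: EFin_inj; rewrite !mulr2n !EFinD !(sqK _ _ zf) !(sqK _ _ zg) !(sqK _ _ zD) !(sqK _ _ zB).
have DE (h k : {mfun T >-> R}) : (sq_int h + sq_int k =
    \int[mu]_x ((h x) ^+ 2 + (k x) ^+ 2)%:E)%E.
  rewrite /sq_int -ge0_integralD//; first by move=> x _; rewrite lee_fin sqr_ge0.
  by move=> x _; rewrite lee_fin sqr_ge0.
rewrite addeACA !DE -ge0_integralD//.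
- apply: eq_integral => x _; rewrite -EFinD; congr EFin.
  have -> : (f + g) x = f x + g x by [].
  have -> : (f - g) x = f x - g x by [].
  by ring.
- by move=> x _; rewrite lee_fin addr_ge0// sqr_ge0.
- by apply/measurable_EFinP/measurable_funD; exact: measurable_funX.
- by move=> x _; rewrite lee_fin addr_ge0// sqr_ge0.
- by apply/measurable_EFinP/measurable_funD; exact: measurable_funX.
Qed.

Lemma Lspace_disjointD z z' f g : finite_part_val z = cls f -> finite_part_val z' = cls g ->
  (forall x, f x = 0 \/ g x = 0) -> `|z + z'| `^ p <= `|z| `^ p + `|z'| `^ p.
Proof.
move=> zf zg fg; rewrite -lee_fin EFinD (Lspace_powE zf) (Lspace_powE zg).
rewrite (Lspace_powE (Lspace_add_rep zf zg)).
rewrite -ge0_integralD//.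
apply: ge0_le_integral => //.
  exact: emeasurable_funD.
move=> x _; rewrite -EFinD lee_fin.
have -> : (f + g) x = f x + g x by [].
by case: (fg x) => ->; rewrite normr0 powR0 ?gt_eqF// ?add0r ?addr0.
Qed.

(** The disjoint subspaces are those of the classes supported on the [A k], and
    the Hilbert norm is that of [L^2]. *)
Lemma not_embeds_Lspace (w : nat -> R) (A : nat -> set T)
    (h : nat -> nat -> {mfun T >-> R}) (c : nat -> R) :
  (forall k l x, A k x -> A l x -> k = l) ->
  (forall k j x, ~ A k x -> h k j x = 0) -> (forall k j x, `|h k j x| <= 1) ->
  (forall k, 0 < c k) ->
  (forall k j l, j != l -> ((c k)%:E <= sq_int (h k j - h k l)%R)%E) ->
  ~ embeds Z (Xpw p1 w).
Proof.
move=> Adisj hA h1 c0 hc /embeds_Xpw[U [S [B [B0 UB SB USB]]]].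
pose D k (z : Z) := exists2 f, finite_part_val z = cls f & forall x, ~ A k x -> f x = 0.
have /choice[H HP] (kj : nat * nat) : exists z : Z,
    finite_part_val z = cls (h kj.1 kj.2) /\ `|z| <= 1.
  by have [z] := @Lspace_of (h kj.1 kj.2) 1 ler01 (h1 kj.1 kj.2); exists z.
apply: (@no_embedding_sum R p p2 p1 (ell2 R) Z U S B D (fun=> sq_form) (fun=> 2) c
  (fun k j => H (k, j))) => //.
- exact/parallelogram_ell2/parallelogram_real.
- by move=> k; exists 0.
- move=> k x y [f xf f0] [g yg g0]; exists (f + g); first exact: Lspace_add_rep.
  move=> t At; have -> : (f + g) t = f t + g t by [].
  by rewrite f0// g0// addr0.
- move=> k a x [f xf f0]; exists (a *: f); first exact: Lspace_scale_rep.
  move=> t At; have -> : (a *: f) t = a * f t by [].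
  by rewrite f0// mulr0.
- by move=> k x y _ _; exact: sq_form_parallelogram.
- by move=> k x _; exact: sq_form_le.
- by move=> k j; have [Hh _] := HP (k, j); exists (h k j) => // x; exact: hA.
- by move=> k j; have [_ H1] := HP (k, j); rewrite (le_trans H1)// ler1n.
- move=> k j l jl; have [Hj _] := HP (k, j); have [Hl _] := HP (k, l).
  have HB := Lspace_sub_rep Hj Hl.
  rewrite (sq_formE HB) -lee_fin fineK; first exact: hc.
  by rewrite ge0_fin_numE ?sq_int_ge0// (le_lt_trans (sq_int_le HB))// ltry.
- move=> n z Dz.
  suff [f _ [_ ?]] : exists2 f, finite_part_val (\sum_(0 <= k < n) z k) = cls f &
      (forall x, (forall k, (k < n)%N -> ~ A k x) -> f x = 0) /\
      `|\sum_(0 <= k < n) z k| `^ p <= \sum_(0 <= k < n) `|z k| `^ p by [].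
  elim: n => [|n [f sf [f0 IH]]].
    exists 0; first by rewrite big_geq.
    by split=> //; rewrite !big_geq// normr0 powR0// gt_eqF.
  have [g zg g0] := Dz n.
  rewrite !big_nat_recr//=; exists (f + g); first exact: Lspace_add_rep.
  split.
    move=> x An; have -> : (f + g) x = f x + g x by [].
    rewrite f0 ?g0 ?addr0// => [|k kn]; first exact: An.
    by apply: An; rewrite ltnS ltnW.
  apply: (le_trans (Lspace_disjointD sf zg _)); last by rewrite lerD2r.
  move=> x; have [An|An] := pselect (A n x); last by right; exact: g0.
  left; apply: f0 => k kn Ak; have := Adisj _ _ _ An Ak.
  by move=> nk; move: kn; rewrite nk ltnn.
Qed.

End Lspace_facts.

(** * Cosines on disjoint intervals *)

Section trig.
Context {R : realType}.

Lemma sin_natpi n : sin (n%:R * pi) = 0 :> R.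
Proof.
elim: n => [|n IH]; first by rewrite mul0r sin0.
by rewrite -natr1 mulrDl mul1r sinDpi IH oppr0.
Qed.

Lemma is_derive_sin_scale (c x : R) : c != 0 ->
  is_derive x 1 (fun y => sin (c * y) * c^-1) (cos (c * x)).
Proof.
move=> c0.
have d1 : is_derive x 1 (fun y : R => c * y) c.
  have := @is_deriveZ _ _ _ id c x 1 1 (is_derive_id _ _).
  by rewrite [c *: 1]mulr1.
have d2 := @is_derive1_comp _ sin (fun y => c * y) x (cos (c * x)) c (is_derive_sin _) d1.
have -> : (fun y => sin (c * y) * c^-1) = c^-1 \*: (sin \o (fun y => c * y)).
  by apply/funext => y; rewrite /= mulrC.
have -> : cos (c * x) = c^-1 *: (cos (c * x) * c).
  by rewrite /GRing.scale/= mulrCA mulVf ?mulr1.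
exact: (@is_deriveZ _ _ _ (sin \o (fun y => c * y)) c^-1 x 1 _ d2).
Qed.

(** A primitive of [(cos (a x) - cos (b x))^2], found by linearizing the
    square. *)
Definition sq_primitive (a b x : R) : R :=
  x + sin (2 * a * x) * (2 * a)^-1 * 2^-1 + sin (2 * b * x) * (2 * b)^-1 * 2^-1
  - sin ((a + b) * x) * (a + b)^-1 - sin ((a - b) * x) * (a - b)^-1.

Lemma is_derive_sq_primitive (a b x : R) :
  a != 0 -> b != 0 -> a + b != 0 -> a - b != 0 ->
  is_derive x 1 (sq_primitive a b) ((cos (a * x) - cos (b * x)) ^+ 2).
Proof.
move=> a0 b0 ab aB.
have a20 : 2 * a != 0 by rewrite mulf_neq0.
have b20 : 2 * b != 0 by rewrite mulf_neq0.
have dZ (f : R -> R) (df : R) : is_derive x 1 f df -> is_derive x 1 (fun y => f y * 2^-1) (df * 2^-1).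
  move=> fd; have -> : (fun y => f y * 2^-1) = 2^-1 \*: f.
    by apply/funext => y; rewrite /= mulrC.
  by rewrite mulrC; exact: (@is_deriveZ _ _ _ f 2^-1 x 1 _ fd).
have dD (f g : R -> R) (df dg : R) : is_derive x 1 f df -> is_derive x 1 g dg ->
    is_derive x 1 (fun y => f y + g y) (df + dg).
  by move=> fd gd; exact: (@is_deriveD _ _ _ f g x 1 df dg fd gd).
have dB (f g : R -> R) (df dg : R) : is_derive x 1 f df -> is_derive x 1 g dg ->
    is_derive x 1 (fun y => f y - g y) (df - dg).
  by move=> fd gd; exact: (@is_deriveB _ _ _ f g x 1 df dg fd gd).
have := dB _ _ _ _ (dB _ _ _ _ (dD _ _ _ _ (dD _ _ _ _ (is_derive_id x (1 : R))
  (dZ _ _ (is_derive_sin_scale x a20))) (dZ _ _ (is_derive_sin_scale x b20)))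
  (is_derive_sin_scale x ab)) (is_derive_sin_scale x aB).
rewrite (_ : 1 + _ + _ - _ - _ = (cos (a * x) - cos (b * x)) ^+ 2); first exact.
have cos2 (c : R) : cos (2 * c * x) = 2 * cos (c * x) ^+ 2 - 1.
  have -> : 2 * c * x = c * x + c * x by ring.
  by rewrite cosD -!expr2 sin2cos2; ring.
by rewrite !cos2 [(a + b) * x]mulrDl [(a - b) * x]mulrBl cosD cosB; field.
Qed.

Lemma integral_sq_diff_cos (a b s t : R) : s < t ->
  a != 0 -> b != 0 -> a + b != 0 -> a - b != 0 ->
  (\int[lebesgue_measure]_(x in `[s, t]) ((cos (a * x) - cos (b * x)) ^+ 2)%:E =
    (sq_primitive a b t - sq_primitive a b s)%:E)%E.
Proof.
move=> st a0 b0 ab aB; rewrite EFinB.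
have dG x := is_derive_sq_primitive x a0 b0 ab aB.
have cG x : {for x, continuous (sq_primitive a b)}.
  by apply/differentiable_continuous/derivable1_diffP; have [] := dG x.
apply: continuous_FTC2 => //.
- apply: continuous_subspaceT => x.
  have cc (c : R) : {for x, continuous (fun y : R => cos (c * y))}.
    apply: continuous_comp; last exact: continuous_cos.
    exact: mulrl_continuous.
  have cB : {for x, continuous (fun y => cos (a * y) - cos (b * y))}.
    exact: (continuousB (cc a) (cc b)).
  exact: (continuousM cB cB).
- split.
  + by move=> x _; have [] := dG x.
  + exact/cvg_at_right_filter/cG.
  + exact/cvg_at_left_filter/cG.
- by move=> x _; rewrite derive1E; have [_ ->] := dG x.
Qed.

Lemma integral_sq_diff_cos_periods (j l m : nat) (N : R) : 0 < N -> j != l ->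
  (\int[lebesgue_measure]_(x in `[(m%:R / N)%R, (m.+1%:R / N)%R])
    ((cos (pi * 2 * j.+1%:R * N * x) - cos (pi * 2 * l.+1%:R * N * x)) ^+ 2)%:E =
   (N^-1)%:E)%E.
Proof.
move=> N0 jl.
pose a : R := pi * 2 * j.+1%:R * N; pose b : R := pi * 2 * l.+1%:R * N.
have pi0 : 0 < pi :> R by exact: pi_gt0.
have a0 : 0 < a by rewrite !mulr_gt0.
have b0 : 0 < b by rewrite !mulr_gt0.
have ab : a - b != 0.
  rewrite subr_eq0; apply/eqP => /(mulIf (lt0r_neq0 N0)).
  have p20 : pi * 2 != 0 :> R by rewrite mulf_neq0// gt_eqF.
  by move=> /(mulfI p20)/eqP; rewrite eqr_nat eqSS (negPf jl).
have st : m%:R / N < m.+1%:R / N by rewrite ltr_pM2r ?invr_gt0// ltr_nat.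
rewrite -/a -/b (integral_sq_diff_cos st (lt0r_neq0 a0) (lt0r_neq0 b0)
  (lt0r_neq0 (addr_gt0 a0 b0)) ab).
have sin0k (k : nat) : sq_primitive a b (k%:R / N) = k%:R / N.
  have N1 : N * (k%:R / N) = k%:R by rewrite mulrCA mulfV ?mulr1// gt_eqF.
  have s1 (i : nat) : sin (2 * (pi * 2 * i%:R * N) * (k%:R / N)) = 0.
    rewrite -!mulrA N1 -(sin_natpi (4 * i * k)%N); congr sin.
    by rewrite !natrM; ring.
  have s2 : sin ((a + b) * (k%:R / N)) = 0.
    rewrite /a /b -mulrDl -!mulrA N1 -(sin_natpi (2 * (j.+1 + l.+1) * k)%N); congr sin.
    by rewrite !natrM !natrD; ring.
  have s3 : sin ((a - b) * (k%:R / N)) = 0.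
    have sE (i i' : nat) : (i' <= i)%N ->
        sin ((pi * 2 * i.+1%:R * N - pi * 2 * i'.+1%:R * N) * (k%:R / N)) = 0 :> R.
      move=> ii; rewrite -mulrBl -!mulrA N1 -(sin_natpi (2 * (i.+1 - i'.+1) * k)%N); congr sin.
      by rewrite !natrM natrB ?ltnS//; ring.
    have [jl'|lj] := leqP l j; first exact: sE.
    by rewrite -opprB mulNr sinN sE ?oppr0// ltnW.
  by rewrite /sq_primitive !s1 s2 s3 !mul0r !addr0 !subr0.
by rewrite !sin0k -mulrBl -natr1 addrAC subrr add0r mul1r.
Qed.

End trig.

Section Lp01.
Context {R : realType} (p : R) (p2 : 2 < p) (p1 : 1 <= p).
Local Notation leb := (@lebesgue_measure R).
Local Notation mu := (mrestr leb (measurable_itv `]0%R, 1%R[)).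

(** The functions [cos (2 pi j N x)], with [N = 4^(k+1)] and [j > 0], have whole
    periods on the interval from [2 / N] to [3 / N], so that they are orthogonal
    in [L^2] of that interval; for different [k] these intervals are disjoint. *)
Lemma not_embeds_Lp01 (w : nat -> R) : ~ embeds (Lp01 p1) (Xpw p1 w).
Proof.
pose N k : R := 4 ^+ k.+1.
have N0 k : 0 < N k by rewrite exprn_gt0.
pose A k : set R := [set` `[2%:R / N k, 3%:R / N k]].
have mA k : measurable (A k) by exact: measurable_itv.
pose F k j x := cos (pi * 2 * j.+1%:R * N k * x) * \1_(A k) x.
have cosm (c : R) : measurable_fun setT (fun x : R => cos (c * x)).
  apply: continuous_measurable_fun => x.
  apply: continuous_comp; last exact: continuous_cos.
  exact: mulrl_continuous.
have mF k j : measurable_fun setT (F k j : R -> R).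
  by apply: measurable_funM => //; exact: measurable_indic.
have /choice[h hE] (kj : nat * nat) :
    exists f : {mfun (measurableTypeR R) >-> R}, f =1 F kj.1 kj.2.
  by apply: mfun_of; exact: mF.
have mu1 : (mu setT <= 1)%E.
  by rewrite /mrestr/= setTI lebesgue_measure_itv/= lte_fin ltr01 oppr0 adde0.
apply: (@not_embeds_Lspace _ _ _ mu mu1 p p2 p1 w A (fun k j => h (k, j))
  (fun k => (N k)^-1)).
- have dis k l x : (k < l)%N -> A k x -> ~ A l x.
    move=> kl; rewrite /A /= !in_itv/= => /andP[kx _] /andP[_ xl].
    have : 2 / N k <= 3 / N l by exact: le_trans xl.
    rewrite ler_pdivlMr// mulrAC ler_pdivrMr// /N => h1.
    have : 4 * N k <= N l.
      by rewrite /N -exprS ler_weXn2l// ler1n.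
    by have := N0 k; rewrite /N in h1 *; lra.
  move=> k l x Ak Al; apply/eqP; case: ltngtP => // kl.
    by case: (dis _ _ _ kl Ak Al).
  by case: (dis _ _ _ kl Al Ak).
- by move=> k j x Ak; rewrite hE /F /= indicE memNset// mulr0.
- move=> k j x; rewrite hE /F /= normrM indicE.
  have c1 : `|cos (pi * 2 * j.+1%:R * N k * x)| <= 1.
    by rewrite ler_norml cos_geN1 cos_le1.
  by case: (x \in A k); rewrite /= ?normr1 ?normr0 ?mulr1 ?mulr0.
- by move=> k; rewrite invr_gt0.
move=> k j l jl.
have -> : sq_int mu (h (k, j) - h (k, l))%R = (\int[mu]_(x in A k)
    ((h (k, j) x - h (k, l) x) ^+ 2)%:E)%E.
  rewrite [RHS]integral_mkcond; apply: eq_integral => x _; rewrite patchE.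
  have -> : (h (k, j) - h (k, l)) x = h (k, j) x - h (k, l) x by [].
  case: ifPn => // xA; rewrite !hE /F /= indicE (negPf xA) !mulr0 subrr expr0n//.
rewrite (eq_measure_integral leb); last first.
  move=> B mB BA; rewrite [LHS]/(leb (B `&` [set` `]0%R, 1%R[])).
  rewrite setIidl// => x /BA.
  rewrite /A /= !in_itv/= => /andP[x2 x3]; apply/andP; split.
    by rewrite (lt_le_trans _ x2)// divr_gt0.
  rewrite (le_lt_trans x3)// ltr_pdivrMr// mul1r (@lt_le_trans _ _ 4)//.
    by rewrite ltr_nat.
  by rewrite /N exprS ler_peMr// exprn_ege1// ler1n.
rewrite -(integral_sq_diff_cos_periods 2 (N0 k) jl) le_eqVlt; apply/orP; left.
by apply/eqP/eq_integral => x xA; rewrite !hE /F /= indicE xA !mulr1.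
Qed.

End Lp01.

(** * The theorem *)

Theorem proposition2p24 (R : realType) :
  (forall (p : R) (p_gt2 : 2 < p) (w : nat -> R),
    (forall n, 0 < w n) -> star_condition p w ->
    let p_ge1 := gt2_ge1 p_gt2 in
    let Xp := Xpw p_ge1 w in
    let ell2_ellp := (ell2 R * ell p_ge1)%type in
    [/\ (* a *) embeds Xp ell2_ellp,
        (* b *) complementably_embeds ell2_ellp Xp &
        (* c *) mutually_embed Xp ell2_ellp] /\
    [/\ (* d *) ~ complementably_embeds Xp ell2_ellp,
        (* e *) ~ embeds (ell_sum p_ge1 (ell2 R)) Xp,
        (* f *) ~ complementably_embeds Xp (ell_sum p_ge1 (ell2 R)) &
        (* g *) ~ embeds (Lp01 p_ge1) Xp]) /\
  (* h *)
  (forall (p q : R) (p_gt1 : 1 < p) (p_lt2 : p < 2) (pq : p^-1 + q^-1 = 1)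
      (w : nat -> R),
    (forall n, 0 < w n) -> star_condition q w ->
    let p_ge1 := ltW p_gt1 in
    let Xp := dual (Xpw (conjugate_ge1 p_gt1 pq) w) in
    let ell2_ellp := (ell2 R * ell p_ge1)%type in
    [/\ complementably_embeds ell2_ellp Xp,
        ~ complementably_embeds Xp ell2_ellp &
        ~ complementably_embeds Xp (ell_sum p_ge1 (ell2 R))]).
Proof.
split=> [p p_gt2 w w0 wstar p_ge1 Xp ell2_ellp|
    p q p_gt1 p_lt2 pq w w0 wstar p_ge1 Xp ell2_ellp].
  have a : embeds Xp ell2_ellp by exact: Xpw_embeds.
  have b : complementably_embeds ell2_ellp Xp.
    apply/complementably_embedsP; exists 3 => //.
    exact: ell2_ellp_retract_Xpw.
  have f : ~ complementably_embeds Xp (ell_sum p_ge1 (ell2 R)).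
    exact: Xpw_not_complemented.
  split; split=> //.
  - by split=> //; exact: complementably_embeds_embeds.
  - exact: ell2_ellp_not_complemented.
  - exact: not_embeds_ell_sum.
  - exact: not_embeds_Lp01.
have q_gt2 : 2 < q.
  have p0 : 0 < p by rewrite (lt_trans _ p_gt1).
  have qE : q^-1 = 1 - p^-1 by rewrite -pq addrAC subrr add0r.
  have : 2^-1 < p^-1 by rewrite ltf_pV2 ?posrE.
  have : p^-1 < 1 by rewrite invf_lt1.
  move=> p1 p2; rewrite -[q]invrK qE -[2]invrK ltf_pV2 ?posrE; lra.
have f : ~ complementably_embeds Xp (ell_sum p_ge1 (ell2 R)).
  exact: dual_Xpw_not_complemented.
split=> //; last exact: ell2_ellp_not_complemented.
apply/complementably_embedsP; exists 6 => //.
exact: ell2_ellp_retract_dual_Xpw.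
Qed.
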